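(* Let $(P,\omega)$ be a symplectic manifold of dimension $2m$, let $\mu=\frac{1}{m!}\wedge^m\omega$, let $f$ be a non-vanishing smooth function on $P$, and let $\nu=f\mu$. Let $\{e_1,\dots,e_{2m}\}$ be a local frame field on some local chart $U$ in $P$ and $\{\theta^1,\dots,\theta^{2m}\}$ its dual coframe field. If $P$ has a Poisson connection $D$ whose torsion is vanishing, then the modular operator with respect to the volume form $\nu$ is given on $U$, for every $A\in\mathfrak{X}^a(P)$, by \[ \Lambda_{\nu}^a|_UA=(-1)^a\sum_{i,j=1}^{2m}(\mathcal{L}_{\sharp\theta^i}\log|f|)\,\omega(e_i,e_j)\,D_{\theta^j}A+\sum_{i,j=1}^{2m}\biggl\{\sum_{k=1}^{2m}(\mathcal{L}_{\sharp\theta^k}\log|f|)\,\Gamma^{ij}_k-\mathcal{L}_{\sharp\theta^i}\mathcal{L}_{\sharp\theta^j}\log|f|\biggr\}\,e_i\wedge i(\flat(e_j))A, \] where the functions $\Gamma^{ij}_k$ on $U$ are defined by $D_{\theta^i}\theta^j=\sum_{k}\Gamma^{ij}_k\theta^k$.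
   Context: $\mathfrak{X}^k(P)=\Gamma^\infty(\wedge^kTP)$ and $\Omega^k(P)=\Gamma^\infty(\wedge^kT^*P)$; the pairing is $\langle\alpha_1\wedge\cdots\wedge\alpha_k,X_1\wedge\cdots\wedge X_k\rangle=\det(\alpha_i(X_j))$. Symplectic conventions: $\flat:\mathfrak{X}^1(P)\to\Omega^1(P)$, $\flat(X)=\omega(X,\cdot)$, is invertible with inverse $\sharp$; the Poisson bivector $\Pi$ of $\omega$ is defined by $\langle\beta\wedge\alpha,\Pi\rangle=\beta(\sharp\alpha)$ for 1-forms $\alpha,\beta$. Interior products: for $A\in\mathfrak{X}^a(P)$, $\eta\in\Omega^p(P)$: if $p\ge a$, $i(A)\eta\in\Omega^{p-a}(P)$ is given by $\langle i(A)\eta,B\rangle=\langle\eta,A\wedge B\rangle$ for all $(p-a)$-vector fields $B$; if $a\ge p$, $i(\eta)A\in\mathfrak{X}^{a-p}(P)$ is given by $\langle\tau,i(\eta)A\rangle=\langle\tau\wedge\eta,A\rangle$ for all $(a-p)$-forms $\tau$; they are $0$ in the remaining cases. Schouten bracket: for $A\in\mathfrak{X}^a$, $B\in\mathfrak{X}^b$, writing $A(F_1,\dots,F_a)=A(dF_1,\dots,dF_a)$, \[ \begin{aligned}[] [A,B]_{\mathrm S}(F_1,\dots,F_{a+b-1})&=\sum_{\sigma\in\mathfrak{S}_{b,a-1}}\mathrm{sgn}(\sigma)A\bigl(B(F_{\sigma(1)},\dots,F_{\sigma(b)}),F_{\sigma(b+1)},\dots,F_{\sigma(a+b-1)}\bigr)\\&\quad-(-1)^{(a-1)(b-1)}\sum_{\sigma\in\mathfrak{S}_{a,b-1}}\mathrm{sgn}(\sigma)B\bigl(A(F_{\sigma(1)},\dots,F_{\sigma(a)}),F_{\sigma(a+1)},\dots,F_{\sigma(a+b-1)}\bigr),\end{aligned}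 \] where $\mathfrak{S}_{p,q}$ is the set of $(p,q)$-shuffles (empty sum if $p$ or $q$ is negative). The Poisson coboundary operator is $\partial_\Pi^a:\mathfrak{X}^a(P)\to\mathfrak{X}^{a+1}(P)$, $\partial_\Pi^a(A)=-[A,\Pi]_{\mathrm S}$. For a volume form $\nu$ on $P$, $\nu^\flat(A)=i(A)\nu$ is an isomorphism $\mathfrak{X}^a(P)\to\Omega^{2m-a}(P)$ with inverse $\nu^\sharp$, and the curl operator is $\mathfrak{C}_\nu^a=\nu^\sharp\circ d\circ\nu^\flat:\mathfrak{X}^a(P)\to\mathfrak{X}^{a-1}(P)$. The $a$-th modular operator with respect to $\nu$ is $\Lambda_\nu^a=\mathfrak{C}_\nu^{a+1}\circ\partial_\Pi^a-\partial_\Pi^{a-1}\circ\mathfrak{C}_\nu^a:\mathfrak{X}^a(P)\to\mathfrak{X}^a(P)$; $\Lambda_\nu^a|_U$ is its restriction to $U$. A contravariant derivative $D$ assigns to 1-forms $\eta,\alpha$ a 1-form $D_\eta\alpha$, $\mathbb{R}$-linearly in $\alpha$, $C^\infty(P)$-linearly in $\eta$, with $D_\eta(h\alpha)=hD_\eta\alpha+((\sharp\eta)h)\alpha$ for functions $h$. It extends to multivector fields by $\langle\alpha_1\wedge\cdots\wedge\alpha_a,D_\eta A\rangle=(\sharp\eta)\langle\alpha_1\wedge\cdots\wedge\alpha_a,A\rangle-\sum_{i=1}^a\langle\alpha_1\wedge\cdots\wedge D_\eta\alpha_i\wedge\cdots\wedge\alpha_a,A\rangle$ (and $D_\eta h=(\sharp\eta)h$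 on functions). $D$ is a Poisson connection if $D\Pi=0$. With $[\alpha,\beta]_\Pi=\mathcal{L}_{\sharp\alpha}\beta-\mathcal{L}_{\sharp\beta}\alpha+d\langle\alpha\wedge\beta,\Pi\rangle$, the torsion is $T_D(\alpha,\beta)=D_\alpha\beta-D_\beta\alpha-[\alpha,\beta]_\Pi$; it is vanishing if $T_D(\alpha,\beta)=0$ for all 1-forms $\alpha,\beta$. *)

(* Defs.v *)
From HB Require Import structures.
From mathcomp Require Import all_boot all_order all_algebra all_fingroup.
From mathcomp Require Import all_classical all_reals all_analysis.

Set Implicit Arguments.
Unset Strict Implicit.
Unset Printing Implicit Defensive.

Import Order.TTheory GRing.Theory Num.Theory.
Import numFieldNormedType.Exports.

Local Open Scope classical_set_scope.
Local Open Scope ring_scope.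

(* [sigma] is increasing on the first [k] indices and on the other ones. *)
Definition shuffle (n k : nat) (sigma : 'S_n) : bool :=
  [forall i : 'I_n, forall j : 'I_n,
    (i < j)%N && ((j < k)%N || (k <= i)%N) ==> (sigma i < sigma j)%N].

Definition permute (T : Type) (s : seq T) (sigma : 'S_(size s)) : seq T :=
  [seq tnth (in_tuple s) (sigma i) | i <- enum 'I_(size s)].
Arguments permute {T} s sigma.

(* Vectors are rows ['rV[R]_n] and covectors are columns ['cV[R]_n].  An element
   of degree [a] of the exterior algebra of a space is an alternating [a]-linear
   form on the dual space, stored as a function on lists that vanishes on the
   lists of length different from [a].  Products and contractions then need no
   casts between the types of the different degrees. *)
Section ExteriorAlgebra.
Context {R : realType}.

Definition alternating (V : lmodType R) (a : nat) (T : seq V -> R) : Prop :=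
  [/\ forall s, size s != a -> T s = 0,
      forall s1 s2 k u v,
        T (s1 ++ (k *: u + v) :: s2) =
        k * T (s1 ++ u :: s2) + T (s1 ++ v :: s2)
    & forall s, ~~ uniq s -> T s = 0].

(* If [S] and [T] have degrees [p] and [q], only the terms with [k = p] can be
   nonzero, and they run over the (p, q)-shuffles. *)
Definition wedge (V : lmodType R) (S T : seq V -> R) (s : seq V) : R :=
  \sum_(k < (size s).+1) \sum_(sigma : 'S_(size s) | shuffle k sigma)
    (-1) ^+ sigma * S (take k (permute s sigma)) * T (drop k (permute s sigma)).

Section Pairing.
Context {n : nat}.

Definition pair (xi : 'cV[R]_n) (v : 'rV[R]_n) : R := (v *m xi) 0 0.

(* X_1 ^ ... ^ X_k as a function of k covectors, and dually. *)
Definition wedge_vectors (X : seq 'rV[R]_n) (s : seq 'cV[R]_n) : R :=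
  if size s == size X
  then \det (\matrix_(i < size s, j < size s) pair (nth 0 s i) (nth 0 X j))
  else 0.

Definition wedge_covectors (xi : seq 'cV[R]_n) (s : seq 'rV[R]_n) : R :=
  if size s == size xi
  then \det (\matrix_(i < size s, j < size s) pair (nth 0 xi i) (nth 0 s j))
  else 0.

(* The pairing for which <xi_1 ^ ... ^ xi_k, X_1 ^ ... ^ X_k> is det xi_i(X_j),
   and the different degrees are orthogonal: the increasing products of the
   standard basis are a basis, and those of the dual basis are its dual basis. *)
Definition ext_pair (eta : seq 'rV[R]_n -> R) (A : seq 'cV[R]_n -> R) : R :=
  \sum_(I : {set 'I_n})
    eta [seq delta_mx 0 i | i <- enum I] * A [seq delta_mx i 0 | i <- enum I].

Definition interior_vec (A : seq 'cV[R]_n -> R) (eta : seq 'rV[R]_n -> R)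
    (s : seq 'rV[R]_n) : R :=
  ext_pair eta (wedge A (wedge_vectors s)).

Definition interior_form (eta : seq 'rV[R]_n -> R) (A : seq 'cV[R]_n -> R)
    (s : seq 'cV[R]_n) : R :=
  ext_pair (wedge (wedge_covectors s) eta) A.

Definition flat_at (w : seq 'rV[R]_n -> R) (v : 'rV[R]_n) : 'cV[R]_n :=
  \col_i w [:: v; delta_mx 0 i].

Definition sharp_at (w : seq 'rV[R]_n -> R) (xi : 'cV[R]_n) : 'rV[R]_n :=
  xget 0 [set v | flat_at w v = xi].

End Pairing.
End ExteriorAlgebra.

Section SmoothEuclidean.
Context {R : realType} {n : nat}.

Definition iter_partial (l : seq 'I_n) (g : 'rV[R]_n -> R) : 'rV[R]_n -> R :=
  foldr (fun i (h : 'rV[R]_n -> R) x => 'D_(delta_mx 0 i) h x) g l.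

(* Meant for an open [W]. *)
Definition smooth_on (W : set 'rV[R]_n) (g : 'rV[R]_n -> R) : Prop :=
  forall l x, W x ->
    {for x, continuous (iter_partial l g)} /\
    forall i, derivable (iter_partial l g) x (delta_mx 0 i).

End SmoothEuclidean.

Record chart (R : realType) (n : nat) (P : topologicalType) := Chart {
  chart_dom : set P;
  to_coord :> P -> 'rV[R]_n;
  of_coord : 'rV[R]_n -> P;
  open_dom : open chart_dom;
  open_codom : open (to_coord @` chart_dom);
  to_coordK : forall p, chart_dom p -> of_coord (to_coord p) = p;
  to_coord_continuous : forall p, chart_dom p -> {for p, continuous to_coord};
  of_coord_continuous :
    forall x, (to_coord @` chart_dom) x -> {for x, continuous of_coord} }.

Definition smooth_transition (R : realType) (n : nat) (P : topologicalType)
    (c c' : chart R n P) : Prop :=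
  forall j, smooth_on (c @` (chart_dom c `&` chart_dom c'))
                      (fun x => c' (of_coord c x) 0 j).

(* The atlas is given as a choice of a chart around each point.  The tangent and
   cotangent spaces at [p] are identified with R^n by means of [chart_at p]. *)
Record manifold (R : realType) (n : nat) := Manifold {
  points :> topologicalType;
  chart_at : points -> chart R n points;
  chart_at_dom : forall p, chart_dom (chart_at p) p;
  chart_at_smooth : forall p q, smooth_transition (chart_at p) (chart_at q);
  points_hausdorff : hausdorff_space points;
  points_second_countable : @second_countable points }.

Section Manifold.
Context {R : realType} {n : nat} {P : manifold R n}.

Notation vfield := (P -> 'rV[R]_n).
Notation form1 := (P -> 'cV[R]_n).
Notation mvfield := (P -> seq 'cV[R]_n -> R).
Notation form := (P -> seq 'rV[R]_n -> R).

Definition smooth_chart (c : chart R n P) : Prop :=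
  forall p, smooth_transition c (chart_at p) /\
            smooth_transition (chart_at p) c.

Definition smooth_fun (W : set P) (h : P -> R) : Prop :=
  forall x, smooth_on (chart_at x @` (W `&` chart_dom (chart_at x)))
                      (h \o of_coord (chart_at x)).

Definition dfun (h : P -> R) : form1 := fun p =>
  \col_i 'D_(delta_mx 0 i) (h \o of_coord (chart_at p)) (chart_at p p).

(* The vector at [q] whose coordinates in the chart [chart_at x] are [v]. *)
Definition from_chart (x q : P) (v : 'rV[R]_n) : 'rV[R]_n :=
  'D_v (chart_at q \o of_coord (chart_at x)) (chart_at x q).

Definition coord_vector (x : P) (i : 'I_n) : vfield :=
  fun q => from_chart x q (delta_mx 0 i).

Definition coord_covector (x : P) (i : 'I_n) : form1 :=
  dfun (fun q => chart_at x q 0 i).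

(* Sections of the exterior powers over [W], whose components in the charts are
   smooth. *)
Definition smooth_mvfield (a : nat) (W : set P) (A : mvfield) : Prop :=
  (forall p, W p -> alternating a (A p)) /\
  forall x (l : seq 'I_n),
    smooth_fun (W `&` chart_dom (chart_at x))
               (fun q => A q [seq coord_covector x i q | i <- l]).

Definition smooth_form (k : nat) (W : set P) (eta : form) : Prop :=
  (forall p, W p -> alternating k (eta p)) /\
  forall x (l : seq 'I_n),
    smooth_fun (W `&` chart_dom (chart_at x))
               (fun q => eta q [seq coord_vector x i q | i <- l]).

Definition mvfield_of (X : vfield) : mvfield := fun p => wedge_vectors [:: X p].
Definition form_of (al : form1) : form := fun p => wedge_covectors [:: al p].

Definition smooth_vfield (W : set P) (X : vfield) : Prop :=
  smooth_mvfield 1 W (mvfield_of X).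
Definition smooth_form1 (W : set P) (al : form1) : Prop :=
  smooth_form 1 W (form_of al).

(* At [p], the vectors of [s] are extended near [p] with constant coordinates in
   [chart_at p], so that the brackets in the formula of d vanish. *)
Definition ext_d (eta : form) : form := fun p s =>
  \sum_(i < size s) (-1) ^+ i *
    'D_(nth 0 s i)
      (fun y => let q := of_coord (chart_at p) y in
                eta q [seq from_chart p q v | v <- take i s ++ drop i.+1 s])
      (chart_at p p).

Definition lie_fun (X : vfield) (h : P -> R) : P -> R :=
  fun p => pair (dfun h p) (X p).

(* L_X al = i(X) d al + d (i(X) al). *)
Definition lie_form1 (X : vfield) (al : form1) : form1 := fun p =>
  (\col_i ext_d (form_of al) p [:: X p; delta_mx 0 i])
  + dfun (fun q => pair (al q) (X q)) p.

Definition on_funs (A : mvfield) (F : seq (P -> R)) : P -> R :=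
  fun p => A p [seq dfun h p | h <- F].

(* (a + 1) (b + 1) has the parity of (a - 1) (b - 1).  When [a = 0], the first
   sum is zero because [take b] has fewer than [b] elements, and likewise for the
   second one when [b = 0]. *)
Definition schouten_on_funs (a b : nat) (A B : mvfield) (F : seq (P -> R)) :
    P -> R := fun p =>
  if (size F).+1 == (a + b)%N then
    \sum_(sigma : 'S_(size F) | shuffle b sigma) (-1) ^+ sigma *
      on_funs A (on_funs B (take b (permute F sigma))
                 :: drop b (permute F sigma)) p
    - (-1) ^+ (a.+1 * b.+1) *
    \sum_(sigma : 'S_(size F) | shuffle a sigma) (-1) ^+ sigma *
      on_funs B (on_funs A (take a (permute F sigma))
                 :: drop a (permute F sigma)) p
  else 0.

(* A function near [p] whose differential at [p] is [xi]. *)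
Definition fun_with_diff (p : P) (xi : 'cV[R]_n) : P -> R :=
  fun q => pair xi (chart_at p q).

(* The value of the bracket at [p] on (dF_1, ..., dF_k) depends only on the
   differentials of the F_i at [p]. *)
Definition schouten (a b : nat) (A B : mvfield) : mvfield := fun p s =>
  schouten_on_funs a b A B [seq fun_with_diff p xi | xi <- s] p.

Definition flat (w : form) (X : vfield) : form1 := fun p => flat_at (w p) (X p).
Definition sharp (w : form) (al : form1) : vfield :=
  fun p => sharp_at (w p) (al p).

Definition symplectic (w : form) : Prop :=
  [/\ smooth_form 2 setT w,
      forall p s, ext_d w p s = 0
    & forall p v, (forall u, w p [:: v; u] = 0) -> v = 0].

Definition poisson (w : form) : mvfield := fun p s =>
  if s is [:: be; al] then pair be (sharp_at (w p) al) else 0.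

Definition poisson_d (w : form) (a : nat) (A : mvfield) : mvfield :=
  fun p s => - schouten a 2 A (poisson w) p s.

Definition vol_flat (nu : form) (A : mvfield) : form :=
  fun p => interior_vec (A p) (nu p).

(* [vol_sharp nu a] is the inverse of [vol_flat nu] on multivectors of degree
   [a]. *)
Definition vol_sharp (nu : form) (a : nat) (eta : form) : mvfield := fun p =>
  xget (fun=> 0) [set B | alternating a B /\ interior_vec B (nu p) = eta p].

(* There are no multivector fields of degree -1 except 0. *)
Definition curl (nu : form) (a : nat) (A : mvfield) : mvfield :=
  if a is a'.+1 then vol_sharp nu a' (ext_d (vol_flat nu A)) else fun _ _ => 0.

Definition modular (w nu : form) (a : nat) (A : mvfield) : mvfield := fun p s =>
  curl nu a.+1 (poisson_d w a A) p s - poisson_d w a.-1 (curl nu a A) p s.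

Definition contravariant_derivative (w : form) (D : form1 -> form1 -> form1) :
    Prop :=
  [/\ forall eta al, smooth_form1 setT eta -> smooth_form1 setT al ->
        smooth_form1 setT (D eta al),
      forall (k : R) eta al be, smooth_form1 setT eta ->
        smooth_form1 setT al -> smooth_form1 setT be ->
        forall p, D eta (fun q => k *: al q + be q) p = k *: D eta al p + D eta be p,
      forall h eta eta' al, smooth_fun setT h -> smooth_form1 setT eta ->
        smooth_form1 setT eta' -> smooth_form1 setT al ->
        forall p, D (fun q => h q *: eta q + eta' q) al p =
                  h p *: D eta al p + D eta' al p
    & forall h eta al, smooth_fun setT h -> smooth_form1 setT eta ->
        smooth_form1 setT al ->
        forall p, D eta (fun q => h q *: al q) p =
                  h p *: D eta al p + lie_fun (sharp w eta) h p *: al p].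

(* A 1-form on the whole manifold that coincides with [al] near [p]. *)
Definition globalize (p : P) (al : form1) : form1 :=
  xget (fun=> 0) [set be | smooth_form1 setT be /\ \forall q \near p, be q = al q].

(* The restriction of [D] to open sets, where [eta] and [al] need only be smooth
   near [p]. *)
Definition restrict_cd (D : form1 -> form1 -> form1) (eta al : form1) : form1 :=
  fun p => D (globalize p eta) (globalize p al) p.

(* At [p], the covectors of [s] are extended to the exact forms [al] near [p]; the
   result depends only on [s]. *)
Definition cd_mvfield (w : form) (D : form1 -> form1 -> form1) (eta : form1)
    (A : mvfield) : mvfield := fun p s =>
  let al := [seq dfun (fun_with_diff p xi) | xi <- s] in
  lie_fun (sharp w eta) (fun q => A q [seq be q | be <- al]) p
  - \sum_(i < size s)
      A p (set_nth 0 s i (restrict_cd D eta (nth (fun=> 0) al i) p)).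

Definition poisson_connection (w : form) (D : form1 -> form1 -> form1) : Prop :=
  contravariant_derivative w D /\
  forall eta, smooth_form1 setT eta ->
    forall p s, cd_mvfield w D eta (poisson w) p s = 0.

Definition form1_bracket (w : form) (al be : form1) : form1 := fun p =>
  lie_form1 (sharp w al) be p - lie_form1 (sharp w be) al p
  + dfun (fun q => poisson w q [:: al q; be q]) p.

Definition torsion (w : form) (D : form1 -> form1 -> form1) (al be : form1) :
    form1 := fun p => D al be p - D be al p - form1_bracket w al be p.

Definition torsion_free (w : form) (D : form1 -> form1 -> form1) : Prop :=
  forall al be, smooth_form1 setT al -> smooth_form1 setT be ->
    forall p, torsion w D al be p = 0.

Definition local_frame (U : set P) (e : 'I_n -> vfield) : Prop :=
  (forall i, smooth_vfield U (e i)) /\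
  forall p, U p -> (\matrix_i e i p) \in unitmx.

Definition dual_coframe (U : set P) (e : 'I_n -> vfield) (th : 'I_n -> form1) :
    Prop :=
  (forall i, smooth_form1 U (th i)) /\
  forall p, U p -> forall i j, pair (th i p) (e j p) = (i == j)%:R.

Definition liouville_form (m : nat) (w : form) : form := fun p s =>
  (m`!)%:R^-1 * iter m (wedge (w p)) (wedge_covectors [::]) s.

End Manifold.

(* Main.v *)
(** Write [phi = log|f|].  Both sides equal [(-1)^(a-1)] times the Lie derivative of
[A] along the Hamiltonian field [sharp (d phi)].

Left-hand side.  In a chart the tensors are multilinear forms over the ring [K] of
smooth functions on the image of the chart, which carries the commuting derivations
[d_k].  There the curl operator of [nu = rho dx^1 ^ ... ^ dx^n] is the divergence
[A |-> sum_k (d_k A)(..., dx^k) + A(..., lam)] with [lam = d log rho], and the Poisson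
coboundary operator is the Chevalley-Eilenberg differential of the Lie algebroid of
1-forms.  On constant covectors their commutator is, up to sign, the Lie derivative
along the modular field [x |-> sum_k (d_k Pi)(dx^k, x) + Pi(lam, x)].  For the Liouville
density this field vanishes because omega is closed, hence for [nu = f mu] it is
[x |-> Pi(d phi, x)].

Right-hand side.  [D Pi = 0] is a Leibniz rule for the pairing [Pi], which gives
[D_(theta^i) d phi = sum_j H_ij flat(e_j)] with [H_ij] the coefficient in braces; the
vanishing torsion turns [D_(d phi) dF] into [D_(dF) d phi - d Pi(d phi, dF)].  So the
second sum cancels the terms [D_(dF) d phi] of the first one and leaves the Lie
derivative. *)

(* The tangent space at q is identified with R^n by [chart_at q], which may vary with q without any
   continuity, so components cannot be differentiated as they stand. Around p every tensor is
   therefore represented, at all points of one chart, by a form over [sfun (chart_open p)] ([rep],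
   [rep_form]); the algebra is done over a commutative ring with commuting derivations and an
   element [half], and evaluated at p. The interior product by a multivector leads to a divergence
   whose contracted covector stands last. Moving it to the front costs (-1)^a on the Poisson
   differential of A and (-1)^(a-1) on A, so the commutator in the modular operator becomes (-1)^a
   times a sum div d + d div, to which Cartan's formula applies. The remaining sign comes from Pi(d
   phi, x) = -x(sharp (d phi)). The other obstacle is that D acts on forms defined on all of P,
   while coordinate covectors and the coframe are local. They are continued by bump functions, and D
   is shown to depend on the germ of its second argument and on the value of its first. *)
From HB Require Import structures.
Require Import Defs.
From mathcomp Require Import all_boot all_order all_algebra all_fingroup.
From mathcomp Require Import all_classical all_reals all_analysis.
From mathcomp Require Import ring lra zify.

Set Implicit Arguments.
Unset Strict Implicit.
Unset Printing Implicit Defensive.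

Import Order.TTheory GRing.Theory Num.Theory.
Import numFieldNormedType.Exports.
Local Open Scope classical_set_scope.
Local Open Scope ring_scope.

(** * Alternating sums and multilinear forms on lists *)

Section AltSum.
Context {V : Type} {K : comPzRingType}.
Implicit Types (Psi : V -> seq V -> K) (s l : seq V) (T : seq V -> K).

(** Recursion on the list spares the bookkeeping of indices; [altsumE] gives the usual form, with
    the sign (-1)^i for the entry of index i. *)
Fixpoint altsum Psi s : K :=
  if s is x :: s' then Psi x s' - altsum (fun y l => Psi y (x :: l)) s' else 0.

(* The terms [i < j] get the sign [(-1)^(i + j - 1)]. *)
Fixpoint altsum2 (Psi : V -> V -> seq V -> K) s : K :=
  if s is x :: s' then
    altsum (Psi x) s' + altsum2 (fun y z l => Psi y z (x :: l)) s'
  else 0.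

Lemma eq_altsum Psi Psi' s :
  (forall x l, (size l).+1 = size s -> Psi x l = Psi' x l) -> altsum Psi s = altsum Psi' s.
Proof.
elim: s Psi Psi' => //= x s IH Psi Psi' H; rewrite H //; congr (_ - _).
by apply: IH => y l sl; apply: H; rewrite /= sl.
Qed.

Lemma altsumD Psi Psi' s :
  altsum (fun x l => Psi x l + Psi' x l) s = altsum Psi s + altsum Psi' s.
Proof.
by elim: s Psi Psi' => [|x s IH] Psi Psi' /=; rewrite ?addr0// IH opprD addrACA.
Qed.

Lemma altsumZ k Psi s : altsum (fun x l => k * Psi x l) s = k * altsum Psi s.
Proof. by elim: s Psi => [|x s IH] Psi /=; rewrite ?mulr0// IH mulrBr. Qed.

Lemma altsum0 s : altsum (fun _ _ => 0) s = 0.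
Proof. by elim: s => //= x s ->; rewrite subr0. Qed.

Lemma altsumN Psi s : altsum (fun x l => - Psi x l) s = - altsum Psi s.
Proof. by elim: s Psi => [|x s IH] Psi /=; rewrite ?oppr0// IH opprD. Qed.

Lemma altsum_sum (I : finType) (F : I -> V -> seq V -> K) s :
  altsum (fun x l => \sum_i F i x l) s = \sum_i altsum (F i) s.
Proof.
elim: s F => [|x s IH] F /=; first by rewrite big1.
by rewrite IH -sumrB.
Qed.

Lemma altsumE x0 Psi s :
  altsum Psi s = \sum_(i < size s) (-1) ^+ i * Psi (nth x0 s i) (take i s ++ drop i.+1 s).
Proof.
elim: s Psi => [|x s IH] Psi /=; first by rewrite big_ord0.
rewrite big_ord_recl /= mul1r drop0 IH; congr (_ + _); rewrite -sumrN.
by apply: eq_bigr => i _; rewrite /bump /= add1n exprS mulN1r mulNr.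
Qed.

Lemma eq_altsum2 (Psi Psi' : V -> V -> seq V -> K) s :
  (forall x y l, Psi x y l = Psi' x y l) -> altsum2 Psi s = altsum2 Psi' s.
Proof.
elim: s Psi Psi' => //= x s IH Psi Psi' H; congr (_ + _); last by apply: IH.
by apply: eq_altsum => y l _; apply: H.
Qed.

Lemma altsum2D (Psi Psi' : V -> V -> seq V -> K) s :
  altsum2 (fun x y l => Psi x y l + Psi' x y l) s = altsum2 Psi s + altsum2 Psi' s.
Proof.
elim: s Psi Psi' => [|x s IH] Psi Psi' /=; rewrite ?addr0//.
by rewrite altsumD IH addrACA.
Qed.

Lemma altsum2Z k (Psi : V -> V -> seq V -> K) s : altsum2 (fun x y l => k * Psi x y l) s = k * altsum2 Psi s.
Proof. by elim: s Psi => [|x s IH] Psi /=; rewrite ?mulr0// altsumZ IH mulrDr. Qed.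

Lemma altsum2_0 s : altsum2 (fun _ _ _ => 0) s = 0.
Proof. by elim: s => //= x s ->; rewrite altsum0 addr0. Qed.

Lemma altsum2N (Psi : V -> V -> seq V -> K) s : altsum2 (fun x y l => - Psi x y l) s = - altsum2 Psi s.
Proof. by elim: s Psi => [|x s IH] Psi /=; rewrite ?oppr0// altsumN IH opprD. Qed.

Lemma altsum2_sum (I : finType) (F : I -> V -> V -> seq V -> K) s :
  altsum2 (fun x y l => \sum_i F i x y l) s = \sum_i altsum2 (F i) s.
Proof.
elim: s F => [|x s IH] F /=; first by rewrite big1.
by rewrite altsum_sum IH big_split.
Qed.

(** Taking out two entries in one order or in the other shifts the position of one of them by one,
    hence the sign. *)
Lemma altsum_altsumN (Phi : V -> V -> seq V -> K) s :
  altsum (fun x l => altsum (Phi x) l) s = - altsum (fun x l => altsum (Phi ^~ x) l) s.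
Proof.
elim: s Phi => [|x s IH] Phi /=; first by rewrite oppr0.
rewrite !altsumD !altsumN IH /=; ring.
Qed.

(** By induction, since [altsum_altsumN] would only say that twice the sum is zero. *)
Lemma altsum_altsum_sym (Phi : V -> V -> seq V -> K) s :
  (forall x y l, Phi x y l = Phi y x l) -> altsum (fun x l => altsum (Phi x) l) s = 0.
Proof.
elim: s Phi => [//|x s IH] Phi H /=.
rewrite altsumD altsumN (IH (fun y z l => Phi y z (x :: l))) //.
by rewrite subr0 (@eq_altsum (Phi x) (Phi ^~ x)) ?subrr // => y l _; apply: H.
Qed.

(** Adjacent repetitions suffice: with multilinearity they give [skew], and then vanishing on every
    list with a repetition ([altern_nonuniq]). *)
Definition altern T := forall s1 u s2, T (s1 ++ u :: u :: s2) = 0.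
Definition skew T := forall s1 u v s2, T (s1 ++ u :: v :: s2) = - T (s1 ++ v :: u :: s2).

Lemma altern_cons T x : altern T -> altern (fun l => T (x :: l)).
Proof. by move=> H s1 u s2; apply: (H (x :: s1)). Qed.

Lemma skew_cons T x : skew T -> skew (fun l => T (x :: l)).
Proof. by move=> H s1 u v s2; apply: (H (x :: s1)). Qed.

Lemma skew_move T s1 u s2 : skew T ->
  T (s1 ++ u :: s2) = (-1) ^+ size s1 * T (u :: s1 ++ s2).
Proof.
elim: s1 T => [|x s1 IH] T sT /=; first by rewrite mul1r.
rewrite (IH (fun l => T (x :: l))); last exact: skew_cons.
by rewrite exprS (sT [::]) /= mulN1r mulrN mulNr.
Qed.

Lemma skew_move_rcons T s u : skew T -> T (rcons s u) = (-1) ^+ size s * T (u :: s).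
Proof. by move=> sT; rewrite -cats1 skew_move// cats0. Qed.

Lemma altsum_skew Psi : (forall x, skew (Psi x)) -> skew (altsum Psi).
Proof.
move=> H s1; elim: s1 Psi H => [|z s1 IH] Psi H x y s2 /=; last first.
  rewrite H opprB (IH (fun y l => Psi y (z :: l))); last by move=> w; apply: skew_cons.
  by rewrite opprK addrC.
rewrite (@eq_altsum (fun y0 l => Psi y0 (x :: y :: l)) (fun w l => - Psi w (y :: x :: l))).
  by rewrite altsumN; ring.
by move=> w l _; apply: (H w [::]).
Qed.

Lemma altsum_altern Psi : (forall x, altern (Psi x)) -> altern (altsum Psi).
Proof.
move=> H s1; elim: s1 Psi H => [|z s1 IH] Psi H x s2 /=; last first.
  rewrite H (IH (fun y l => Psi y (z :: l))) ?subr0 //.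
  by move=> w; apply: altern_cons.
rewrite (@eq_altsum (fun y0 l => Psi y0 (x :: x :: l)) (fun w l => 0)).
  by rewrite altsum0; ring.
by move=> w l _; apply: (H w [::]).
Qed.

End AltSum.

Section Multilinear.
Context {K : comPzRingType} {M : lmodType K}.
Implicit Types (T : seq M -> K) (s : seq M).

Definition multilin T := forall s1 s2 k u v,
  T (s1 ++ (k *: u + v) :: s2) = k * T (s1 ++ u :: s2) + T (s1 ++ v :: s2).

Lemma multilin_cons T x : multilin T -> multilin (fun l => T (x :: l)).
Proof. by move=> H s1; apply: (H (x :: s1)). Qed.

Lemma multilin0 T s1 s2 : multilin T -> T (s1 ++ 0 :: s2) = 0.
Proof.
move=> H; have := H s1 s2 1 0 0; rewrite scaler0 addr0 mul1r => /eqP.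
by rewrite -subr_eq subrr eq_sym => /eqP.
Qed.

Lemma multilinD T s1 s2 u v : multilin T ->
  T (s1 ++ (u + v) :: s2) = T (s1 ++ u :: s2) + T (s1 ++ v :: s2).
Proof. by move=> H; rewrite -{1}[u]scale1r H mul1r. Qed.

Lemma multilinZ T s1 s2 k u : multilin T ->
  T (s1 ++ (k *: u) :: s2) = k * T (s1 ++ u :: s2).
Proof. by move=> H; rewrite -[k *: u]addr0 H multilin0// addr0. Qed.

Lemma multilinN T s1 s2 u : multilin T -> T (s1 ++ (- u) :: s2) = - T (s1 ++ u :: s2).
Proof. by move=> H; rewrite -scaleN1r multilinZ// mulN1r. Qed.

Lemma multilinB T s1 s2 u v : multilin T ->
  T (s1 ++ (u - v) :: s2) = T (s1 ++ u :: s2) - T (s1 ++ v :: s2).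
Proof. by move=> H; rewrite multilinD// multilinN. Qed.

Lemma multilin_sum T s1 s2 (I : finType) (F : I -> M) : multilin T ->
  T (s1 ++ (\sum_i F i) :: s2) = \sum_i T (s1 ++ F i :: s2).
Proof.
move=> H; elim/big_rec2: _ => [|i a b _ IH]; first exact: multilin0.
by rewrite multilinD // IH.
Qed.

Lemma multilin_skew T : multilin T -> altern T -> skew T.
Proof.
move=> mT aT s1 u v s2.
have E x : T (s1 ++ x :: (u + v) :: s2) = T (s1 ++ x :: u :: s2) + T (s1 ++ x :: v :: s2).
  by rewrite -!(cat_rcons x) multilinD.
have := aT s1 (u + v) s2.
by rewrite (multilinD s1) // !E !aT addr0 add0r => /eqP; rewrite addr_eq0 => /eqP.
Qed.

Lemma altern_nonuniq (T : seq M -> K) s :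
  altern T -> skew T -> ~~ uniq s -> T s = 0.
Proof.
elim: s T => [//|x s IH] T aT sT /=; rewrite negb_and negbK => /orP[/path.splitPr|].
  move=> [p1 p2]; rewrite (skew_move (T := fun l => T (x :: l))); last exact: skew_cons.
  by rewrite /= (aT [::]) mulr0.
by move=> us; apply: (IH (fun l => T (x :: l))) => //; [apply: altern_cons | apply: skew_cons].
Qed.

(** The derivation induced by [g] on the arguments. [dsumE] links it to the sums over [set_nth] by
    which connections and Lie derivatives act on multivectors. *)
Fixpoint dsum (g : M -> M) T s : K :=
  if s is x :: s' then T (g x :: s') + dsum g (fun l => T (x :: l)) s' else 0.

Lemma eq_dsum g T T' s : T =1 T' -> dsum g T s = dsum g T' s.
Proof.
move=> E; elim: s T T' E => //= x s IH T T' E; rewrite E; congr (_ + _).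
by apply: IH => l; rewrite E.
Qed.

Lemma dsumD g T T' s : dsum g (fun l => T l + T' l) s = dsum g T s + dsum g T' s.
Proof.
by elim: s T T' => [|x s IH] T T' /=; rewrite ?addr0// IH addrACA.
Qed.

Lemma dsumZ g k T s : dsum g (fun l => k * T l) s = k * dsum g T s.
Proof. by elim: s T => [|x s IH] T /=; rewrite ?mulr0// IH mulrDr. Qed.

Lemma dsum_gsum (I : finType) (g : I -> M -> M) T s : multilin T ->
  dsum (fun x => \sum_i g i x) T s = \sum_i dsum (g i) T s.
Proof.
elim: s T => [|x s IH] T mT /=; first by rewrite big1.
by rewrite (multilin_sum [::])// IH -?big_split //; apply: multilin_cons.
Qed.

Lemma dsum_lin g g' k T s : multilin T ->
  dsum (fun x => k *: g x + g' x) T s = k * dsum g T s + dsum g' T s.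
Proof.
elim: s T => [|x s IH] T mT /=; first by rewrite mulr0 addr0.
rewrite (mT [::])/= IH; last exact: multilin_cons.
by ring.
Qed.

Lemma eq_dsumg g g' T s : (forall x, x \in s -> g x = g' x) -> dsum g T s = dsum g' T s.
Proof.
elim: s T => //= x s IH T H; rewrite H ?mem_head // IH // => y ys.
by apply: H; rewrite inE ys orbT.
Qed.

Lemma dsumE g T s :
  dsum g T s = \sum_(i < size s) T (set_nth 0 s i (g (nth 0 s i))).
Proof.
elim: s T => [|x s IH] T /=; first by rewrite big_ord0.
by rewrite big_ord_recl /= IH.
Qed.

(** Bringing [g y] back from the front to the place of [y] costs exactly the sign that [altsum]
    gives to this place. *)
Lemma altsum_dsum g T s : skew T -> altsum (fun y l => T (g y :: l)) s = dsum g T s.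
Proof.
elim: s T => //= x s IH T sT; congr (_ + _).
rewrite -IH; last exact: skew_cons.
rewrite -altsumN; apply: eq_altsum => y l _.
by rewrite (sT [::]) opprK.
Qed.

End Multilinear.

(** * The differential of a Lie-Rinehart pair *)

Section LieRinehart.
Context {K : comPzRingType} {M : lmodType K} (act : M -> K -> K) (br : M -> M -> M).
Implicit Types (T : seq M -> K) (s : seq M).

Hypothesis actD : forall x a b, act x (a + b) = act x a + act x b.
Hypothesis actM : forall x a b, act x (a * b) = act x a * b + a * act x b.
Hypothesis act_lin : forall k x y a, act (k *: x + y) a = k * act x a + act y a.
Hypothesis brD : forall x y z, br x (y + z) = br x y + br x z.
Hypothesis brZ : forall x k y, br x (k *: y) = k *: br x y + act x k *: y.
Hypothesis brC : forall x y, br x y = - br y x.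
Hypothesis brr : forall x, br x x = 0.

(* The Chevalley-Eilenberg differential of the Lie-Rinehart pair [(K, M)]. *)
Definition lr_d T s : K :=
  altsum (fun x l => act x (T l)) s - altsum2 (fun x y l => T (br x y :: l)) s.

Lemma eq_lr_d T T' s : T =1 T' -> lr_d T s = lr_d T' s.
Proof.
move=> E; congr (_ - _); first by apply: eq_altsum => x l _; rewrite E.
by apply: eq_altsum2 => x y l; rewrite E.
Qed.

(** Cartan's formula i_x d = L_x - d i_x. It allows the arguments of the differential to be treated
    one at a time. *)
Lemma lr_d_cons T x s : skew T ->
  lr_d T (x :: s) = act x (T s) - altsum (fun y l => T (br x y :: l)) s
                    - lr_d (fun l => T (x :: l)) s.
Proof.
move=> sT; rewrite /lr_d /=.
rewrite (@eq_altsum2 _ _ (fun y z l => T (br y z :: x :: l)) (fun y z l => - T (x :: br y z :: l))).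
  by rewrite altsum2N; ring.
by move=> y z l; rewrite (sT [::]).
Qed.

Lemma lr_dD T T' s : lr_d (fun l => T l + T' l) s = lr_d T s + lr_d T' s.
Proof.
rewrite /lr_d altsum2D -addrACA -opprD; congr (_ - _).
by rewrite -altsumD; apply: eq_altsum => x l _; rewrite actD.
Qed.

Lemma lr_dZ k T s :
  lr_d (fun l => k * T l) s = k * lr_d T s + altsum (fun x l => act x k * T l) s.
Proof.
rewrite /lr_d altsum2Z mulrBr addrAC; congr (_ - _).
by rewrite -altsumZ -altsumD; apply: eq_altsum => x l _; rewrite actM addrC.
Qed.

Lemma act0 x : act x 0 = 0.
Proof. by apply: (@addrI _ (act x 0)); rewrite -actD !addr0. Qed.

Lemma actN x a : act x (- a) = - act x a.
Proof. by apply/eqP; rewrite -addr_eq0 -actD addNr act0. Qed.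

Lemma lr_dN T s : lr_d (fun l => - T l) s = - lr_d T s.
Proof.
rewrite /lr_d altsum2N opprB opprK addrC; congr (_ + _).
by rewrite -altsumN; apply: eq_altsum => x l _; rewrite actN.
Qed.

Lemma lr_d_skew T : multilin T -> altern T -> skew (lr_d T).
Proof.
move=> mT aT s1; elim: s1 T mT aT => [|z s1 IH] T mT aT x y s2.
  have sT := multilin_skew mT aT.
  rewrite /= !lr_d_cons /=; do ?[exact: sT | exact: skew_cons].
  have E u v : altsum (fun w l => T (br u w :: v :: l)) s2 = - altsum (fun w l => T (v :: br u w :: l)) s2.
    by rewrite -altsumN; apply: eq_altsum => w l _; apply: (sT [::]).
  have -> : lr_d (fun l => T (y :: x :: l)) s2 = - lr_d (fun l => T (x :: y :: l)) s2.
    by rewrite -lr_dN; apply: eq_lr_d => l; apply: (sT [::]).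
  rewrite !E brC (multilinN [::]) //=; ring.
have sT := multilin_skew mT aT.
rewrite /= !lr_d_cons // sT IH; [|exact: multilin_cons|exact: altern_cons].
rewrite altsum_skew; last by move=> w; apply: skew_cons.
by rewrite actN; ring.
Qed.

Lemma lr_d_altern T : multilin T -> altern T -> altern (lr_d T).
Proof.
move=> mT aT s1; elim: s1 T mT aT => [|z s1 IH] T mT aT x s2.
  have sT := multilin_skew mT aT.
  rewrite /= !lr_d_cons /=; do ?[exact: sT | exact: skew_cons].
  rewrite brr (multilin0 [::]) //.
  have -> : altsum (fun w l => T (br x w :: x :: l)) s2 = - altsum (fun w l => T (x :: br x w :: l)) s2.
    by rewrite -altsumN; apply: eq_altsum => w l _; apply: (sT [::]).
  have -> : lr_d (fun l => T (x :: x :: l)) s2 = 0; last by ring.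
  rewrite (eq_lr_d (T' := fun=> 0)); last by move=> l; apply: (aT [::]).
  rewrite /lr_d altsum2_0 (@eq_altsum _ _ _ (fun _ _ => 0)) ?altsum0 ?subrr //.
  by move=> w l _; rewrite act0.
have sT := multilin_skew mT aT.
rewrite /= !lr_d_cons // aT IH; [|exact: multilin_cons|exact: altern_cons].
rewrite altsum_altern ?act0; last by move=> w; apply: altern_cons.
by ring.
Qed.

Lemma lr_d_multilin T : multilin T -> altern T -> multilin (lr_d T).
Proof.
move=> mT aT s1 s2 k u v.
have sT := multilin_skew mT aT.
have sd := lr_d_skew mT aT.
(* By skewness only linearity in the first argument remains, where Cartan's formula applies. *)
rewrite !(skew_move s1) //; set s := s1 ++ s2.
suff -> : lr_d T (k *: u + v :: s) = k * lr_d T (u :: s) + lr_d T (v :: s) by ring.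
rewrite !lr_d_cons // act_lin.
rewrite (@eq_lr_d (fun l => T ((k *: u + v) :: l)) (fun l => k * T (u :: l) + T (v :: l))); last first.
  by move=> l; rewrite (mT [::]).
rewrite lr_dD lr_dZ.
(* The Leibniz term of the bracket cancels the terms [act y k * T (u :: l)] produced by [lr_dZ]. *)
rewrite (@eq_altsum _ _ (fun y l => T (br (k *: u + v) y :: l))
   (fun y l => k * T (br u y :: l) - act y k * T (u :: l) + T (br v y :: l))).
  by rewrite altsumD altsumD altsumN altsumZ; ring.
move=> y l _; rewrite brC brD brZ opprD opprD -scalerN -!brC.
rewrite (multilinD [::]) // (mT [::]) /= (multilinN [::]) // (multilinZ [::]) //.
Qed.

End LieRinehart.

(** * Exterior products *)

Section RWedge.
Context {V : Type} {K : comPzRingType}.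
Implicit Types (S T : seq V -> K) (s l : seq V).

(** The sign (-1)^deg T, read off from the length of the list because degrees are not in the types.
    It is paid when an argument jumps over those of [T]. *)
Definition sgn_size T l : K := (-1) ^+ size l * T l.

(* The sum over the shuffles, organized by the factor that takes the first argument. *)
Fixpoint rwedge S T s : K :=
  if s is x :: s' then
    rwedge (fun l => S (x :: l)) T s' + rwedge (sgn_size S) (fun l => T (x :: l)) s'
  else S [::] * T [::].

Definition degree a T := forall s, size s != a -> T s = 0.

Lemma eq_rwedge S S' T T' s : S =1 S' -> T =1 T' -> rwedge S T s = rwedge S' T' s.
Proof.
elim: s S S' T T' => [|x s IH] S S' T T' ES ET /=; first by rewrite ES ET.
by congr (_ + _); apply: IH => l; rewrite /sgn_size ?ES ?ET.
Qed.

Lemma rwedge_eq0 S T s :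
  (forall l1 l2, (size l1 + size l2)%N = size s -> S l1 * T l2 = 0) -> rwedge S T s = 0.
Proof.
elim: s S T => [|x s IH] S T H /=; first exact: H.
rewrite !IH ?addr0 // => l1 l2 E.
  by rewrite /sgn_size -mulrA H ?mulr0 //= addnS E.
by rewrite H //= addSn E.
Qed.

Lemma rwedgeDl S S' T s : rwedge (fun l => S l + S' l) T s = rwedge S T s + rwedge S' T s.
Proof.
elim: s S S' T => [|x s IH] S S' T /=; first by rewrite mulrDl.
rewrite IH (@eq_rwedge (sgn_size _) (fun l => sgn_size S l + sgn_size S' l) _ (fun l => T (x :: l))) //.
  by rewrite IH addrACA.
by move=> l; rewrite /sgn_size mulrDr.
Qed.

Lemma rwedgeDr S T T' s : rwedge S (fun l => T l + T' l) s = rwedge S T s + rwedge S T' s.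
Proof.
elim: s S T T' => [|x s IH] S T T' /=; first by rewrite mulrDr.
by rewrite !IH addrACA.
Qed.

Lemma rwedgeZl k S T s : rwedge (fun l => k * S l) T s = k * rwedge S T s.
Proof.
elim: s S T => [|x s IH] S T /=; first by rewrite mulrA.
rewrite IH (@eq_rwedge (sgn_size _) (fun l => k * sgn_size S l) _ (fun l => T (x :: l))) //.
  by rewrite IH mulrDr.
by move=> l; rewrite /sgn_size mulrCA.
Qed.

Lemma rwedgeZr k S T s : rwedge S (fun l => k * T l) s = k * rwedge S T s.
Proof.
elim: s S T => [|x s IH] S T /=; first by rewrite mulrCA.
by rewrite !IH mulrDr.
Qed.

Lemma rwedge0l T s : rwedge (fun=> 0) T s = 0.
Proof. by apply: rwedge_eq0 => *; rewrite mul0r. Qed.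

Lemma rwedge0r S s : rwedge S (fun=> 0) s = 0.
Proof. by apply: rwedge_eq0 => *; rewrite mulr0. Qed.

Lemma rwedge_suml (I : finType) (S : I -> seq V -> K) T s :
  rwedge (fun l => \sum_i S i l) T s = \sum_i rwedge (S i) T s.
Proof.
elim: (index_enum I) => [|i r IH].
  rewrite big_nil -[RHS](rwedge0l T s); apply: eq_rwedge => // l; exact: big_nil.
by rewrite big_cons -IH -rwedgeDl; apply: eq_rwedge => // l; exact: big_cons.
Qed.

Lemma rwedge_altsumr {W : Type} S (c : W -> K) (F : seq W -> seq V -> K) (w : seq W) s :
  rwedge S (fun l => altsum (fun x w' => c x * F w' l) w) s =
  altsum (fun x w' => c x * rwedge S (F w') s) w.
Proof.
elim: w F => [|x w IH] F /=; first by rewrite rwedge0r.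
rewrite -IH -rwedgeZr -[X in _ = _ - X]mul1r -mulNr -rwedgeZr -rwedgeDr.
by apply: eq_rwedge => // l; rewrite mulN1r.
Qed.

Lemma sgn_size_altern T : altern T -> altern (sgn_size T).
Proof. by move=> H s1 u s2; rewrite /sgn_size H mulr0. Qed.

(** If both copies of [u] go to one factor the term vanishes; the two ways to share them between the
    factors cancel by the sign of [sgn_size]. *)
Lemma rwedge_altern S T : altern S -> altern T -> altern (rwedge S T).
Proof.
move=> aS aT s1 u s2; elim: s1 S T aS aT => [|x s1 IH] S T aS aT /=; last first.
  by rewrite !IH ?addr0 //; [exact: sgn_size_altern|exact: altern_cons|exact: altern_cons].
rewrite (@eq_rwedge (fun l => S (u :: u :: l)) (fun=> 0) T T) //; last by move=> l; apply: (aS [::]).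
rewrite (@eq_rwedge (sgn_size (sgn_size S)) (sgn_size (sgn_size S)) (fun l => T (u :: u :: l)) (fun=> 0)) //;
  last by move=> l; apply: (aT [::]).
rewrite rwedge0l rwedge0r add0r addr0 -rwedgeDl -[RHS](rwedge0l (fun l => T (u :: l)) s2).
by apply: eq_rwedge => // l; rewrite /sgn_size /= exprS mulN1r mulNr subrr.
Qed.

Lemma rwedge_degree p q S T : degree p S -> degree q T -> degree (p + q)%N (rwedge S T).
Proof.
move=> dS dT s sz; apply: rwedge_eq0 => l1 l2 E.
have [E1|?] := eqVneq (size l1) p; last by rewrite dS ?mul0r.
rewrite dT ?mulr0 //; apply: contraNneq sz => <-.
by rewrite -E E1.
Qed.

Lemma rwedge_degree0l S T s : degree 0 S -> rwedge S T s = S [::] * T s.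
Proof.
elim: s S T => [//|x s IH] S T dS /=.
rewrite (@eq_rwedge (fun l => S (x :: l)) (fun=> 0) T T) //; last by move=> l; apply: dS.
rewrite rwedge0l add0r IH /sgn_size ?expr0 ?mul1r // => l sl.
by rewrite dS ?mulr0.
Qed.

Lemma rwedge_degree0r S T s : degree 0 T -> rwedge S T s = S s * T [::].
Proof.
elim: s S T => [//|x s IH] S T dT /=.
rewrite (@eq_rwedge (sgn_size S) (sgn_size S) (fun l => T (x :: l)) (fun=> 0)) //; last by move=> l; apply: dT.
by rewrite rwedge0r addr0 IH.
Qed.

Lemma rwedge_degree1l S T s : degree 1 S -> rwedge S T s = altsum (fun x l => S [:: x] * T l) s.
Proof.
elim: s S T => [|x s IH] S T dS /=; first by rewrite dS ?mul0r.
rewrite rwedge_degree0l; last by move=> l sl; apply: dS.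
rewrite IH; last by move=> l sl; rewrite /sgn_size dS ?mulr0.
congr (_ + _); rewrite -altsumN; apply: eq_altsum => y l _.
by rewrite /sgn_size expr1 mulN1r mulNr.
Qed.

(** The mirror image of the recursion of [rwedge]: a last argument that goes to [S] jumps over those
    of [T]. *)
Lemma rwedge_rcons S T l x :
  rwedge S T (rcons l x) =
  rwedge S (fun l => T (rcons l x)) l + rwedge (fun l => S (rcons l x)) (sgn_size T) l.
Proof.
elim: l S T => [|y l IH] S T /=.
  by rewrite /sgn_size /= !expr0 !mul1r addrC.
rewrite !IH addrACA; congr (_ + _); congr (_ + _).
rewrite (@eq_rwedge (fun l => sgn_size S (rcons l x)) (fun l => -1 * sgn_size (fun l => S (rcons l x)) l)
  (sgn_size (fun l => T (y :: l))) (fun l => -1 * sgn_size T (y :: l))).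
- by rewrite rwedgeZl rwedgeZr mulrA mulrNN !mul1r.
- by move=> l0; rewrite /sgn_size size_rcons exprS mulrA.
- by move=> l0; rewrite /sgn_size /= exprS; ring.
Qed.

Lemma derivation_sign (d : K -> K) i :
  (forall a b, d (a + b) = d a + d b) -> (forall a b, d (a * b) = d a * b + a * d b) ->
  d ((-1) ^+ i) = 0.
Proof.
move=> dD dM.
have d0 : d 0 = 0 by apply: (@addrI _ (d 0)); rewrite -dD !addr0.
have d1 : d 1 = 0 by have := dM 1 1; rewrite !mulr1 mul1r -{1}[d 1]addr0 => /addrI/esym.
have dN1 : d (-1) = 0 by have := dD (-1) 1; rewrite addNr d0 d1 addr0.
by elim: i => [//|i IH]; rewrite exprS dM dN1 IH mul0r mulr0 addr0.
Qed.

Lemma derivation_rwedge (d : K -> K) S T s :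
  (forall a b, d (a + b) = d a + d b) -> (forall a b, d (a * b) = d a * b + a * d b) ->
  d (rwedge S T s) = rwedge (d \o S) T s + rwedge S (d \o T) s.
Proof.
move=> dD dM; elim: s S T => [|x s IH] S T /=; first exact: dM.
rewrite dD !IH addrACA; congr (_ + _ + _).
apply: eq_rwedge => // l; rewrite /sgn_size /= dM derivation_sign //.
by rewrite mul0r add0r.
Qed.

End RWedge.

Lemma rwedge_map (V V' : Type) (K : comPzRingType) (g : V -> V') (S T : seq V' -> K) s :
  rwedge S T (map g s) = rwedge (S \o map g) (T \o map g) s.
Proof.
elim: s S T => //= x s IH S T; rewrite !IH; congr (_ + _); apply: eq_rwedge => // l /=.
by rewrite /sgn_size /= size_map.
Qed.

Lemma morph_rwedge (V : Type) (K K' : comPzRingType) (phi : K -> K') (S T : seq V -> K) s :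
  (forall a b, phi (a + b) = phi a + phi b) -> (forall a b, phi (a * b) = phi a * phi b) ->
  phi 1 = 1 ->
  phi (rwedge S T s) = rwedge (phi \o S) (phi \o T) s.
Proof.
move=> pD pM p1.
have p0 : phi 0 = 0 by apply: (@addrI _ (phi 0)); rewrite -pD !addr0.
have pN1 : phi (-1) = -1.
  by apply: (@addIr _ 1); rewrite -{1}p1 -pD !addNr.
have ps i : phi ((-1) ^+ i) = (-1) ^+ i.
  by elim: i => [//|i IH]; rewrite !exprS pM pN1 IH.
elim: s S T => [|x s IH] S T /=; first exact: pM.
rewrite pD !IH; congr (_ + _); apply: eq_rwedge => // l.
by rewrite /sgn_size /= pM ps.
Qed.

Section RWedgeMultilinear.
Context {K : comPzRingType} {M : lmodType K}.
Implicit Types (S T : seq M -> K) (s l : seq M).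

Lemma sgn_size_multilin T : multilin T -> multilin (sgn_size T).
Proof. by move=> H s1 s2 k u v; rewrite /sgn_size H !size_cat /=; ring. Qed.

Lemma rwedge_multilin S T : multilin S -> multilin T -> multilin (rwedge S T).
Proof.
move=> mS mT s1 s2 k u v; elim: s1 S T mS mT => [|x s1 IH] S T mS mT /=; last first.
  rewrite !IH; first by ring.
  - exact: sgn_size_multilin.
  - exact: multilin_cons.
  - exact: multilin_cons.
  - exact: mT.
rewrite (@eq_rwedge _ _ (fun l => S ((k *: u + v) :: l)) (fun l => k * S (u :: l) + S (v :: l)) T T) //;
  last by move=> l; apply: (mS [::]).
rewrite (@eq_rwedge _ _ (sgn_size S) (sgn_size S) (fun l => T ((k *: u + v) :: l)) (fun l => k * T (u :: l) + T (v :: l))) //;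
  last by move=> l; apply: (mT [::]).
by rewrite rwedgeDl rwedgeZl rwedgeDr rwedgeZr; ring.
Qed.

Lemma dsum_sgn_size g T s : dsum g (sgn_size T) s = sgn_size (dsum g T) s.
Proof.
rewrite /sgn_size.
(* The offset [k] counts the arguments already passed by the recursion, so that the induction goes
   through. *)
have E k : dsum g (fun l => (-1) ^+ (k + size l) * T l) s = (-1) ^+ (k + size s) * dsum g T s.
  elim: s k T => [|x s IH] k T /=; first by rewrite mulr0.
  rewrite mulrDr; congr (_ + _).
  rewrite (@eq_dsum _ _ g _ (fun l => (-1) ^+ (k.+1 + size l) * T (x :: l))).
    by rewrite (IH k.+1) addnS addSn.
  by move=> l; rewrite /= addSn addnS.
exact: (E 0%N).
Qed.

Lemma dsum_rwedge g S T s :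
  dsum g (rwedge S T) s = rwedge (dsum g S) T s + rwedge S (dsum g T) s.
Proof.
elim: s S T => [|x s IH] S T /=; first by rewrite mul0r mulr0 addr0.
rewrite dsumD !IH rwedgeDl rwedgeDr.
rewrite (@eq_rwedge _ _ (dsum g (sgn_size S)) (sgn_size (dsum g S)) (fun l => T (x :: l)) (fun l => T (x :: l))) //;
  last by move=> l; apply: dsum_sgn_size.
ring.
Qed.

End RWedgeMultilinear.

(** * Determinants by Laplace expansion *)

Section WDet.
Context {K : comPzRingType} {N M : lmodType K} (pr : M -> N -> K).
Implicit Types (X : seq N) (l : seq M).

(* The determinant of the [pr xi_i X_j], by Laplace expansion. *)
Fixpoint wdet X l : K :=
  if l is xi :: l' then altsum (fun x X' => pr xi x * wdet X' l') X
  else (size X == 0%N)%:R.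

Hypothesis pr_linl : forall k xi eta x, pr (k *: xi + eta) x = k * pr xi x + pr eta x.
Hypothesis pr_linr : forall k xi x y, pr xi (k *: x + y) = k * pr xi x + pr xi y.

Lemma wdet_size X l : size l != size X -> wdet X l = 0.
Proof.
elim: l X => [|xi l IH] X /=; first by rewrite eq_sym => /negPf->.
move=> sz; rewrite (@eq_altsum _ _ _ (fun _ _ => 0)) ?altsum0 // => x X' sX.
by rewrite IH ?mulr0 // -eqSS sX.
Qed.

Lemma wdet_degree X : degree (size X) (wdet X).
Proof. by move=> l; apply: wdet_size. Qed.

Lemma wdet_multilin X : multilin (wdet X).
Proof.
move=> s1 s2 k u v; elim: s1 X => [|xi s1 IH] X /=.
  rewrite -altsumZ -altsumD; apply: eq_altsum => x X' _.
  by rewrite pr_linl mulrDl mulrA.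
rewrite -altsumZ -altsumD; apply: eq_altsum => x X' _.
by rewrite IH; ring.
Qed.

(** For two equal rows the double expansion is symmetric in the two chosen columns, so
    [altsum_altsum_sym] applies. *)
Lemma wdet_altern X : altern (wdet X).
Proof.
move=> s1 u s2; elim: s1 X => [|xi s1 IH] X /=.
  rewrite (@eq_altsum _ _ _ (fun x X' => altsum (fun y X'' => pr u x * (pr u y * wdet X'' s2)) X')).
    by rewrite altsum_altsum_sym // => x y l; rewrite mulrCA.
  by move=> x X' _; rewrite altsumZ.
by rewrite (@eq_altsum _ _ _ (fun _ _ => 0)) ?altsum0 // => x X' _; rewrite IH mulr0.
Qed.

Lemma altsum_multilin (Psi : N -> seq N -> K) :
  (forall x, multilin (Psi x)) ->
  (forall k u v (w : seq N), Psi (k *: u + v) w = k * Psi u w + Psi v w) -> multilin (altsum Psi).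
Proof.
move=> mP lP s1 s2 k u v; elim: s1 Psi mP lP => [|x s1 IH] Psi mP lP /=.
  rewrite lP.
  rewrite (@eq_altsum _ _ _ (fun y (w : seq N) => k * Psi y (u :: w) + Psi y (v :: w))).
    by rewrite altsumD altsumZ; ring.
  by move=> y l _; apply: (mP y [::]).
rewrite mP IH; first by ring.
  by move=> y; apply: multilin_cons.
by move=> *; apply: lP.
Qed.

Lemma wdet_multilinr l : multilin (wdet ^~ l).
Proof.
elim: l => [|xi l IH] /=.
  by move=> s1 s2 k u v; rewrite !size_cat /= !addnS /=; ring.
apply: altsum_multilin.
  by move=> x s1 s2 k u v; rewrite IH; ring.
by move=> k u v l'; rewrite pr_linr; ring.
Qed.

(** Expansion along the last row, which is exchanged with each row before it by [altsum_altsumN]. *)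
Lemma wdet_rcons X l xi :
  wdet X (rcons l xi) = (-1) ^+ size l * altsum (fun x X' => pr xi x * wdet X' l) X.
Proof.
elim: l X => [|eta l IH] X /=; first by rewrite mul1r.
rewrite (@eq_altsum _ _ _ (fun x X' => (-1) ^+ size l *
   altsum (fun y X'' => pr eta x * (pr xi y * wdet X'' l)) X')); last first.
  by move=> x X' _; rewrite IH altsumZ mulrCA.
rewrite altsumZ altsum_altsumN exprS mulN1r mulrN mulNr; congr (- (_ * _)).
by apply: eq_altsum => x X' _; rewrite -altsumZ; apply: eq_altsum => y X'' _; rewrite mulrCA.
Qed.

End WDet.

Lemma eq_wdet (K : comPzRingType) (N M : lmodType K) (N' M' : lmodType K)
   (pr : M -> N -> K) (pr' : M' -> N' -> K) (f : N -> N') (g : M -> M') X l :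
  (forall xi x, pr' (g xi) (f x) = pr xi x) ->
  wdet pr' (map f X) (map g l) = wdet pr X l.
Proof.
move=> E; elim: l X => [|xi l IH] X /=; first by rewrite size_map.
suff H (Psi : N' -> seq N' -> K) Y : altsum Psi (map f Y) = altsum (fun x Z => Psi (f x) (map f Z)) Y.
  by rewrite H; apply: eq_altsum => x X' _; rewrite E IH.
by elim: Y Psi => //= x Y IHY Psi; rewrite IHY.
Qed.

Lemma altsum_eq0_mem {V : eqType} {K : comPzRingType} (Psi : V -> seq V -> K) s :
  (forall x l, x \in s -> Psi x l = 0) -> altsum Psi s = 0.
Proof.
elim: s Psi => //= x s IH Psi H; rewrite H ?mem_head // IH ?subrr // => y l ys.
by apply: H; rewrite inE ys orbT.
Qed.

(** * Bases, contractions and forms of top degree *)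

Section Basis.
Context {K : comPzRingType} {n : nat} {M : lmodType K} (e : 'I_n -> M) (co : 'I_n -> M -> K).
Implicit Types (T : seq M -> K) (l : seq M).

Hypothesis coE : forall x, x = \sum_i co i x *: e i.

Definition std := [seq e i | i <- enum 'I_n].

Lemma std_nonuniq T (s1 s2 : seq 'I_n) (i : 'I_n) : multilin T -> altern T -> i \in s1 ++ s2 ->
  T (map e s1 ++ e i :: map e s2) = 0.
Proof.
move=> mT aT H; apply: altern_nonuniq => //; first exact: multilin_skew.
rewrite -map_cons -map_cat; apply/negP => /map_uniq.
rewrite uniq_catC /= mem_cat orbC -mem_cat H.
by [].
Qed.

(** [xi] expands into basis vectors, all of which occur in [std] already. *)
Lemma altern_top T xi : multilin T -> altern T -> T (rcons std xi) = 0.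
Proof.
move=> mT aT; rewrite -cats1 [xi]coE multilin_sum // big1 // => i _.
rewrite multilinZ // (@std_nonuniq _ _ [::]) ?mulr0 //.
by rewrite cats0 mem_enum.
Qed.

(** In the slot of [e i] only the component of [g (e i)] on [e i] survives, the other basis vectors
    being present elsewhere. So a trace appears. *)
Lemma dsum_std g T : multilin T -> altern T ->
  dsum g T std = (\sum_i co i (g (e i))) * T std.
Proof.
move=> mT aT.
(* [I1] holds the slots already passed by the recursion of [dsum], [I2] those to come. *)
suff H I1 I2 : I1 ++ I2 = enum 'I_n ->
  dsum g (fun l => T (map e I1 ++ l)) (map e I2) = (\sum_(i <- I2) co i (g (e i))) * T std.
  by rewrite /std (H [::]) // -big_enum.
elim: I2 I1 => [|i I2 IH] I1 E /=; first by rewrite big_nil mul0r.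
rewrite big_cons mulrDl; congr (_ + _).
  rewrite {1}[g (e i)]coE multilin_sum // (bigD1 i) //= multilinZ //.
  rewrite -[in X in X + _]map_cons -map_cat E big1 ?addr0 // => k ki.
  rewrite multilinZ // std_nonuniq ?mulr0 //.
  have : k \in I1 ++ i :: I2 by rewrite E mem_enum.
  by rewrite !mem_cat inE (negPf ki).
rewrite -(IH (rcons I1 i)) ?cat_rcons //; apply: eq_dsum => l.
by rewrite map_rcons cat_rcons.
Qed.

Lemma multilin_std_ext T T' l : multilin T -> multilin T' ->
  (forall I : seq 'I_n, T (map e I) = T' (map e I)) -> T l = T' l.
Proof.
move=> mT mT' H.
suff G I : T (map e I ++ l) = T' (map e I ++ l) by apply: (G [::]).
elim: l I => [|x l IH] I; first by rewrite cats0.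
rewrite [x]coE !multilin_sum //; apply: eq_bigr => i _.
by rewrite !multilinZ // -!cat_rcons -map_rcons IH.
Qed.

Section Dual.
Context {N : lmodType K} (pr : M -> N -> K) (v : 'I_n -> N).
Hypothesis pr_linl : forall k xi eta x, pr (k *: xi + eta) x = k * pr xi x + pr eta x.
Hypothesis pr_dual : forall i j, pr (e i) (v j) = (i == j)%:R.

Lemma wdet_dual I : uniq I -> wdet pr (map v I) (map e I) = 1.
Proof.
elim: I => //= i I IH /andP[iI uI].
rewrite pr_dual eqxx mul1r IH // altsum_eq0_mem ?subr0 // => x l /mapP[j jI ->].
by rewrite pr_dual (negPf (memPnC iI j jI)) mul0r.
Qed.

(** The product of [T] and [wdet pr s] vanishes on the n + 1 covectors of [std] and [xi]
    ([altern_top]). Expanded along [xi], this moves the contraction by [xi] from [T] to [s]. It is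
    the algebraic core of the identity between d i(T) nu and the divergence of T. *)
Lemma interior_contract T xi (s : seq N) : multilin T -> altern T ->
  rwedge (fun l => T (rcons l xi)) (wdet pr s) std =
  altsum (fun x s' => pr xi x * rwedge T (wdet pr s') std) s.
Proof.
move=> mT aT.
have := @altern_top _ xi (rwedge_multilin mT (wdet_multilin pr_linl s))
                          (rwedge_altern aT (wdet_altern pr s)).
rewrite rwedge_rcons -rwedge_altsumr.
rewrite (@eq_rwedge _ _ T T (fun l => wdet pr s (rcons l xi))
  (fun l => - (-1) ^+ size s * altsum (fun x w' => pr xi x * wdet pr w' l) s)) //; last first.
  move=> l; rewrite wdet_rcons; have [E|ne] := eqVneq (size l).+1 (size s).
    by rewrite -E exprS mulN1r opprK.
  rewrite (@eq_altsum _ _ _ (fun _ _ => 0)) ?altsum0 ?mulr0 // => x w' sw.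
  by rewrite wdet_size ?mulr0 // -eqSS sw.
rewrite (@eq_rwedge _ _ _ (fun l => T (rcons l xi)) (sgn_size (wdet pr s))
  (fun l => (-1) ^+ size s * wdet pr s l)) //; last first.
  move=> l; rewrite /sgn_size; have [->//|ne] := eqVneq (size l) (size s).
  by rewrite wdet_size ?mulr0.
rewrite !rwedgeZr mulNr addrC -mulrBr => /(congr1 (fun a => (-1) ^+ size s * a)).
by rewrite mulrA -exprMn mulrNN mulr1 expr1n mul1r mulr0 => /eqP; rewrite subr_eq0 => /eqP.
Qed.

(** By [interior_contract] the hypothesis is inherited by the contractions of [T], down to degree 0,
    where the dual basis [map v (enum 'I_n)] detects the scalar. *)
Lemma interior_inj a T l : multilin T -> altern T -> degree a T ->
  (forall s : seq N, rwedge T (wdet pr s) std = 0) -> T l = 0.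
Proof.
elim: a T l => [|a IH] T l mT aT dT H.
  have [/size0nil ->|/dT //] := eqVneq (size l) 0%N.
  have := H (map v (enum 'I_n)).
  by rewrite rwedge_degree0l // /std wdet_dual ?enum_uniq // mulr1.
have [sl|/dT //] := eqVneq (size l) a.+1.
case: l / lastP sl => [//|l xi] _.
apply: (IH (fun l => T (rcons l xi))).
- by move=> s1 s2 k u w; rewrite !rcons_cat mT.
- by move=> s1 u s2; rewrite rcons_cat aT.
- by move=> s; rewrite -eqSS -(size_rcons s xi); apply: dT.
- move=> s; rewrite interior_contract //.
  by rewrite (@eq_altsum _ _ _ (fun _ _ => 0)) ?altsum0 // => x w _; rewrite H mulr0.
Qed.

(** The difference of the two sides has degree n and vanishes at [std]; multiplied by a nonempty
    [s], it has too large a degree for n covectors. So [interior_inj] applies to it. *)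
Lemma top_form T l : multilin T -> altern T -> degree n T ->
  T l = T std * wdet pr (map v (enum 'I_n)) l.
Proof.
move=> mT aT dT; set W := wdet pr _.
have mW : multilin W by apply: wdet_multilin.
have aW : altern W by apply: wdet_altern.
have dW : degree n W.
  by rewrite -[X in degree X]size_enum_ord -(size_map v); apply: wdet_degree.
apply/eqP; rewrite -subr_eq0; apply/eqP.
pose B l := T l - T std * W l.
have dB : degree n B by move=> s ns; rewrite /B dT // dW // mulr0 subrr.
apply: (@interior_inj n B) => //.
- by move=> s1 s2 k u w; rewrite /B mT mW; ring.
- by move=> s1 u s2; rewrite /B aT aW mulr0 subrr.
- move=> [|x s].
    rewrite rwedge_degree0r /B; last by move=> z; apply: (@wdet_size _ _ _ pr [::]).
    by rewrite /W wdet_dual ?enum_uniq // mulr1 subrr mul0r.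
  apply: rwedge_eq0 => l1 l2; rewrite size_map size_enum_ord => E.
  have [E1|/dB->] := eqVneq (size l1) n; last by rewrite mul0r.
  rewrite (@wdet_size _ _ _ pr (x :: s)) ?mulr0 //.
  by move: E; rewrite E1 -[RHS]addn0 => /addnI ->.
Qed.

End Dual.

End Basis.

Section AltSumIn.
Context {V : eqType} {K : comPzRingType}.

Lemma eq_altsum_in (Psi Psi' : V -> seq V -> K) s :
  (forall x l, x \in s -> {subset l <= s} -> Psi x l = Psi' x l) -> altsum Psi s = altsum Psi' s.
Proof.
elim: s Psi Psi' => //= x s IH Psi Psi' H; rewrite H ?mem_head //; last first.
  by move=> y ys; rewrite inE ys orbT.
congr (_ - _); apply: IH => y l ys sl; apply: H; first by rewrite inE ys orbT.
by move=> z; rewrite !inE => /orP[->//|/sl->]; rewrite orbT.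
Qed.

Lemma eq_altsum2_in (Psi Psi' : V -> V -> seq V -> K) s :
  (forall x y l, x \in s -> y \in s -> {subset l <= s} -> Psi x y l = Psi' x y l) ->
  altsum2 Psi s = altsum2 Psi' s.
Proof.
elim: s Psi Psi' => //= x s IH Psi Psi' H; congr (_ + _).
  apply: eq_altsum_in => y l ys sl; apply: H; rewrite ?mem_head // ?inE ?ys ?orbT //.
  by move=> z zl; rewrite inE sl ?orbT.
apply: IH => y z l ys zs sl; apply: H; rewrite ?inE ?ys ?zs ?orbT //.
by move=> t; rewrite !inE => /orP[->//|/sl->]; rewrite orbT.
Qed.

Lemma raddf_altsum (K' : comPzRingType) (phi : K -> K') (Psi : V -> seq V -> K) s :
  (forall a b, phi (a + b) = phi a + phi b) ->
  phi (altsum Psi s) = altsum (fun x l => phi (Psi x l)) s.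
Proof.
move=> pD; have p0 : phi 0 = 0 by apply: (@addrI _ (phi 0)); rewrite -pD !addr0.
have pN a : phi (- a) = - phi a by apply/eqP; rewrite -addr_eq0 -pD addNr p0.
by elim: s Psi => //= x s IH Psi; rewrite pD pN IH.
Qed.

Lemma raddf_altsum2 (K' : comPzRingType) (phi : K -> K') (Psi : V -> V -> seq V -> K) s :
  (forall a b, phi (a + b) = phi a + phi b) ->
  phi (altsum2 Psi s) = altsum2 (fun x y l => phi (Psi x y l)) s.
Proof.
move=> pD; have p0 : phi 0 = 0 by apply: (@addrI _ (phi 0)); rewrite -pD !addr0.
by elim: s Psi => //= x s IH Psi; rewrite pD IH raddf_altsum.
Qed.

End AltSumIn.

Lemma dsum0 (K : comPzRingType) (M : lmodType K) (T : seq M -> K) s :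
  multilin T -> dsum (fun=> 0) T s = 0.
Proof.
elim: s T => //= x s IH T mT.
by rewrite (multilin0 [::]) // IH ?addr0 //; apply: multilin_cons.
Qed.

(** * Extension of a derivation to tensors *)

Section LieDerivative.
Context {K : comPzRingType} {M : lmodType K} (d : K -> K) (g : M -> M).
Implicit Types (T : seq M -> K) (s : seq M).
Hypothesis dD : forall a b, d (a + b) = d a + d b.
Hypothesis dM : forall a b, d (a * b) = d a * b + a * d b.
Hypothesis g_lin : forall k x y, g (k *: x + y) = k *: g x + d k *: x + g y.

Definition lie T s := d (T s) - dsum g T s.

Lemma lie_cons T x s : lie T (x :: s) = lie (fun l => T (x :: l)) s - T (g x :: s).
Proof. by rewrite /lie /= opprD addrA addrAC. Qed.

Lemma lie_multilin T : multilin T -> multilin (lie T).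
Proof.
move=> mT s1 s2 k u v; elim: s1 T mT => [|x s1 IH] T mT /=.
  rewrite /lie /= (mT [::]) /= dD dM g_lin (multilinD [::]) // (mT [::]) (multilinZ [::]) //=.
  rewrite (@eq_dsum _ _ g (fun l => T ((k *: u + v) :: l)) (fun l => k * T (u :: l) + T (v :: l))); last first.
    by move=> l; rewrite (mT [::]).
  by rewrite dsumD dsumZ; ring.
rewrite !lie_cons IH; last exact: multilin_cons.
by rewrite (mT (g x :: s1)) /=; ring.
Qed.

Lemma lie_altern T : multilin T -> altern T -> altern (lie T).
Proof.
move=> mT aT s1 u s2; elim: s1 T mT aT => [|x s1 IH] T mT aT /=.
  have sT := multilin_skew mT aT.
  rewrite !lie_cons /lie /= (aT [::]).
  rewrite (@eq_dsum _ _ g (fun l => T (u :: u :: l)) (fun l => 0 * T l)); last first.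
    by move=> l; rewrite (aT [::]) mul0r.
  have d0 : d 0 = 0 by apply: (@addrI _ (d 0)); rewrite -dD !addr0.
  by rewrite dsumZ d0 (sT [::]) /=; ring.
rewrite !lie_cons (aT (g x :: s1)) subr0 IH //; [exact: multilin_cons|exact: altern_cons].
Qed.

End LieDerivative.

(** * The Poisson differential and the divergence *)

Section BivectorField.
Context {K : comPzRingType} {n : nat} (d : 'I_n -> K -> K) (P : 'M[K]_n) (half : K).
Notation M := 'cV[K]_n.
Implicit Types (T A : seq M -> K) (s : seq M) (x y : M) (h : K).

Hypothesis dD : forall k a b, d k (a + b) = d k a + d k b.
Hypothesis dM : forall k a b, d k (a * b) = d k a * b + a * d k b.
Hypothesis dC : forall k l a, d k (d l a) = d l (d k a).
Hypothesis PC : forall i j, P i j = - P j i.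
Hypothesis Pii : forall i, P i i = 0.
Hypothesis halfE : half + half = 1.

Definition bil (Q : 'M[K]_n) x y : K := \sum_i \sum_j Q i j * (x i 0 * y j 0).
Definition grad h : M := \col_i d i h.
Definition dcol k x : M := map_mx (d k) x.
Definition dbiv k : 'M[K]_n := map_mx (d k) P.
Definition cov k : M := delta_mx k 0.
(** When [P] is the matrix of Pi, this is minus the derivation along sharp x, since Pi(x, dh) =
    -dh(sharp x). Accordingly [biv_br] is minus the bracket of 1-forms [x, y]_Pi. *)
Definition biv_act x h := bil P x (grad h).
Definition biv_br x y : M :=
  \col_l (biv_act x (y l 0) - biv_act y (x l 0) + bil (dbiv l) x y).
Definition const_cov x := forall k, dcol k x = 0.

Lemma d0 k : d k 0 = 0.
Proof. by apply: (@addrI _ (d k 0)); rewrite -dD !addr0. Qed.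

Lemma dN k a : d k (- a) = - d k a.
Proof. by apply/eqP; rewrite -addr_eq0 -dD addNr d0. Qed.

Lemma d1 k : d k 1 = 0.
Proof. by have := dM k 1 1; rewrite !mulr1 mul1r -{1}[d k 1]addr0 => /addrI/esym. Qed.

Lemma d_sum k (I : finType) (F : I -> K) : d k (\sum_i F i) = \sum_i d k (F i).
Proof. exact: (big_morph _ (dD k) (d0 k)). Qed.

Lemma sum_antisym (F : 'I_n -> 'I_n -> K) :
  (forall i j, F i j = - F j i) -> \sum_i \sum_j F i j = 0.
Proof.
move=> H; set X := \sum_i _.
have E : X = - X.
  rewrite {1}/X exchange_big /= -sumrN; apply: eq_bigr => i _.
  by rewrite -sumrN; apply: eq_bigr => j _.
by rewrite -[X]mul1r -halfE mulrDl {2}E mulrN subrr.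
Qed.

Lemma bil_linl Q k x x' y : bil Q (k *: x + x') y = k * bil Q x y + bil Q x' y.
Proof.
rewrite mulr_sumr -big_split; apply: eq_bigr => i _ /=.
rewrite mulr_sumr -big_split; apply: eq_bigr => j _ /=.
by rewrite !mxE; ring.
Qed.

Lemma bil_linr Q k x y y' : bil Q x (k *: y + y') = k * bil Q x y + bil Q x y'.
Proof.
rewrite mulr_sumr -big_split; apply: eq_bigr => i _ /=.
rewrite mulr_sumr -big_split; apply: eq_bigr => j _ /=.
by rewrite !mxE; ring.
Qed.

Lemma bilC (Q : 'M[K]_n) x y : (forall i j, Q i j = - Q j i) -> bil Q x y = - bil Q y x.
Proof.
move=> H; rewrite /bil exchange_big /= -sumrN; apply: eq_bigr => i _.
by rewrite -sumrN; apply: eq_bigr => j _; rewrite H; ring.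
Qed.

Lemma bilxx (Q : 'M[K]_n) x : (forall i j, Q i j = - Q j i) -> bil Q x x = 0.
Proof. by move=> H; apply: sum_antisym => i j; rewrite H; ring. Qed.

Lemma dbivC k i j : dbiv k i j = - dbiv k j i.
Proof. by rewrite !mxE PC dN. Qed.

Lemma bil_covr Q x y : bil Q x y = \sum_k y k 0 * bil Q x (cov k).
Proof.
rewrite /bil exchange_big /=; apply: eq_bigr => k _.
rewrite mulr_sumr; apply: eq_bigr => i _.
rewrite (bigD1 k) //= big1 => [|j jk].
  by rewrite /cov mxE !eqxx addr0 mulr1 [RHS]mulrC mulrA.
by rewrite /cov mxE (negPf jk) !mulr0.
Qed.

Lemma grad_covE h : grad h = \sum_k d k h *: cov k.
Proof.
apply/colP => i; rewrite mxE summxE (bigD1 i) //= !mxE !eqxx mulr1 big1 ?addr0 // => j ji.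
by rewrite !mxE eq_sym (negPf ji) mulr0.
Qed.

Lemma col_covE x : x = \sum_k x k 0 *: cov k.
Proof.
apply/colP => i; rewrite summxE (bigD1 i) //= !mxE !eqxx mulr1 big1 ?addr0 // => j ji.
by rewrite !mxE eq_sym (negPf ji) mulr0.
Qed.

Lemma d_bil k x y :
  d k (bil P x y) = bil (dbiv k) x y + bil P (dcol k x) y + bil P x (dcol k y).
Proof.
rewrite d_sum -!big_split; apply: eq_bigr => i _ /=.
rewrite d_sum -!big_split; apply: eq_bigr => j _ /=.
by rewrite !dM !mxE; ring.
Qed.

Lemma bil0l Q y : bil Q 0 y = 0.
Proof. by rewrite /bil big1 // => i _; rewrite big1 // => j _; rewrite mxE mul0r mulr0. Qed.

Lemma bil0r Q x : bil Q x 0 = 0.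
Proof. by rewrite /bil big1 // => i _; rewrite big1 // => j _; rewrite mxE !mulr0. Qed.

Lemma d_bil_const k x y : const_cov x -> const_cov y -> d k (bil P x y) = bil (dbiv k) x y.
Proof. by move=> cx cy; rewrite d_bil cx cy bil0l bil0r !addr0. Qed.

Lemma const_cov_cov k : const_cov (cov k).
Proof.
move=> l; apply/colP => i; rewrite !mxE.
by case: (_ && _); rewrite ?d1 ?d0.
Qed.

Lemma gradD a b : grad (a + b) = grad a + grad b.
Proof. by apply/colP => i; rewrite !mxE dD. Qed.

Lemma dcol_grad k h : dcol k (grad h) = grad (d k h).
Proof. by apply/colP => i; rewrite !mxE dC. Qed.

Lemma dcol_lin k a x y : dcol k (a *: x + y) = a *: dcol k x + d k a *: x + dcol k y.
Proof. by apply/colP => i; rewrite !mxE dD dM; ring. Qed.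

Lemma biv_actD x a b : biv_act x (a + b) = biv_act x a + biv_act x b.
Proof. by rewrite /biv_act gradD -{1}[grad a]scale1r bil_linr mul1r. Qed.

Lemma gradM a b : grad (a * b) = b *: grad a + a *: grad b.
Proof. by apply/colP => i; rewrite !mxE dM; ring. Qed.

Lemma bilZr Q k x y : bil Q x (k *: y) = k * bil Q x y.
Proof. by rewrite -[k *: y]addr0 bil_linr bil0r addr0. Qed.

Lemma bilZl Q k x y : bil Q (k *: x) y = k * bil Q x y.
Proof. by rewrite -[k *: x]addr0 bil_linl bil0l addr0. Qed.

Lemma bilDr Q x y y' : bil Q x (y + y') = bil Q x y + bil Q x y'.
Proof. by rewrite -{1}[y]scale1r bil_linr mul1r. Qed.

Lemma bilDl Q x x' y : bil Q (x + x') y = bil Q x y + bil Q x' y.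
Proof. by rewrite -{1}[x]scale1r bil_linl mul1r. Qed.

Lemma biv_actM x a b : biv_act x (a * b) = biv_act x a * b + a * biv_act x b.
Proof. by rewrite /biv_act gradM bil_linr bilZr; ring. Qed.

Lemma biv_act_lin k x y a : biv_act (k *: x + y) a = k * biv_act x a + biv_act y a.
Proof. exact: bil_linl. Qed.

Lemma biv_brD x y z : biv_br x (y + z) = biv_br x y + biv_br x z.
Proof.
apply/colP => l; rewrite !mxE biv_actD bilDr.
have -> : biv_act (y + z) (x l 0) = biv_act y (x l 0) + biv_act z (x l 0) by apply: bilDl.
ring.
Qed.

Lemma biv_brZ x k y : biv_br x (k *: y) = k *: biv_br x y + biv_act x k *: y.
Proof.
apply/colP => l; rewrite !mxE biv_actM bilZr.
have -> : biv_act (k *: y) (x l 0) = k * biv_act y (x l 0) by apply: bilZl.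
ring.
Qed.

Lemma biv_brC x y : biv_br x y = - biv_br y x.
Proof.
by apply/colP => l; rewrite !mxE (bilC _ _ (dbivC l)); ring.
Qed.

Lemma biv_brr x : biv_br x x = 0.
Proof. by apply/colP => l; rewrite !mxE (bilxx _ (dbivC l)); ring. Qed.

(** Closedness turns [biv_act x (y l 0)] into Pi(x, d_l y), and the components of the bracket become
    the Leibniz expansion of d_l Pi(x, y). *)
Lemma biv_br_closed x y : (forall k l, d k (x l 0) = d l (x k 0)) -> 
  (forall k l, d k (y l 0) = d l (y k 0)) -> biv_br x y = grad (bil P x y).
Proof.
move=> cx cy; apply/colP => l; rewrite !mxE d_bil.
have E (z : M) : (forall k l, d k (z l 0) = d l (z k 0)) -> grad (z l 0) = dcol l z.
  by move=> cz; apply/colP => i; rewrite !mxE cz.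
by rewrite /biv_act !E // (bilC y _ PC); ring.
Qed.

Lemma const_closed x : const_cov x -> forall k l, d k (x l 0) = d l (x k 0).
Proof.
move=> cx k l.
by have := cx k => /colP/(_ l); have := cx l => /colP/(_ k); rewrite !mxE => -> ->.
Qed.

Definition poisson_diff := lr_d biv_act biv_br.

Lemma poisson_diff_multilin T : multilin T -> altern T -> multilin (poisson_diff T).
Proof.
apply: lr_d_multilin; do ?[exact: biv_actD|exact: biv_actM|exact: biv_act_lin|exact: biv_brD|
 exact: biv_brZ|exact: biv_brC].
Qed.

Lemma poisson_diff_altern T : multilin T -> altern T -> altern (poisson_diff T).
Proof. by apply: lr_d_altern; [exact: biv_actD|exact: biv_brr]. Qed.

(** The covariant derivative along d_k of the flat connection for which the coordinate covectors are
    parallel. *)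
Definition nabla k T s := lie (d k) (dcol k) T s.

Lemma nabla_multilin k T : multilin T -> multilin (nabla k T).
Proof. apply: lie_multilin; [exact: dD|exact: dM|exact: dcol_lin]. Qed.

Lemma nabla_altern k T : multilin T -> altern T -> altern (nabla k T).
Proof. apply: lie_altern; exact: dD. Qed.

Lemma nabla_const k T s : multilin T -> (forall x, x \in s -> const_cov x) ->
  nabla k T s = d k (T s).
Proof.
move=> mT cs; rewrite /nabla /lie.
suff -> : dsum (dcol k) T s = 0 by rewrite subr0.
elim: s T mT cs => //= x s IH T mT cs.
rewrite cs ?mem_head // (multilin0 [::]) // IH ?addr0 //; first exact: multilin_cons.
by move=> y ys; apply: cs; rewrite inE ys orbT.
Qed.

Lemma nabla_cons k T x s : multilin T -> const_cov x ->
  nabla k T (x :: s) = nabla k (fun l => T (x :: l)) s.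
Proof. by move=> mT cx; rewrite /nabla lie_cons cx (multilin0 [::]) // subr0. Qed.

Lemma d_cons k T x s : multilin T -> (forall y, y \in s -> const_cov y) ->
  d k (T (x :: s)) = nabla k T (x :: s) + T (dcol k x :: s).
Proof.
move=> mT cs; rewrite /nabla lie_cons -[lie _ _ _ _]/(nabla _ _ _) nabla_const ?subrK //.
exact: multilin_cons.
Qed.

Lemma d_dsum k g T s : multilin T -> (forall y, y \in s -> const_cov y) ->
  d k (dsum g T s) = dsum g (nabla k T) s + dsum (dcol k \o g) T s.
Proof.
elim: s T => [|x s IH] T mT cs /=; first by rewrite d0 addr0.
have cs' y : y \in s -> const_cov y by move=> ys; apply: cs; rewrite inE ys orbT.
rewrite dD d_cons // IH //; last exact: multilin_cons.
rewrite (@eq_dsum _ _ g (fun l => nabla k T (x :: l)) (nabla k (fun l => T (x :: l)))); last first.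
  by move=> l; rewrite nabla_cons //; apply: cs; rewrite mem_head.
by rewrite addrACA.
Qed.

(** The divergence for a density with logarithmic gradient [lam], with the contracted covector in
    front as Cartan's formula [poisson_diff_cons] wants it. *)
Definition div_left (lam : M) T s := \sum_k nabla k T (cov k :: s) + T (lam :: s).

Lemma poisson_diff_const T s : (forall x, x \in s -> const_cov x) ->
  poisson_diff T s = altsum (fun x l => bil P x (grad (T l))) s
                   - altsum2 (fun x y l => T (grad (bil P x y) :: l)) s.
Proof.
move=> cs; rewrite /poisson_diff /lr_d; congr (_ - _).
apply: eq_altsum2_in => x y l xs ys _.
by rewrite biv_br_closed //; apply: const_closed; apply: cs.
Qed.

(** The terms of d_k ([poisson_diff T]) in which the derivative falls on [P]: the defect of
    commutation of d_k with the Poisson differential. *)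
Definition poisson_diff_deriv k T s :=
  altsum (fun x l => bil (dbiv k) x (grad (T l))) s
  - altsum2 (fun x y l => T (grad (d k (bil P x y)) :: l)) s.

Lemma d_poisson_diff k T s : multilin T -> (forall x, x \in s -> const_cov x) ->
  d k (poisson_diff T s) = poisson_diff (nabla k T) s + poisson_diff_deriv k T s.
Proof.
move=> mT cs; rewrite !poisson_diff_const // dD dN raddf_altsum; last exact: dD.
rewrite raddf_altsum2; last exact: dD.
rewrite addrACA -opprD -altsumD -altsum2D; congr (_ - _).
  apply: eq_altsum_in => x l xs sl.
  rewrite d_bil cs // bil0l addr0 dcol_grad nabla_const //; first by rewrite addrC.
  by move=> y /sl; apply: cs.
apply: eq_altsum2_in => x y l xs ys sl.
rewrite d_cons //; last by move=> z /sl; apply: cs.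
by rewrite dcol_grad.
Qed.

Lemma poisson_diff_cons T x s : multilin T -> altern T ->
  poisson_diff T (x :: s) =
  biv_act x (T s) - dsum (biv_br x) T s - poisson_diff (fun l => T (x :: l)) s.
Proof.
move=> mT aT; have sT := multilin_skew mT aT.
by rewrite /poisson_diff lr_d_cons // altsum_dsum.
Qed.

Lemma poisson_diffD T T' s :
  poisson_diff (fun l => T l + T' l) s = poisson_diff T s + poisson_diff T' s.
Proof. by apply: lr_dD; apply: biv_actD. Qed.

Lemma poisson_diff_sum (I : finType) (F : I -> seq M -> K) s :
  poisson_diff (fun l => \sum_i F i l) s = \sum_i poisson_diff (F i) s.
Proof.
elim: (index_enum I) => [|i r IH].
  rewrite big_nil /poisson_diff (eq_lr_d _ _ (T' := fun=> 0)); last by move=> l; rewrite big_nil.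
  rewrite /lr_d altsum2_0 (@eq_altsum _ _ _ (fun _ _ => 0)) ?altsum0 ?subrr //.
  by move=> x l _; apply: act0; apply: biv_actD.
rewrite big_cons -IH -poisson_diffD; apply: eq_lr_d => l; exact: big_cons.
Qed.

(* The component on [x] of the modular vector field. *)
Definition modular_covec (lam : M) x := \sum_k bil (dbiv k) (cov k) x + bil P lam x.

(** Cartan's formula turns every contraction, by [cov k] or by [lam], into a Lie derivative. The
    second derivatives of [A] and the products of first derivatives of [P] and [A] cancel, except
    for those that form the Lie derivative along the modular field. *)
Lemma div_poisson_diff (lam : M) A s : multilin A -> altern A ->
  (forall k l, d k (lam l 0) = d l (lam k 0)) -> (forall x, x \in s -> const_cov x) ->
  div_left lam (poisson_diff A) s + poisson_diff (div_left lam A) s =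
  modular_covec lam (grad (A s)) - dsum (fun x => grad (modular_covec lam x)) A s.
Proof.
move=> mA aA clam cs.
have mQ := poisson_diff_multilin mA aA.
have ccs k x : x \in cov k :: s -> const_cov x.
  by rewrite inE => /orP[/eqP->|/cs//]; apply: const_cov_cov.
have mc x : multilin (fun l => A (x :: l)) by apply: multilin_cons.
rewrite /div_left poisson_diffD poisson_diff_sum addrACA -big_split /=.
rewrite (poisson_diff_cons lam s mA aA) subrK.
(* Cartan's formula for [cov k], differentiated by d_k; the last term corrects the exchange of d_k
   with the Poisson differential. *)
have Ek k : nabla k (poisson_diff A) (cov k :: s) + poisson_diff (fun l => nabla k A (cov k :: l)) s
  = d k (biv_act (cov k) (A s)) - d k (dsum (biv_br (cov k)) A s)
    - poisson_diff_deriv k (fun l => A (cov k :: l)) s.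
  rewrite nabla_const //; last exact: ccs.
  have -> : poisson_diff (fun l => nabla k A (cov k :: l)) s
          = poisson_diff (nabla k (fun l => A (cov k :: l))) s.
    by apply: eq_lr_d => l; rewrite nabla_cons //; apply: const_cov_cov.
  by rewrite poisson_diff_cons // !dD !dN d_poisson_diff //; ring.
rewrite (eq_bigr _ (fun k _ => Ek k)).
under eq_bigr => k _ do rewrite /biv_act d_bil const_cov_cov bil0l addr0 dcol_grad d_dsum //.
under eq_bigr => k _ do rewrite opprD.
rewrite !big_split /= !sumrN.
(* The second derivatives of [A s] are symmetric and [P] is antisymmetric. *)
have -> : \sum_k bil P (cov k) (grad (d k (A s))) = 0.
  under eq_bigr => k _ do rewrite bil_covr.
  apply: sum_antisym => i j; rewrite !mxE dC (bilC _ _ PC); ring.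
(* The terms with first derivatives of [A] cancel in pairs because the derivatives of [P] are
   antisymmetric; those with second derivatives of [P] vanish because [A] is alternating. *)
have E3 : \sum_k dsum (biv_br (cov k)) (nabla k A) s
        + \sum_k poisson_diff_deriv k (fun l => A (cov k :: l)) s = 0.
  rewrite /poisson_diff_deriv sumrB.
  have -> : \sum_k altsum2 (fun x y l => A (cov k :: grad (d k (bil P x y)) :: l)) s = 0.
    rewrite -altsum2_sum (@eq_altsum2 _ _ _ (fun _ _ _ => 0)) ?altsum2_0 // => x y l.
    under eq_bigr => k _ do rewrite grad_covE (@multilin_sum _ _ A [:: cov k]) //.
    apply: sum_antisym => i j.
    rewrite !(@multilinZ _ _ A [:: _]) // dC /= (multilin_skew mA aA [::]) /=; ring.
  rewrite subr0.
  have -> : \sum_k altsum (fun x l => bil (dbiv k) x (grad (A (cov k :: l)))) s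
          = \sum_k \sum_l dsum (fun x => bil (dbiv l) x (cov k) *: cov l) (nabla k A) s.
    rewrite exchange_big /=; apply: eq_bigr => k _.
    have sk i := multilin_skew (nabla_multilin i mA) (nabla_altern i mA aA).
    under [RHS]eq_bigr => i _ do rewrite -(altsum_dsum _ _ (sk i)).
    rewrite -altsum_sum; apply: eq_altsum_in => x l xs sl.
    rewrite bil_covr; apply: eq_bigr => i _.
    rewrite (multilinZ [::]) /=; last exact: nabla_multilin.
    rewrite !mxE mulrC nabla_const // => z; rewrite inE => /orP[/eqP->|/sl/cs//].
    exact: const_cov_cov.
  rewrite -big_split big1 // => k _ /=.
  rewrite (@eq_dsumg _ _ _ (fun x => \sum_l bil (dbiv l) (cov k) x *: cov l)).
    rewrite dsum_gsum; last exact: nabla_multilin.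
    rewrite -big_split big1 // => l _ /=.
    rewrite (@eq_dsumg _ _ (fun x => bil (dbiv l) x (cov k) *: cov l)
       (fun x => -1 *: (bil (dbiv l) (cov k) x *: cov l) + 0)).
      rewrite dsum_lin; last exact: nabla_multilin.
      rewrite mulN1r addrA subrr add0r.
      by rewrite dsum0 //; apply: nabla_multilin.
    by move=> x _; rewrite addr0 scaleN1r -scaleNr (bilC _ _ (dbivC l)).
  move=> x xs; rewrite biv_br_closed; [|exact/const_closed/const_cov_cov|exact/const_closed/cs].
  rewrite grad_covE; apply: eq_bigr => l _.
  by rewrite d_bil_const //; [exact: const_cov_cov|exact: cs].
(* On closed covectors each bracket is a gradient, so the remaining sums over the slots assemble
   into the gradient of the modular field. *)
have E4 : dsum (fun x => grad (modular_covec lam x)) A s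
  = \sum_k dsum (dcol k \o biv_br (cov k)) A s + dsum (biv_br lam) A s.
  rewrite -dsum_gsum // -[X in X + _]mul1r -dsum_lin //; apply: eq_dsumg => x xs.
  rewrite scale1r biv_br_closed //; last exact/const_closed/cs.
  rewrite /modular_covec gradD; congr (_ + _).
  rewrite (big_morph _ gradD (id1 := 0)); last by apply/colP => i; rewrite !mxE d0.
  apply: eq_bigr => k _ /=; rewrite biv_br_closed; [|exact/const_closed/const_cov_cov|exact/const_closed/cs].
  by rewrite dcol_grad d_bil_const //; [exact: const_cov_cov|exact: cs].
rewrite E4 /modular_covec /biv_act addr0.
move/eqP: E3; rewrite addrC addr_eq0 => /eqP->.
ring.
Qed.

End BivectorField.

(** * The de Rham differential and volume forms *)

Lemma eq_rwedge_in (V : eqType) (K : comPzRingType) (S S' T T' : seq V -> K) s :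
  (forall l, {subset l <= s} -> S l = S' l) -> (forall l, {subset l <= s} -> T l = T' l) ->
  rwedge S T s = rwedge S' T' s.
Proof.
elim: s S S' T T' => [|x s IH] S S' T T' ES ET /=; first by rewrite ES // ET.
have sx l : {subset l <= s} -> {subset x :: l <= x :: s}.
  by move=> sl y; rewrite !inE => /orP[->//|/sl->]; rewrite orbT.
have sx' l : {subset l <= s} -> {subset l <= x :: s}.
  by move=> sl y /sl; rewrite inE orbC => ->.
by congr (_ + _); apply: IH => l sl; rewrite /sgn_size ?ES ?ET //; auto.
Qed.

Lemma wdet_alternr (K : comPzRingType) (N M : lmodType K) (pr : M -> N -> K) l :
  altern (wdet pr ^~ l).
Proof.
elim: l => [|xi l IH] /=; first by move=> s1 u s2; rewrite size_cat addnC.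
apply: altsum_altern => x s1 u s2.
by rewrite IH mulr0.
Qed.

Section RowStd.
Context {K : comPzRingType} {n : nat}.

Definition vec (i : 'I_n) : 'rV[K]_n := delta_mx 0 i.

Lemma row_vecE (x : 'rV[K]_n) : x = \sum_k x 0 k *: vec k.
Proof.
apply/rowP => i; rewrite summxE (bigD1 i) //= !mxE !eqxx mulr1 big1 ?addr0 // => j ji.
by rewrite !mxE eq_sym (negPf ji) andbF mulr0.
Qed.

Definition kpair (xi : 'cV[K]_n) (v : 'rV[K]_n) : K := (v *m xi) 0 0.

Lemma kpairE xi v : kpair xi v = \sum_k v 0 k * xi k 0.
Proof. by rewrite /kpair mxE. Qed.

Lemma kpair_linl k xi eta x : kpair (k *: xi + eta) x = k * kpair xi x + kpair eta x.
Proof. by rewrite /kpair mulmxDr -scalemxAr !mxE. Qed.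

Lemma kpair_linr k xi x y : kpair xi (k *: x + y) = k * kpair xi x + kpair xi y.
Proof. by rewrite /kpair mulmxDl -scalemxAl !mxE. Qed.

Lemma kpair_cov k x : kpair (cov k) x = x 0 k.
Proof.
rewrite kpairE (bigD1 k) //= !mxE !eqxx mulr1 big1 ?addr0 // => j jk.
by rewrite !mxE (negPf jk) mulr0.
Qed.

Lemma kpair_dual i j : kpair (cov i) (vec j) = (i == j)%:R.
Proof. by rewrite kpair_cov mxE eqxx. Qed.

End RowStd.

Section VectorFields.
Context {K : comPzRingType} {n : nat} (d : 'I_n -> K -> K).
Notation M := 'cV[K]_n.
Notation N := 'rV[K]_n.
Hypothesis dD : forall k a b, d k (a + b) = d k a + d k b.
Hypothesis dM : forall k a b, d k (a * b) = d k a * b + a * d k b.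
Implicit Types (T : seq M -> K) (s : seq N).

Definition vec_act (X : N) h : K := \sum_k X 0 k * d k h.
Definition vec_br (X Y : N) : N := \row_l (vec_act X (Y 0 l) - vec_act Y (X 0 l)).

Lemma vec_actD X a b : vec_act X (a + b) = vec_act X a + vec_act X b.
Proof. by rewrite -big_split; apply: eq_bigr => k _; rewrite dD mulrDr. Qed.

Lemma vec_actM X a b : vec_act X (a * b) = vec_act X a * b + a * vec_act X b.
Proof.
rewrite mulr_suml mulr_sumr -big_split; apply: eq_bigr => k _ /=; rewrite dM; ring.
Qed.

Lemma vec_act_lin k X Y a : vec_act (k *: X + Y) a = k * vec_act X a + vec_act Y a.
Proof.
rewrite mulr_sumr -big_split; apply: eq_bigr => l _ /=; rewrite !mxE; ring.
Qed.

Lemma vec_actZ k X a : vec_act (k *: X) a = k * vec_act X a.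
Proof. by rewrite mulr_sumr; apply: eq_bigr => l _; rewrite !mxE mulrA. Qed.

Lemma vec_actDl X Y a : vec_act (X + Y) a = vec_act X a + vec_act Y a.
Proof. by rewrite -[X]scale1r vec_act_lin scale1r mul1r. Qed.

Lemma vec_brD X Y Z : vec_br X (Y + Z) = vec_br X Y + vec_br X Z.
Proof. by apply/rowP => l; rewrite !mxE vec_actD vec_actDl; ring. Qed.

Lemma vec_brZ X k Y : vec_br X (k *: Y) = k *: vec_br X Y + vec_act X k *: Y.
Proof. by apply/rowP => l; rewrite !mxE vec_actM vec_actZ; ring. Qed.

Lemma vec_brC X Y : vec_br X Y = - vec_br Y X.
Proof. by apply/rowP => l; rewrite !mxE opprB. Qed.

Definition de_rham := lr_d vec_act vec_br.

Lemma de_rham_multilin (E : seq N -> K) : multilin E -> altern E -> multilin (de_rham E).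
Proof.
apply: lr_d_multilin; do ?[exact: vec_actD|exact: vec_actM|exact: vec_act_lin|
 exact: vec_brD|exact: vec_brZ|exact: vec_brC].
Qed.

Definition const_vec (x : N) := forall k, map_mx (d k) x = 0.

Lemma const_vec_vec k : const_vec (vec k).
Proof.
move=> l; apply/rowP => i; rewrite !mxE.
by case: (_ && _); rewrite ?(d1 dM) ?(d0 dD).
Qed.

Lemma vec_act0 X : vec_act X 0 = 0.
Proof. by rewrite /vec_act big1 // => k _; rewrite (d0 dD) mulr0. Qed.

Lemma const_vecP (x : N) k l : const_vec x -> d k (x 0 l) = 0.
Proof. by move=> /(_ k) /rowP/(_ l); rewrite !mxE. Qed.

Lemma vec_br_const x y : const_vec x -> const_vec y -> vec_br x y = 0.
Proof.
move=> cx cy; apply/rowP => l; rewrite !mxE /vec_act !big1 ?subrr // => k _;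
 by rewrite const_vecP // mulr0.
Qed.

Lemma de_rham_const (T : seq N -> K) s : multilin T ->
  (forall x, x \in s -> const_vec x) -> de_rham T s = altsum (fun x l => vec_act x (T l)) s.
Proof.
move=> mT cs; rewrite /de_rham /lr_d (@eq_altsum2_in _ _ _ (fun _ _ _ => 0)).
  by rewrite altsum2_0 subr0.
by move=> x y l xs ys _; rewrite vec_br_const ?(multilin0 [::]) //; apply: cs.
Qed.

(** The form i(T) nu for nu = rho dx^1 ^ ... ^ dx^n, which sees only the top component of the
    product of T with the arguments. *)
Definition vol (rho : K) T s : K := rho * rwedge T (wdet kpair s) (std cov).

Lemma vol_multilin rho T : multilin (vol rho T).
Proof.
move=> s1 s2 k u v; rewrite /vol.
rewrite (@eq_rwedge _ _ T T _ (fun l => k * wdet kpair (s1 ++ u :: s2) l + wdet kpair (s1 ++ v :: s2) l)) //.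
  by rewrite rwedgeDr rwedgeZr; ring.
by move=> l; apply: (wdet_multilinr (@kpair_linr K n) l).
Qed.

Lemma vol_altern rho T : altern (vol rho T).
Proof.
move=> s1 u s2; rewrite /vol (@eq_rwedge _ _ T T _ (fun=> 0)) ?rwedge0r ?mulr0 // => l.
exact: wdet_alternr.
Qed.

(** The divergence as it comes out of d i(T) nu: [T] stands in front of the arguments there, and
    [interior_contract] contracts its last slot. *)
Definition div_right (lam : M) T l : K :=
  \sum_k nabla d k T (rcons l (cov k)) + T (rcons l lam).

Lemma multilin_rcons T x : multilin T -> multilin (fun l => T (rcons l x)).
Proof. by move=> mT s1 s2 k u v; rewrite !rcons_cat mT. Qed.

Lemma altern_rcons T x : altern T -> altern (fun l => T (rcons l x)).
Proof. by move=> aT s1 u s2; rewrite rcons_cat aT. Qed.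

Lemma div_right_multilin lam T : multilin T -> multilin (div_right lam T).
Proof.
move=> mT s1 s2 k u v; rewrite /div_right.
rewrite (eq_bigr (fun i => k * nabla d i T (rcons (s1 ++ u :: s2) (cov i))
    + nabla d i T (rcons (s1 ++ v :: s2) (cov i)))); last first.
  by move=> i _; rewrite (multilin_rcons _ (nabla_multilin dD dM i mT)).
by rewrite (multilin_rcons _ mT) big_split -mulr_sumr /=; ring.
Qed.

Lemma div_right_altern lam T : multilin T -> altern T -> altern (div_right lam T).
Proof.
move=> mT aT s1 u s2; rewrite /div_right (altern_rcons _ aT) addr0 big1 // => k _.
by rewrite (altern_rcons _ (nabla_altern dD k mT aT)).
Qed.

Lemma nabla_degree a k T : degree a T -> degree a (nabla d k T).
Proof.
move=> dT s sz; rewrite /nabla /lie dT // (d0 dD) dsumE big1 ?subr0 // => i _.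
by apply: dT; rewrite size_set_nth (maxn_idPr (ltn_ord i)).
Qed.

Lemma div_right_degree a lam T : degree a.+1 T -> degree a (div_right lam T).
Proof.
move=> dT s sz; rewrite /div_right dT ?size_rcons // addr0 big1 // => k _.
by rewrite (nabla_degree _ dT) // size_rcons.
Qed.

Lemma div_right_degree0 lam T (s : seq M) : degree 0 T -> div_right lam T s = 0.
Proof.
move=> dT; rewrite /div_right dT ?size_rcons // addr0 big1 // => k _.
by rewrite (nabla_degree _ dT) // size_rcons.
Qed.

Lemma div_right_left lam T (s : seq M) : multilin T -> altern T ->
  div_right lam T s = (-1) ^+ size s * div_left d lam T s.
Proof.
move=> mT aT; rewrite /div_right /div_left mulrDr mulr_sumr; congr (_ + _).
  apply: eq_bigr => k _; apply: skew_move_rcons.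
  by apply: multilin_skew; [exact: nabla_multilin|exact: nabla_altern].
exact/skew_move_rcons/multilin_skew.
Qed.

Lemma d_wdet_const k (X : seq N) (l : seq M) :
  (forall x, x \in X -> const_vec x) -> (forall x, x \in l -> const_cov d x) ->
  d k (wdet kpair X l) = 0.
Proof.
elim: l X => [|xi l IH] X cX cl /=.
  by case: eqP => _; rewrite ?(d1 dM) ?(d0 dD).
rewrite raddf_altsum; last exact: dD.
rewrite (@eq_altsum_in _ _ _ (fun _ _ => 0)) ?altsum0 // => x X' xX sX'.
rewrite dM IH; first last.
- by move=> y yl; apply: cl; rewrite inE yl orbT.
- by move=> y /sX'; apply: cX.
rewrite mulr0 addr0 kpairE (d_sum dD) big1 ?mul0r // => i _.
have /(_ k)/colP/(_ i) := cl xi (mem_head _ _); rewrite !mxE => e.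
by rewrite dM e (const_vecP _ _ (cX _ xX)) mulr0 mul0r addr0.
Qed.

Lemma const_std x : x \in std (@cov K n) -> const_cov d x.
Proof. by move=> /mapP[i _ ->]; apply: const_cov_cov. Qed.

Lemma const_vec_map I x : x \in map (@vec K n) I -> const_vec x.
Proof. by move=> /mapP[i _ ->]; apply: const_vec_vec. Qed.

(** By [interior_contract] the contractions by [cov k] in the divergence pass to the arguments,
    where they extract the coefficients of the directional derivatives that make up d. *)
Lemma de_rham_vol rho (lam : M) T s : multilin T -> altern T ->
  (forall k, d k rho = rho * lam k 0) ->
  de_rham (vol rho T) s = vol rho (div_right lam T) s.
Proof.
move=> mT aT drho.
(* By multilinearity constant coordinate vectors suffice, and their brackets vanish. *)
apply: (@multilin_std_ext K n N vec (fun i x => x 0 i) row_vecE).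
- by apply: de_rham_multilin; [exact: vol_multilin|exact: vol_altern].
- exact: vol_multilin.
move=> I; set s' := map _ I.
rewrite de_rham_const; [|exact: vol_multilin|exact: const_vec_map].
rewrite /vol rwedgeDl rwedge_suml.
have ic := interior_contract (@col_covE K n) (@kpair_linl K n).
rewrite (eq_bigr _ (fun k _ => ic _ (cov k) s' (nabla_multilin dD dM k mT) (nabla_altern dD k mT aT))).
rewrite ic // -altsum_sum -altsumD -altsumZ.
apply: eq_altsum_in => x l xs sl.
have cl y : y \in l -> const_vec y by move=> /sl; apply: const_vec_map.
rewrite kpairE mulr_suml -big_split mulr_sumr; apply: eq_bigr => k _.
rewrite kpair_cov dM drho (@derivation_rwedge _ _ (d k)) //.
have -> : rwedge T (d k \o wdet kpair l) (std cov) = 0.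
  rewrite -[RHS](rwedge0r T (std cov)); apply: eq_rwedge_in => // l' sl'.
  by apply: d_wdet_const => // y /sl'; apply: const_std.
have -> : rwedge (d k \o T) (wdet kpair l) (std cov) = rwedge (nabla d k T) (wdet kpair l) (std cov).
  apply: eq_rwedge_in => // l' sl' /=; rewrite nabla_const // => y /sl'; exact: const_std.
by rewrite /=; ring.
Qed.

End VectorFields.

(** * The Liouville volume *)

Section AWedge.
Context {V : Type} {K : comPzRingType}.
Implicit Types (S T X : seq V -> K) (s : seq V) (al : V -> K).

(** The exterior product of a 1-form with [X], the shape in which contractions of powers of a 2-form
    appear. *)
Definition awedge al X s := altsum (fun x l => al x * X l) s.

Lemma awedge_cons al X x s : awedge al X (x :: s) = al x * X s - awedge al (fun l => X (x :: l)) s.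
Proof. by []. Qed.

Lemma awedgeD al X X' s : awedge al (fun l => X l + X' l) s = awedge al X s + awedge al X' s.
Proof. by rewrite -altsumD; apply: eq_altsum => x l _; rewrite mulrDr. Qed.

Lemma awedge_rwedge al S T s :
  awedge al (rwedge S T) s = rwedge (sgn_size S) (awedge al T) s.
Proof.
elim: s S T => [|x s IH] S T.
  by rewrite /awedge /= mulr0.
rewrite awedge_cons /= awedgeD !IH.
rewrite (@eq_rwedge _ _ (fun l => sgn_size S (x :: l)) (fun l => -1 * sgn_size (fun l => S (x :: l)) l)
  (awedge al T) (awedge al T)) //; last by move=> l; rewrite /sgn_size /= exprS mulrA.
rewrite (@eq_rwedge _ _ (sgn_size (sgn_size S)) (sgn_size (sgn_size S)) (fun l => awedge al T (x :: l)) (fun l => al x * T l + -1 * awedge al (fun l => T (x :: l)) l)) //;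
  last by move=> l; rewrite awedge_cons mulN1r.
rewrite (@rwedgeDr _ _ _ (fun l => al x * T l)) rwedgeZl !rwedgeZr.
have EE X : rwedge (sgn_size (sgn_size S)) X s = rwedge S X s.
  apply: eq_rwedge => // l.
  by rewrite /sgn_size mulrA -exprMn mulrNN mulr1 expr1n mul1r.
by rewrite !EE; ring.
Qed.

End AWedge.

Lemma skew_quadratic (K : comPzRingType) n (half : K) (W : 'M[K]_n) : half + half = 1 ->
  (forall i j, W i j = - W j i) -> forall x : 'rV[K]_n, x *m W *m x^T = 0.
Proof.
move=> halfE WC x.
have trW : W^T = - W by apply/matrixP => i j; rewrite mxE WC !mxE.
apply/matrixP => i j; rewrite !ord1 [RHS]mxE.
suff E : (x *m W *m x^T) 0 0 = - (x *m W *m x^T) 0 0.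
  by rewrite -[LHS]mul1r -halfE mulrDl {2}E mulrN subrr.
have {1}-> : x *m W *m x^T = (x *m W *m x^T)^T.
  by apply/matrixP => a b; rewrite !ord1 [RHS]mxE.
by rewrite !trmx_mul trmxK trW mulmxA mulmxN mulNmx mxE.
Qed.

Section TwoForm.
Context {K : comPzRingType} {n : nat} (W : 'M[K]_n).
Notation N := 'rV[K]_n.
Implicit Types (T : seq N -> K) (s : seq N).
Hypothesis WC : forall x : N, (x *m W *m x^T) = 0.

Definition two_form s : K := if s is [:: x; y] then (x *m W *m y^T) 0 0 else 0.

Lemma two_form_degree : degree 2 two_form.
Proof. by case=> [|x[|y[|z s]]]. Qed.

Lemma two_form_multilin : multilin two_form.
Proof.
move=> [|x [|y [|z s1]]] s2 k u v /=; rewrite ?mulr0 ?addr0 //.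
- case: s2 => [|y [|z s2]] /=; rewrite ?mulr0 ?addr0 //.
  by rewrite !mulmxDl -!scalemxAl !mxE.
- case: s2 => [|y s2] /=; rewrite ?mulr0 ?addr0 //.
  by rewrite linearD linearZ /= mulmxDr -!scalemxAr !mxE.
Qed.

Lemma two_form_altern : altern two_form.
Proof.
move=> [|x [|y s1]] u s2 //=; last by case: s1.
by case: s2 => //; rewrite WC mxE.
Qed.

Definition form1_unit s : K := (size s == 0%N)%:R.

Definition form_pow k := iter k (rwedge two_form) form1_unit.

Lemma form1_unit_degree : degree 0 form1_unit.
Proof. by move=> s; rewrite /form1_unit => /negPf->. Qed.

Lemma form_pow_multilin k : multilin (form_pow k).
Proof.
elim: k => [|k IH].
  by move=> s1 s2 a u v; rewrite /form_pow /= /form1_unit !size_cat !addnS /= mulr0 addr0.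
exact: rwedge_multilin two_form_multilin IH.
Qed.

Lemma form_pow_altern k : altern (form_pow k).
Proof.
elim: k => [|k IH]; last exact: rwedge_altern two_form_altern IH.
by move=> s1 u s2; rewrite /form_pow /= /form1_unit !size_cat !addnS.
Qed.

Lemma form_pow_degree k : degree (k + k)%N (form_pow k).
Proof.
elim: k => [|k IH]; first exact: form1_unit_degree.
by rewrite addSn addnS; exact: rwedge_degree two_form_degree IH.
Qed.

(** The contraction by [v] is a derivation, and the factor i_v omega can be brought to the front of
    each of the k + 1 terms without a sign. *)
Lemma form_pow_cons k v s :
  form_pow k.+1 (v :: s) = k.+1%:R * awedge (fun x => two_form [:: v; x]) (form_pow k) s.
Proof.
set al := fun x => _.
have E1 X l : rwedge (fun l => two_form (v :: l)) X l = awedge al X l.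
  rewrite rwedge_degree1l // => l' sl; exact: two_form_degree.
(* A 2-form has even degree, so jumping over it costs no sign. *)
have Es l : sgn_size two_form l = two_form l.
  have [e|ne] := eqVneq (size l) 2%N; last by rewrite /sgn_size two_form_degree ?mulr0.
  by rewrite /sgn_size e sqrrN expr1n mul1r.
elim: k v s @al E1 => [|k IH] v s al E1.
  rewrite /form_pow /= E1 (@eq_rwedge _ _ _ (sgn_size two_form) _ (fun=> 0)) //.
  by rewrite rwedge0r addr0 mul1r.
rewrite -[form_pow k.+2 _]/(rwedge _ _ _ + rwedge _ _ _) E1.
rewrite (@eq_rwedge _ _ _ (sgn_size two_form) _ (fun l => k.+1%:R * awedge al (form_pow k) l)) //; last first.
  by move=> l; apply: IH.
rewrite rwedgeZr -awedge_rwedge -[k.+2%:R]/(k.+1.+1%:R) -[k.+2]add1n natrD mulrDl mul1r.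
by [].
Qed.

End TwoForm.

Section Nondegenerate.
Context {F : numFieldType} {n : nat} (W : 'M[F]_n).
Hypothesis WC : forall x : 'rV[F]_n, (x *m W *m x^T) = 0.
Hypothesis Wu : W \in unitmx.

(** Given 2k indices [I], some [i] is not among them. The vector [vec i *m invmx W] contracts omega
    to dx^i, so contracting omega^(k+1) gives dx^i ^ omega^k = 0, whose value at [vec i] and [I] is
    that of omega^k at [I]. *)
Lemma form_pow_eq0 k : (k + k < n)%N -> (forall s, form_pow W k.+1 s = 0) ->
  forall s, form_pow W k s = 0.
Proof.
move=> kn H s; have mk := form_pow_multilin W k.
apply: (@multilin_std_ext _ _ _ vec (fun i x => x 0 i) row_vecE _ (fun=> 0)) => //.
  by move=> *; rewrite mulr0 addr0.
move=> I; have [sI|] := eqVneq (size I) (k + k)%N; last first.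
  by move=> ne; apply: form_pow_degree; rewrite size_map.
have /existsP[i iI] : [exists i : 'I_n, i \notin I].
  apply: contraT => /existsPn IH; move: kn; rewrite ltnNge -sI -{1}(size_enum_ord n).
  by rewrite uniq_leq_size ?enum_uniq // => i _; have := IH i; rewrite negbK.
pose al x := two_form W [:: vec i *m invmx W; x].
have E (x : 'rV[F]_n) : al x = x 0 i by rewrite /al /= mulmxKV // /vec -rowE !mxE.
have /eqP := H (vec i *m invmx W :: vec i :: map vec I).
rewrite form_pow_cons // -/al mulf_eq0 pnatr_eq0 orFb awedge_cons E [X in _ - X]altsum_eq0_mem; last first.
  move=> x l /mapP[j jI ->]; rewrite E mxE eqxx /=.
  by rewrite (negPf (memPnC iI j jI)) mul0r.
by rewrite subr0 mxE !eqxx mul1r => /eqP.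
Qed.

(** Otherwise [form_pow_eq0], applied from the top power downwards, would make the power 0, which is
    1, vanish. *)
Lemma form_pow_std_neq0 m : (m + m = n)%N -> form_pow W m (std vec) != 0.
Proof.
move=> mn; apply/eqP => z.
have H k s : (k <= m)%N -> form_pow W (m - k) s = 0.
  elim: k s => [|k IH] s km.
    rewrite subn0 (@top_form _ _ _ vec (fun i x => x 0 i) row_vecE _ (fun y x => kpair x y) cov).
    - by rewrite z mul0r.
    - by move=> k xi eta x; apply: kpair_linr.
    - by move=> i j; rewrite kpair_dual eq_sym.
    - exact: form_pow_multilin.
    - exact: form_pow_altern.
    - by move=> t sz; apply: form_pow_degree; rewrite mn.
  apply: form_pow_eq0; last by move=> s'; rewrite -subSn // subSS; apply: IH; apply: ltnW.
  by rewrite -mn; apply: (@leq_ltn_trans (m - k.+1 + m)%N); rewrite ?leq_add2l ?ltn_add2r ?leq_subr // ltn_subrL (leq_ltn_trans _ km).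
by have /eqP := H m [::] (leqnn m); rewrite subnn /form_pow /= /form1_unit oner_eq0.
Qed.

End Nondegenerate.

Lemma dsum_degree (K : comPzRingType) (N : lmodType K) g a (T : seq N -> K) :
  degree a T -> degree a (dsum g T).
Proof.
move=> dT s sz; rewrite dsumE big1 // => i _.
by apply: dT; rewrite size_set_nth (maxn_idPr (ltn_ord i)).
Qed.

Section SymplecticAlgebra.
Context {K : comPzRingType} {n : nat} (d : 'I_n -> K -> K) (half : K) (W G : 'M[K]_n).
Notation M := 'cV[K]_n.
Notation N := 'rV[K]_n.
Hypothesis dD : forall k a b, d k (a + b) = d k a + d k b.
Hypothesis dM : forall k a b, d k (a * b) = d k a * b + a * d k b.
Hypothesis dC : forall k l a, d k (d l a) = d l (d k a).
Hypothesis halfE : half + half = 1.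
Hypothesis WC : forall i j, W i j = - W j i.
Hypothesis GC : forall i j, G i j = - G j i.
Hypothesis WG : W *m G = 1%:M.
Hypothesis GW : G *m W = 1%:M.
Hypothesis W_closed : forall i j k, d i (W j k) + d j (W k i) + d k (W i j) = 0.

Definition dW k : 'M[K]_n := map_mx (d k) W.
(** The gradient of log Pf W: the Liouville density is the Pfaffian of [W], and d_k log Pf W = (1/2)
    tr (d_k W W^-1). *)
Definition liouville_covec : M := \col_k (half * \tr (dW k *m G)).

Lemma dWC k i j : dW k i j = - dW k j i.
Proof. by rewrite !mxE WC (dN dD). Qed.

Lemma d_mulmx k p q r (A : 'M[K]_(p, q)) (B : 'M[K]_(q, r)) :
  map_mx (d k) (A *m B) = map_mx (d k) A *m B + A *m map_mx (d k) B.
Proof.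
apply/matrixP => i j; rewrite !mxE (d_sum dD) -big_split; apply: eq_bigr => l _ /=.
by rewrite dM !mxE.
Qed.

Lemma dG k : map_mx (d k) G = - (G *m dW k *m G).
Proof.
have E : dW k *m G + W *m map_mx (d k) G = 0.
  rewrite -d_mulmx WG; apply/matrixP => i j; rewrite !mxE.
  by case: (_ == _); rewrite ?(d1 dM) ?(d0 dD).
have := congr1 (mulmx G) E; rewrite mulmxDr !mulmxA GW mul1mx mulmx0 => /eqP.
by rewrite addrC addr_eq0 => /eqP.
Qed.

Lemma dbl_inj (a b : K) : a + a = b + b -> a = b.
Proof. by move=> E; rewrite -[a]mul1r -[b]mul1r -halfE !mulrDl -!mulrDr E. Qed.

Lemma modular_covec_cov P (lam x : M) :
  modular_covec d P lam x = \sum_j x j 0 * modular_covec d P lam (cov j).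
Proof.
rewrite /modular_covec bil_covr.
rewrite (eq_bigr (fun k => \sum_j x j 0 * bil (dbiv d P k) (cov k) (cov j))); last first.
  by move=> k _; rewrite bil_covr.
rewrite exchange_big -big_split; apply: eq_bigr => j _ /=.
by rewrite -mulr_sumr -mulrDr.
Qed.

Lemma bil_cov (Q : 'M[K]_n) a b : bil Q (cov a) (cov b) = Q a b.
Proof.
rewrite /bil (bigD1 a) //= (bigD1 b) //= !mxE !eqxx !mulr1 !big1 ?addr0 // => i ia.
  by rewrite big1 // => l _; rewrite !mxE (negPf ia) mul0r mulr0.
by rewrite !mxE (negPf ia) !mulr0.
Qed.

Lemma bil_covl (Q : 'M[K]_n) x b : bil Q x (cov b) = \sum_a x a 0 * Q a b.
Proof.
rewrite /bil; apply: eq_bigr => a _; rewrite (bigD1 b) //= !mxE !eqxx big1 => [|i ib].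
  by rewrite addr0 mulr1 mulrC.
by rewrite !mxE (negPf ib) !mulr0.
Qed.

(** Differentiating the inverse [G] gives -G (d_k W) G, so the divergence of [G] contains the sums
    [Z a]; closedness identifies these with the half traces of [liouville_covec]. *)
Lemma liouville_unimodular x : modular_covec d G^T liouville_covec x = 0.
Proof.
rewrite modular_covec_cov big1 // => j _.
suff -> : modular_covec d G^T liouville_covec (cov j) = 0 by rewrite mulr0.
pose Z a := \sum_k (dW k *m G) a k.
(* In 2 Z the two copies, with summation indices exchanged, carry d_k W_ab and d_b W_ka, whose sum
   is d_a W_kb by closedness. *)
have ZE a : Z a = half * \tr (dW a *m G).
  apply: dbl_inj; rewrite -mulrDl halfE mul1r.
  have -> : \tr (dW a *m G) = \sum_k \sum_b dW a k b * G b k.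
    by rewrite /mxtrace; apply: eq_bigr => k _; rewrite mxE.
  have E1 : Z a = \sum_k \sum_b dW k a b * G b k.
    by rewrite /Z; apply: eq_bigr => k _; rewrite mxE.
  rewrite {1}E1 E1 [X in X + _]exchange_big /= -big_split; apply: eq_bigr => k _ /=.
  rewrite -big_split; apply: eq_bigr => b _ /=.
  have := W_closed a b k; rewrite !mxE (GC k b) => cl.
  have -> : d a (W k b) = d k (W a b) + d b (W k a) - (d a (W b k) + d b (W k a) + d k (W a b)) .
    by rewrite (WC k b) (dN dD); ring.
  by rewrite cl (WC k a) (dN dD); ring.
rewrite /modular_covec bil_covl.
rewrite (eq_bigr (fun k => - \sum_a G j a * (dW k *m G) a k)); last first.
  move=> k _; rewrite bil_cov.
  have -> : dbiv d G^T k k j = map_mx (d k) G j k by rewrite !mxE.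
  by rewrite dG -mulmxA !mxE.
rewrite sumrN exchange_big /= addrC; apply/eqP; rewrite subr_eq0; apply/eqP.
apply: eq_bigr => a _; rewrite -mulr_sumr -/(Z a) ZE !mxE mulrC; congr (_ * _).
Qed.

(* The form of a connection for which [W] is parallel. *)
Definition gam k (x : N) : N := half *: (x *m dW k *m G).

(** Since [G *m W] is the identity, each of the two slots contributes half of x (d_k W) y^T, whence
    the factor in [gam]. *)
Lemma d_two_form k (s : seq N) : (forall x, x \in s -> const_vec d x) ->
  d k (two_form W s) = dsum (gam k) (two_form W) s.
Proof.
move=> cs; have [|ne] := eqVneq (size s) 2%N; last first.
  by rewrite two_form_degree // (d0 dD) (dsum_degree (gam k) (@two_form_degree _ _ W)).
case: s cs => [|x [|y []]] //= cs _.
have cx : map_mx (d k) x = 0 by apply: cs; rewrite inE eqxx.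
have cy : map_mx (d k) y = 0 by apply: cs; rewrite !inE eqxx orbT.
have -> : d k ((x *m W *m y^T) 0 0) = (map_mx (d k) (x *m W *m y^T)) 0 0 by rewrite [RHS]mxE.
rewrite !d_mulmx cx mul0mx add0r -map_trmx cy trmx0 mulmx0 addr0 -/(dW k) addr0.
have trW : (dW k)^T = - dW k by apply/matrixP => i j; rewrite mxE dWC !mxE.
have trG : G^T = - G by apply/matrixP => i j; rewrite mxE GC !mxE.
rewrite /gam linearZ /= -!scalemxAl -scalemxAr !trmx_mul trW trG -!mulmxA (mulmxA G W) GW mul1mx.
rewrite mulNmx !mulmxN (mulmxA W G) mulNmx !mulmxN opprK !mulmxA.
rewrite -[x *m W *m G]mulmxA WG mulmx1.
have hE (B : 'M[K]_1) : (half *: B) 0 0 = half * B 0 0 by rewrite mxE.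
by rewrite !hE -mulrDl halfE mul1r.
Qed.

Lemma d_form_pow k m (s : seq N) : (forall x, x \in s -> const_vec d x) ->
  d k (form_pow W m s) = dsum (gam k) (form_pow W m) s.
Proof.
elim: m s => [|m IH] s cs.
  rewrite /form_pow /= /form1_unit.
  have [->|ne] := eqVneq s [::]; first by rewrite /= (d1 dM).
  rewrite (dsum_degree (gam k) (@form1_unit_degree K n)) ?size_eq0 //.
  by rewrite (negPf ne) (d0 dD).
rewrite /form_pow /= (@derivation_rwedge _ _ (d k)) // dsum_rwedge; congr (_ + _).
  by apply: eq_rwedge_in => // l sl /=; rewrite d_two_form // => x /sl/cs.
by apply: eq_rwedge_in => // l sl /=; rewrite IH // => x /sl/cs.
Qed.

(** [gam k] acts as a derivation on all powers of the 2-form, and on a form of top degree a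
    derivation is its trace. *)
Lemma d_liouville k m :
  d k (form_pow W m (std vec)) = form_pow W m (std vec) * liouville_covec k 0.
Proof.
rewrite d_form_pow; last by move=> x /mapP[i _ ->]; apply: const_vec_vec.
rewrite (@dsum_std _ _ _ vec (fun i x => x 0 i) row_vecE).
- rewrite mulrC mxE; congr (_ * _); rewrite mulr_sumr; apply: eq_bigr => i _.
  by rewrite /gam mxE -mulmxA /vec -rowE mxE.
- exact: form_pow_multilin.
- exact: (form_pow_altern (skew_quadratic halfE WC)).
Qed.

End SymplecticAlgebra.

(** * The commutator of the divergence with the Poisson differential *)

Section ModularOperator.
Context {K : comPzRingType} {n : nat} (d : 'I_n -> K -> K) (P : 'M[K]_n) (half : K).
Notation M := 'cV[K]_n.
Hypothesis dD : forall k a b, d k (a + b) = d k a + d k b.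
Hypothesis dM : forall k a b, d k (a * b) = d k a * b + a * d k b.
Hypothesis dC : forall k l a, d k (d l a) = d l (d k a).
Hypothesis PC : forall i j, P i j = - P j i.
Hypothesis halfE : half + half = 1.

Lemma div_left_degree a lam T : degree a.+1 T -> degree a (div_left d lam T).
Proof.
move=> dT s sz; rewrite /div_left dT // addr0 big1 // => k _.
by rewrite (nabla_degree dD _ dT).
Qed.

Lemma poisson_diffZ (c : K) T s : (forall k, d k c = 0) ->
  poisson_diff d P (fun l => c * T l) s = c * poisson_diff d P T s.
Proof.
move=> dc.
rewrite /poisson_diff lr_dZ.
- rewrite (@eq_altsum _ _ _ (fun _ _ => 0)) ?altsum0 ?addr0 // => x l _.
  by rewrite /biv_act (_ : grad d _ = 0) ?bil0r ?mul0r //; apply/colP => k; rewrite !mxE.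
- exact: biv_actM.
Qed.

(** [div_right_left] gives (-1)^a on [poisson_diff A] and (-1)^(a-1) on [A], which turns the
    difference into the sum of [div_poisson_diff]. *)
Lemma modular_commutator a (lam mu : M) A s : multilin A -> altern A -> degree a A ->
  (forall k l, d k (lam l 0) = d l (lam k 0)) ->
  (forall x, modular_covec d P lam x = bil P mu x) ->
  (forall x, x \in s -> const_cov d x) -> size s = a ->
  div_right d lam (poisson_diff d P A) s - poisson_diff d P (div_right d lam A) s =
  (-1) ^+ a * (bil P mu (grad d (A s)) - dsum (fun x => grad d (bil P mu x)) A s).
Proof.
move=> mA aA dA clam Hmu cs sa.
have := div_poisson_diff dD dM dC PC halfE mA aA clam cs.
rewrite Hmu (@eq_dsumg _ _ (fun x => grad d (modular_covec d P lam x)) (fun x => grad d (bil P mu x))) => [<-|x _]; last by rewrite Hmu.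
have mQ : multilin (poisson_diff d P A).
  by apply: (poisson_diff_multilin dD dM PC).
have aQ : altern (poisson_diff d P A).
  by apply: (poisson_diff_altern dD PC halfE).
rewrite div_right_left // sa [RHS]mulrDr; congr (_ + _).
(* In degree 0 the list is empty and both Poisson differentials vanish there, so that the exponent a
   - 1 is only met for positive a. *)
case: a dA sa => [|a] dA sa.
  by rewrite (size0nil sa) /poisson_diff /lr_d /= !subrr oppr0 mulr0.
rewrite /poisson_diff (@eq_lr_d _ _ _ _ _ (fun l => (-1) ^+ a * div_left d lam A l)).
  rewrite -/(poisson_diff _ _ _ _) poisson_diffZ ?exprS.
    by rewrite -/(poisson_diff _ _ _ _) mulN1r mulNr.
  by move=> k; apply: (@derivation_sign _ (d k)).
move=> l; rewrite div_right_left //.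
have [-> //|ne] := eqVneq (size l) a.
by rewrite (div_left_degree _ dA) ?mulr0.
Qed.

End ModularOperator.

(** * Shuffles and interior products *)

Section Shuffles.

(** The permutations with a prescribed value at one index are the lifts of those of a smaller set.
    This is what makes induction over shuffles possible. *)
Lemma sum_lift_perm (V : nmodType) n (i0 j0 : 'I_n.+1) (Q : pred 'S_n.+1) (F : 'S_n.+1 -> V) :
  \sum_(sg | Q sg && (sg i0 == j0)) F sg =
  \sum_(tau | Q (lift_perm i0 j0 tau)) F (lift_perm i0 j0 tau).
Proof.
have inj : injective (lift_perm i0 j0).
  move=> t1 t2 E; apply/permP => k; apply: (@lift_inj _ j0).
  by rewrite -!(lift_perm_lift i0) E.
have surj (sg : 'S_n.+1) : sg i0 = j0 -> exists tau, sg = lift_perm i0 j0 tau.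
  move=> s0; have H k : exists k', sg (lift i0 k) = lift j0 k'.
    case: (unliftP j0 (sg (lift i0 k))) => [k' E|]; first by exists k'.
    move=> E; have := perm_inj (etrans E (esym s0)) => /eqP.
    by rewrite eq_sym (negPf (neq_lift _ _)).
  have [g gE] := choice H.
  have gi : injective g.
    by move=> a b E; apply: (@lift_inj _ i0); apply: (@perm_inj _ sg); rewrite !gE E.
  exists (perm gi); apply/permP => k; case: (unliftP i0 k) => [k'|] ->.
    by rewrite lift_perm_lift permE gE.
  by rewrite lift_perm_id.
rewrite (reindex_omap (lift_perm i0 j0) (fun sg => [pick tau | sg == lift_perm i0 j0 tau])) /=.
  apply: eq_bigl => tau; rewrite lift_perm_id eqxx andbT -[RHS]andbT; congr (_ && _).
  case: pickP => [t /eqP/inj->|/(_ tau)]; rewrite ?eqxx //.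
move=> sg /andP[_ /eqP/surj[tau E]].
case: pickP => [t /eqP Et|/(_ tau)]; first by rewrite /= -Et.
by rewrite E eqxx.
Qed.

Lemma shuffle_lift0 n k (tau : 'S_n) :
  shuffle k.+1 (lift_perm ord0 ord0 tau) = shuffle k tau.
Proof.
apply/forallP/forallP => H i; apply/forallP => j.
  have /forallP/(_ (lift ord0 j)) := H (lift ord0 i).
  by rewrite !lift_perm_lift /= /bump !leq0n !add1n !ltnS.
case: (unliftP ord0 i) => [i'|] ->; case: (unliftP ord0 j) => [j'|] ->;
  rewrite ?lift_perm_lift ?lift_perm_id /= /bump ?leq0n ?add1n ?ltnS ?ltn0 //.
- by have /forallP := H i'; apply.
- by rewrite implybT.
Qed.

Lemma shuffle_liftk n (k : 'I_n.+1) (tau : 'S_n) :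
  shuffle k (lift_perm k ord0 tau) = shuffle k tau.
Proof.
have bE (i j : nat) : (bump k i < bump k j)%N = (i < j)%N by rewrite /bump; lia.
have b1 (i : nat) : (bump k i < k)%N = (i < k)%N by rewrite /bump; lia.
have b2 (i : nat) : (k <= bump k i)%N = (k <= i)%N by rewrite /bump; lia.
apply/forallP/forallP => H i; apply/forallP => j.
  have /forallP/(_ (lift k j)) := H (lift k i).
  by rewrite !lift_perm_lift /= bE b1 b2 /bump !leq0n !add1n !ltnS.
case: (unliftP k i) => [i'|] ->; case: (unliftP k j) => [j'|] ->;
  rewrite ?lift_perm_lift ?lift_perm_id.
- rewrite /= bE b1 b2 /bump !leq0n !add1n !ltnS; have /forallP := H i'; apply.
- by rewrite ltnn /= b2; apply/implyP => /andP[]; rewrite /bump; lia.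
- by rewrite /= /bump leq0n implybT.
- by rewrite ltnn.
Qed.

(** Elsewhere the index before [j] lies in the same block and would have a value below 0. *)
Lemma shuffle_pos0 n k (sg : 'S_n.+1) (j : 'I_n.+1) :
  shuffle k sg -> sg j = ord0 -> (j = ord0) \/ (j = k :> nat).
Proof.
move=> /forallP H s0; have [|j0] := eqVneq j ord0; [by left | right].
have jpos : (0 < j)%N by rewrite lt0n.
have lt : (j.-1 < n.+1)%N by have := ltn_ord j; lia.
have /forallP/(_ j) := H (Ordinal lt); rewrite s0 ltn0 implybF /= negb_and.
move=> /orP[|]; lia.
Qed.

Lemma size_permute (T : Type) (s : seq T) sg : size (permute s sg) = size s.
Proof. by rewrite size_map size_enum_ord. Qed.

Lemma nth_permute (T : Type) (x0 : T) (s : seq T) sg (i : 'I_(size s)) :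
  nth x0 (permute s sg) i = nth x0 s (sg i).
Proof.
rewrite (nth_map i) ?size_enum_ord // nth_ord_enum.
by rewrite (tnth_nth x0).
Qed.

Lemma permute_lift (T : Type) (x : T) (s : seq T) (j : 'I_(size s).+1) (tau : 'S_(size s)) :
  @permute T (x :: s) (lift_perm j ord0 tau) =
  take j (permute s tau) ++ x :: drop j (permute s tau).
Proof.
have js : (j <= size s)%N by rewrite -ltnS.
apply: (@eq_from_nth _ x).
  by rewrite size_permute size_cat /= size_take size_drop size_permute; have := js; case: ltngtP; lia.
move=> i; rewrite size_permute => li.
rewrite (@nth_permute _ x (x :: s) _ (Ordinal li)) nth_cat size_take size_permute.
have -> : (if (j < size s)%N then val j else size s) = j by case: ltngtP js.
case: (unliftP j (Ordinal li)) => [i' E|E].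
  have Ei : i = bump j i' by have := congr1 val E.
  rewrite E lift_perm_lift Ei.
  have -> : nth x (x :: s) (lift ord0 (tau i')) = nth x s (tau i') by [].
  have [ji|ji] := leqP j i'.
    have -> : bump j i' = i'.+1 by rewrite /bump ji.
    by rewrite ltnNge leqW //= subSn //= nth_drop subnKC // nth_permute.
  have -> : bump j i' = i' by rewrite /bump leqNgt ji.
  by rewrite ji nth_take // nth_permute.
have ij : i = j by have := congr1 val E.
by rewrite E lift_perm_id ij ltnn subnn.
Qed.

Variables (R : comPzRingType) (T : Type).
Implicit Types (Phi : seq T -> seq T -> R) (s : seq T).

(** The common shape of the exterior product and of both sums of the Schouten bracket. *)
Definition shufsum k Phi s : R :=
  \sum_(sg : 'S_(size s) | shuffle k sg)
    (-1) ^+ sg * Phi (take k (permute s sg)) (drop k (permute s sg)).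

Lemma shufsum_nil k Phi : shufsum k Phi [::] = Phi [::] [::].
Proof.
have s1 (sg : 'S_0) : sg = 1%g by apply/permP => -[].
have e (sg : 'S_0) : permute (Nil T) sg = [::] by apply: size0nil; rewrite size_permute.
rewrite /shufsum (big_pred1 (1%g : 'S_0)) => [|sg].
  by rewrite e odd_perm1 mul1r; case: k.
rewrite [RHS](_ : _ = true); last exact/eqP/s1.
by apply/forallP => -[].
Qed.

Lemma sign_lift_perm n (i : 'I_n.+1) (tau : 'S_n) :
  (-1) ^+ lift_perm i ord0 tau = (-1) ^+ i * (-1) ^+ tau :> R.
Proof. by rewrite odd_lift_perm addbF signr_addb signr_odd. Qed.

Lemma shufsum_liftk k Phi x s : (k <= size s)%N ->
  \sum_(sg : 'S_(size s).+1 | shuffle k sg && (sg (inord k) == ord0))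
    (-1) ^+ sg * Phi (take k (@permute T (x :: s) sg)) (drop k (@permute T (x :: s) sg)) =
  (-1) ^+ k * shufsum k (fun l r => Phi l (x :: r)) s.
Proof.
move=> ks; rewrite sum_lift_perm mulr_sumr.
have kE : k = @inord (size s) k by rewrite inordK.
apply: eq_big => [tau|tau _]; first by rewrite {1}kE shuffle_liftk -kE.
rewrite sign_lift_perm permute_lift -kE.
have st : size (take k (permute s tau)) = k.
  by rewrite size_take size_permute; case: ltngtP ks.
by rewrite take_cat drop_cat st ltnn subnn take0 drop0 cats0 mulrA.
Qed.

Lemma shufsum0_cons Phi x s :
  shufsum 0 Phi (x :: s) = shufsum 0 (fun l r => Phi l (x :: r)) s.
Proof.
rewrite -[RHS]mul1r -[1]/((-1) ^+ 0) -shufsum_liftk //; apply: eq_bigl => sg /=.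
have [sh|//] := boolP (shuffle 0 sg); apply/esym/eqP.
have [j sj] : exists j, sg j = ord0 by exists ((sg^-1)%g ord0); rewrite permKV.
have -> : inord 0 = j :> 'I_(size s).+1; last by [].
by apply: val_inj; rewrite /= inordK //; case: (shuffle_pos0 sh sj) => ->.
Qed.

(** The entry [x] heads the left block or the right one. The second case needs a nonempty right
    block, which begins at position [k.+1]; hence the test and the sign. *)
Lemma shufsumS_cons k Phi x s : (k <= size s)%N ->
  shufsum k.+1 Phi (x :: s) =
  shufsum k (fun l r => Phi (x :: l) r) s +
  (if (k < size s)%N then (-1) ^+ k.+1 * shufsum k.+1 (fun l r => Phi l (x :: r)) s else 0).
Proof.
move=> ks; rewrite /shufsum /= (bigID (fun sg : 'S_(size s).+1 => sg ord0 == ord0)) /=; congr (_ + _).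
  rewrite sum_lift_perm; apply: eq_big => [tau|tau _]; first exact: shuffle_lift0.
  by rewrite sign_lift_perm permute_lift mul1r take0 drop0.
have J (sg : 'S_(size s).+1) : shuffle k.+1 sg -> sg ord0 != ord0 ->
    exists2 j : 'I_(size s).+1, j = k.+1 :> nat & sg j = ord0.
  move=> sh s0; have [j sj] : exists j, sg j = ord0 by exists ((sg^-1)%g ord0); rewrite permKV.
  by exists j => //; case: (shuffle_pos0 sh sj) => // E; move: s0; rewrite -{1}E sj eqxx.
case: ltnP => ks'; last first.
  rewrite big_pred0 // => sg; apply/negbTE/negP => /andP[sh s0].
  by have [j jk _] := J _ sh s0; have := ltn_ord j; rewrite jk ltnS ltnNge ks'.
rewrite -shufsum_liftk //; apply: eq_bigl => sg.
have [sh /=|//] := boolP (shuffle k.+1 sg).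
apply/idP/eqP => [/(J _ sh)[j jk sj]|E].
  by have -> : inord k.+1 = j by apply: val_inj; rewrite /= inordK ?jk.
apply/eqP => s0; have := perm_inj (etrans E (esym s0)) => /(congr1 val).
by rewrite /= inordK.
Qed.

End Shuffles.

(** Summed over all block sizes, the two cases for [x] are the two terms of the recursion of
    [rwedge], the sign (-1)^k being that of [sgn_size]. *)
Lemma wedge_rwedge (R : realType) (V : lmodType R) (S T : seq V -> R) s :
  wedge S T s = rwedge S T s.
Proof.
have E s0 : wedge S T s0 = \sum_(k < (size s0).+1) shufsum k (fun l r => S l * T r) s0.
  by apply: eq_bigr => k _; apply: eq_bigr => sg _; rewrite mulrA.
rewrite {}E; elim: s S T => [|x s IH] S T /=.
  by rewrite big_ord1 shufsum_nil.
rewrite big_ord_recl shufsum0_cons.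
have H (i : 'I_(size s).+1) : (i <= size s)%N by rewrite -ltnS.
rewrite (eq_bigr _ (fun (i : 'I_(size s).+1) _ => shufsumS_cons _ x (H i))).
rewrite big_split /= addrCA -!IH; congr (_ + _).
transitivity (\sum_(k < (size s).+1) (-1) ^+ k * shufsum k (fun l r => S l * T (x :: r)) s).
  rewrite [RHS]big_ord_recl mul1r; congr (_ + _).
  rewrite big_ord_recr /= ltnn addr0; apply: eq_bigr => i _.
  by rewrite /bump /= add1n ltn_ord.
apply: eq_bigr => k _; rewrite mulr_sumr; apply: eq_bigr => sg _.
rewrite /sgn_size size_take size_permute.
have -> : (if (k < size s)%N then val k else size s) = k.
  by case: ifP => //; have := ltn_ord k; lia.
by rewrite mulrCA !mulrA.
Qed.

Lemma nth_del (T : Type) (x0 : T) (s : seq T) i j : (i < size s)%N ->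
  nth x0 (take i s ++ drop i.+1 s) j = nth x0 s (bump i j).
Proof.
move=> li; rewrite nth_cat size_take li; have [ij|ij] := ltnP j i.
  by rewrite nth_take // /bump leqNgt ij.
by rewrite nth_drop /bump ij; congr nth; lia.
Qed.

Lemma det_wdet (K : comPzRingType) (N M : lmodType K) (pr : M -> N -> K) k X l :
  size X = k -> size l = k ->
  \det (\matrix_(i < k, j < k) pr (nth 0 l i) (nth 0 X j)) = wdet pr X l.
Proof.
elim: l k X => [|xi l IH] [|k] X //= sX sl; first by rewrite det_mx00 sX.
rewrite (altsumE 0) sX (expand_det_row _ ord0); apply: eq_bigr => j _.
rewrite mxE /= /cofactor add0n mulrCA; congr (_ * (_ * _)).
rewrite -(IH k); last by case: sl.
  congr (\det _); apply/matrixP => a b; rewrite !mxE /=; congr pr.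
  by rewrite nth_del ?sX.
rewrite size_cat size_take size_drop sX.
by have lj := ltn_ord j; rewrite lj; lia.
Qed.

Section AlternSets.
Context {K : comPzRingType} {n : nat} {M : lmodType K} (e : 'I_n -> M) (co : 'I_n -> M -> K).
Hypothesis coE : forall x, x = \sum_i co i x *: e i.

(** Only vanishing is tracked, so the sign of the exchange need not be computed. *)
Lemma skew_swap_blocks (T : seq M -> K) s1 s2 s3 :
  skew T -> T (s1 ++ s2 ++ s3) = 0 -> T (s2 ++ s1 ++ s3) = 0.
Proof.
elim: s1 T => [|x s1 IH] T sT // H; rewrite /= skew_move //.
by rewrite (IH (fun l => T (x :: l))) ?mulr0 //; apply: skew_cons.
Qed.

(** Reduction to enumerations of sets, over which [ext_pair] sums: a list of indices without
    repetition is a rearrangement of one, reached by exchanges of blocks. *)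
Lemma altern_sets_ext (T : seq M -> K) l : multilin T -> altern T ->
  (forall I : {set 'I_n}, T (map e (enum I)) = 0) -> T l = 0.
Proof.
move=> mT aT H; have sT := multilin_skew mT aT.
apply: (multilin_std_ext coE (T' := fun=> 0)) => //.
  by move=> *; rewrite mulr0 addr0.
move=> I; have [uI|nu] := boolP (uniq I); last first.
  by apply: altern_nonuniq => //; apply: contra nu; apply: map_uniq.
have pI : perm_eq (enum [set i in I]) I.
  by apply: uniq_perm; rewrite ?enum_uniq // => i; rewrite mem_enum inE.
move: pI (H [set i in I]); move: (enum _) => J.
apply: (@catCA_perm_ind _ (fun J => T (map e J) = 0)) => s1 s2 s3.
by rewrite !map_cat; apply: skew_swap_blocks.
Qed.

End AlternSets.

Lemma rwedge_degree1r (V : Type) (K : comPzRingType) (S T : seq V -> K) s :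
  degree 1 T -> rwedge S T s = altsum (fun x l => sgn_size S l * T [:: x]) s.
Proof.
elim: s S T => [|x s IH] S T dT /=; first by rewrite dT ?mulr0.
rewrite IH // rwedge_degree0r; last by move=> l sl; apply: dT.
rewrite addrC; congr (_ + _); rewrite -altsumN; apply: eq_altsum => y l _.
by rewrite /sgn_size /= exprS; ring.
Qed.

Section RealForms.
Context {R : realType} {n : nat}.
Notation M := 'cV[R]_n.
Notation N := 'rV[R]_n.
Implicit Types (A : seq M -> R) (nu : seq N -> R).

Lemma alternating_multilin (V : lmodType R) a (T : seq V -> R) : Defs.alternating a T -> multilin T.
Proof. by case=> _ H _ s1 s2 k u v; exact: H. Qed.

Lemma alternating_altern (V : lmodType R) a (T : seq V -> R) : Defs.alternating a T -> altern T.
Proof.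
case=> _ _ H s1 u s2; apply: H.
by rewrite cat_uniq /= inE eqxx !andbF.
Qed.

Lemma alternating_degree (V : lmodType R) a (T : seq V -> R) : Defs.alternating a T -> degree a T.
Proof. by case. Qed.

Lemma alternatingP (V : lmodType R) a (T : seq V -> R) :
  degree a T -> multilin T -> altern T -> Defs.alternating a T.
Proof.
move=> dT mT aT; split => // s; apply: altern_nonuniq => //; exact: multilin_skew.
Qed.

Lemma wedge_vectorsE (X : seq N) (s : seq M) : wedge_vectors X s = wdet kpair X s.
Proof.
rewrite /wedge_vectors; case: eqVneq => sX; last by rewrite wdet_size.
by rewrite -(@det_wdet _ _ _ kpair (size s)).
Qed.

Lemma wedge_covectorsE (xi : seq M) (s : seq N) : wedge_covectors xi s = wdet kpair s xi.
Proof.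
rewrite /wedge_covectors; case: eqVneq => sX; last by rewrite wdet_size // eq_sym.
by rewrite -(@det_wdet _ _ _ kpair (size s)).
Qed.

Lemma ext_pair_top nu A : degree n nu -> ext_pair nu A = nu (std vec) * A (std cov).
Proof.
move=> dn; rewrite /ext_pair (bigD1 [set: 'I_n]%SET) //= big1 ?addr0; last first.
  move=> I IT; rewrite dn ?mul0r // size_map -cardE.
  apply: contraNneq IT => cI.
  by rewrite eqEcard finset.subsetT finset.cardsT card_ord cI leqnn.
by rewrite finset.enum_setT -enumT.
Qed.

Lemma interior_vecE nu A s : degree n nu ->
  interior_vec A nu s = nu (std vec) * rwedge A (wdet kpair s) (std cov).
Proof.
move=> dn; rewrite /interior_vec ext_pair_top //; congr (_ * _).
by rewrite wedge_rwedge; apply: eq_rwedge => // l; apply: wedge_vectorsE.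
Qed.

Lemma size_std (V : Type) (e : 'I_n -> V) : size (map e (enum 'I_n)) = n.
Proof. by rewrite size_map size_enum_ord. Qed.

Lemma nth_std (V : lmodType R) (e : 'I_n -> V) (i : 'I_n) : nth 0 (std e) i = e i.
Proof. by rewrite (nth_map i) ?size_enum_ord // nth_ord_enum. Qed.

Lemma altern_top_cov (T : seq M -> R) (h : 'M[R]_n) : multilin T -> altern T ->
  T (map (mulmx h) (std cov)) = \det h * T (std cov).
Proof.
(* [top_form] asks for a form of degree exactly n, so [T] is cut off to lists of length n. *)
move=> mT aT; pose T' s : R := (size s == n)%:R * T s.
have s1 : size (std (@cov R n)) == n by rewrite size_map size_enum_ord.
have := @top_form _ _ _ cov (fun i x => x i 0) (@col_covE R n) _ kpair vec
  (@kpair_linl R n) kpair_dual T' (map (mulmx h) (std cov)).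
rewrite /T' size_map s1 !mul1r => -> //.
- rewrite mulrC; congr (_ * _).
  rewrite -(@det_wdet _ _ _ kpair n); do ?[exact: size_std|by rewrite size_map; exact: size_std].
  rewrite -[RHS]det_tr.
  congr (\det _); apply/matrixP => i j; rewrite !mxE.
  rewrite (nth_map 0) ?size_std // -/(std vec) !nth_std.
  by rewrite /kpair /vec -rowE /cov -colE !mxE.
- by move=> l1 l2 k u v; rewrite mT !size_cat /=; ring.
- by move=> l1 u l2; rewrite aT mulr0.
- by move=> l /negPf->; rewrite mul0r.
Qed.

Lemma altern_top_vec (T : seq N -> R) (g : 'M[R]_n) : multilin T -> altern T ->
  T (map (mulmxr g) (std vec)) = \det g * T (std vec).
Proof.
move=> mT aT; pose T' s : R := (size s == n)%:R * T s.
have s1 : size (std (@vec R n)) == n by rewrite size_map size_enum_ord.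
have := @top_form _ _ _ vec (fun i x => x 0 i) (@row_vecE R n) _ (fun y x => kpair x y) cov
  (fun k xi eta x => kpair_linr k x xi eta) (fun i j => etrans (kpair_dual j i) (congr1 _ (congr1 _ (eq_sym j i)))) T' (map (mulmxr g) (std vec)).
rewrite /T' size_map s1 !mul1r => -> //.
- rewrite mulrC; congr (_ * _).
  rewrite -(@det_wdet _ _ _ (fun y x => kpair x y) n); do ?[exact: size_std|by rewrite size_map; exact: size_std].
  congr (\det _); apply/matrixP => i j; rewrite !mxE.
  rewrite (nth_map 0) ?size_std // -/(std cov) !nth_std.
  by rewrite /kpair /= /vec -rowE /cov -colE !mxE.
- by move=> l1 l2 k u v; rewrite mT !size_cat /=; ring.
- by move=> l1 u l2; rewrite aT mulr0.
- by move=> l /negPf->; rewrite mul0r.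
Qed.

(** The determinants of [g] (from [nu]) and of [h] (from [A] and [s]) cancel. This computes an
    interior product at q in the coordinates of another chart. *)
Lemma interior_vec_frame a nu A s (g h : 'M[R]_n) : g *m h = 1%:M ->
  Defs.alternating n nu -> Defs.alternating a A ->
  interior_vec A nu (map (mulmxr g) s) =
  nu (map (mulmxr g) (std vec)) * rwedge (A \o map (mulmx h)) (wdet kpair s) (std cov).
Proof.
move=> gh an aA; rewrite interior_vecE; last exact: alternating_degree an.
rewrite (altern_top_vec _ (alternating_multilin an) (alternating_altern an)).
have mA := alternating_multilin aA; have altA := alternating_altern aA.
have -> : rwedge (A \o map (mulmx h)) (wdet kpair s) (std cov)
   = rwedge A (wdet kpair (map (mulmxr g) s)) (map (mulmx h) (std cov)).
  rewrite [RHS]rwedge_map; apply: eq_rwedge => // l /=; apply/esym/eq_wdet => xi x.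
  by rewrite /kpair /= !mulmxA -(mulmxA x) gh mulmx1.
rewrite altern_top_cov; [|by apply: rwedge_multilin => //; apply: (wdet_multilin (@kpair_linl R n))
  |by apply: rwedge_altern => //; apply: wdet_altern].
by rewrite mulrACA -det_mulmx gh det1 mul1r.
Qed.

Lemma wedge_covectors_rcons (l : seq M) be (s : seq N) :
  wedge (wedge_covectors l) (wedge_covectors [:: be]) s = wedge_covectors (rcons l be) s.
Proof.
rewrite wedge_rwedge (@eq_rwedge _ _ _ (wdet kpair ^~ l) _ (wdet kpair ^~ [:: be])); last 2 first.
- by move=> t; apply: wedge_covectorsE.
- by move=> t; apply: wedge_covectorsE.
rewrite wedge_covectorsE wdet_rcons rwedge_degree1r; last first.
  by move=> t st; rewrite wdet_size // eq_sym.
rewrite -altsumZ; apply: eq_altsum => x X' _; rewrite /sgn_size /= mulr1 subr0.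
have [->|ne] := eqVneq (size X') (size l); first by ring.
by rewrite wdet_size ?mulr0 ?mul0r // eq_sym.
Qed.

(** Both sides being alternating in [t], basis lists indexed by sets [J] suffice, on which only the
    term [I = J] survives. *)
Lemma ext_pair_wedge_covectors a A t : Defs.alternating a A ->
  ext_pair (wedge_covectors t) A = A t.
Proof.
move=> aA; apply/eqP; rewrite -subr_eq0; apply/eqP.
pose B t := ext_pair (wedge_covectors t) A - A t.
have EB u : ext_pair (wedge_covectors u) A = \sum_(I : {set 'I_n})
    wdet kpair [seq vec i | i <- enum I] u * A [seq cov i | i <- enum I].
  by apply: eq_bigr => I _; rewrite wedge_covectorsE.
rewrite -/(B t); apply: (altern_sets_ext (@col_covE R n)).
- move=> s1 s2 k u v; rewrite /B !EB (alternating_multilin aA).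
  rewrite (eq_bigr (fun I : {set 'I_n} => k * (wdet kpair [seq vec i | i <- enum I] (s1 ++ u :: s2) * A [seq cov i | i <- enum I])
    + wdet kpair [seq vec i | i <- enum I] (s1 ++ v :: s2) * A [seq cov i | i <- enum I])).
    by rewrite big_split -mulr_sumr /=; ring.
  by move=> I _; rewrite (wdet_multilin (@kpair_linl R n)); ring.
- move=> s1 u s2; rewrite /B EB (alternating_altern aA) subr0 big1 // => I _.
  by rewrite wdet_altern mul0r.
- move=> J; rewrite /B EB (bigD1 J) //= (wdet_dual kpair_dual) ?enum_uniq // mul1r.
  rewrite [X in _ + X - _]big1 ?addr0 ?subrr // => I IJ.
  have [sIJ|ne] := eqVneq #|J| #|I|; last by rewrite wdet_size ?mul0r // !size_map -!cardE.
  (* Such an index gives a zero row in the determinant. *)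
  have /existsP[i /andP[iJ iI]] : [exists i, (i \in J) && (i \notin I)].
    apply: contraT => /existsPn H; case/eqP: IJ; apply/esym/eqP.
    rewrite eqEcard sIJ leqnn andbT; apply/fintype.subsetP => i iJ.
    by have := H i; rewrite iJ negbK.
  rewrite -(@det_wdet _ _ _ kpair #|I|) ?size_map -?cardE //.
  have ir : (index i (enum J) < #|I|)%N by rewrite -sIJ cardE index_mem mem_enum.
  rewrite (expand_det_row _ (Ordinal ir)) big1 ?mul0r // => j _; rewrite mxE /=.
  rewrite (nth_map i) -?cardE ?sIJ // nth_index ?mem_enum //.
  rewrite (nth_map i) -?cardE // kpair_dual.
  have : nth i (enum I) j \in I by rewrite -mem_enum mem_nth // -cardE.
  by case: eqVneq => [<-|]; rewrite ?mul0r // (negPf iI).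
Qed.

Lemma interior_formE a be A l : Defs.alternating a A ->
  interior_form (wedge_covectors [:: be]) A l = A (rcons l be).
Proof.
move=> aA; rewrite /interior_form -(ext_pair_wedge_covectors _ aA).
by apply: eq_bigr => I _; rewrite wedge_covectors_rcons.
Qed.

(** The operator e ^ i(be) replaces one argument by [be], weighted by its pairing with [e]. The sign
    comes from moving [be] from the last place to the front, past [size s - 1] arguments. *)
Lemma wedge_interior a (e : N) be A (s : seq M) : Defs.alternating a A ->
  wedge (wedge_vectors [:: e]) (interior_form (wedge_covectors [:: be]) A) s =
  - (-1) ^+ size s * dsum (fun x => kpair x e *: be) A s.
Proof.
move=> aA; rewrite wedge_rwedge.
rewrite (@eq_rwedge _ _ _ (wdet kpair [:: e]) _ (fun l => A (rcons l be))); last 2 first.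
- by move=> l; apply: wedge_vectorsE.
- by move=> l; apply: interior_formE aA.
have mA := alternating_multilin aA; have sA := multilin_skew mA (alternating_altern aA).
rewrite rwedge_degree1l; last by move=> l sl; apply: wdet_size.
rewrite -altsum_dsum // -altsumZ; apply: eq_altsum => x l sl.
rewrite -sl skew_move_rcons // (multilinZ [::]) //= subr0 exprS; ring.
Qed.

End RealForms.

(** * Smooth functions on open sets *)

Section LineDerivative.
Context {R : realType} {V : normedModType R}.

Lemma line_growth (g : V -> R) (y v : V) (t : R) :
  (fun h : R => h^-1 *: (g ((h *: (1 : R) + t) *: v + y) - g (t *: v + y))) =
  (fun h : R => h^-1 *: (g (h *: v + (t *: v + y)) - g (t *: v + y))).
Proof. by apply/funext => h; rewrite [h *: 1]mulr1 scalerDl addrA. Qed.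

Lemma is_derive_line (g : V -> R) (y v : V) (t : R) : derivable g (t *: v + y) v ->
  is_derive t 1 (fun s : R => g (s *: v + y)) ('D_v g (t *: v + y)).
Proof. by move=> dg; split; rewrite /derivable /derive /= line_growth. Qed.

Lemma mvt_line (g : V -> R) (y v : V) (t : R) :
  (forall s : R, `|s| <= `|t| -> derivable g (s *: v + y) v) ->
  exists2 s : R, `|s| <= `|t| & g (t *: v + y) - g y = t * 'D_v g (s *: v + y).
Proof.
move=> dg; pose f s := g (s *: v + y).
have df (s : R) : `|s| <= `|t| -> is_derive s (1 : R) f ('D_v g (s *: v + y)).
  by move=> st; apply/is_derive_line/dg.
have cf (A : interval R) : (forall s : R, s \in A -> `|s| <= `|t|) -> {within [set` A], continuous f}.
  move=> H; apply: derivable_within_continuous => s sA.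
  by have [] := df s (H s sA).
have mvt (a b : R) : a <= b -> (forall s : R, s \in `[a, b] -> `|s| <= `|t|) ->
    exists2 s : R, `|s| <= `|t| & f b - f a = 'D_v g (s *: v + y) * (b - a).
  move=> ab H.
  have H1 (s : R) : s \in `]a, b[ -> is_derive s (1 : R) f ('D_v g (s *: v + y)).
    by move=> sab; apply/df/H/(subset_itv_oo_cc sab).
  have [s sab E] := MVT_segment ab H1 (cf _ H).
  by exists s => //; apply: H.
have [t0|t0] := leP 0 t.
  have [s|s st] := mvt 0 t t0.
    by rewrite in_itv /= => /andP[s0 st]; rewrite !ger0_norm.
  by rewrite /f scale0r add0r subr0 mulrC; exists s.
have [s|s st] := mvt t 0 (ltW t0).
  by rewrite in_itv /= => /andP[ts s0]; rewrite ler0_norm // ltr0_norm // lerN2.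
rewrite /f scale0r add0r sub0r => E; exists s => //.
by rewrite -opprB E mulrN opprK mulrC.
Qed.

End LineDerivative.

Section Partials.
Context {R : realType} {n : nat}.
Notation E := 'rV[R]_n.
Notation b i := (delta_mx 0 i : 'rV[R]_n).
Implicit Types (g : E -> R) (x y v : E).

Lemma coord_le_norm v i : `|v 0 i| <= `|v|.
Proof.
rewrite [leRHS]/Num.Def.normr /= mx_normrE.
by apply/bigmax_geP; right => /=; exists (0, i).
Qed.

Lemma norm_le_coord v (e : R) : 0 <= e -> (forall i, `|v 0 i| <= e) -> `|v| <= e.
Proof.
move=> e0 H; rewrite [leLHS]/Num.Def.normr /= mx_normrE.
by apply/bigmax_leP; split => // -[i j] _ /=; rewrite ord1.
Qed.

Lemma norm_basis (i : 'I_n) : `|b i| <= 1 :> R.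
Proof.
apply: norm_le_coord => // j; rewrite mxE eqxx /=.
by case: eqP => _; rewrite ?normr1 ?normr0.
Qed.

Definition partial_diff g x (v : E) : R := \sum_i v 0 i * 'D_(b i) g x.

(** The increment is telescoped along the coordinate axes, and the mean value theorem is applied on
    each segment. *)
Lemma differentiable_C1 g x :
  (forall i, \forall y \near x, derivable g y (b i)) ->
  (forall i, {for x, continuous (fun y => 'D_(b i) g y)}) ->
  differentiable g x /\ (forall v, 'D_v g x = \sum_i v 0 i * 'D_(b i) g x).
Proof.
move=> dg cg; pose L := partial_diff g x.
have Llin : linear L.
  move=> k u v; rewrite /L /partial_diff scaler_sumr -big_split; apply: eq_bigr => i _ /=.
  by rewrite !mxE mulrDl [k *: _]mulrA.
pose LM := GRing.isLinear.Build _ _ _ _ _ Llin.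
pose LL : {linear E -> R} := HB.pack L LM.
have Lc : continuous LL.
  move=> v; have -> : (LL : E -> R) = \sum_i (fun v : E => v 0 i * 'D_(b i) g x).
    by apply/funext => u; rewrite fct_sumE.
  apply: differentiable_continuous; apply: differentiable_sum => i.
  have -> : (fun v : E => v 0 i * 'D_(b i) g x) = ('D_(b i) g x) \*: (fun v : E => v 0 i).
    by apply/funext => u; rewrite /= mulrC.
  apply: differentiableZ; exact: differentiable_coord.
suff H : g \o shift x = cst (g x) + LL +o_ (0 : E) id.
  have dE := diff_unique Lc H.
  have dx : differentiable g x.
    by apply/diff_locallyP; rewrite dE; split.
  by split => // v; rewrite deriveE // dE.
apply/eqaddoP => e e0.
have n0 : 0 < n.+1%:R :> R by [].
(* [n.+1] instead of [n] keeps [e'] positive in dimension 0. *)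
pose e' := e / n.+1%:R; have e'0 : 0 < e' by rewrite divr_gt0.
pose Pd (i : 'I_n) (y : E) := derivable g y (b i) /\ `|'D_(b i) g x - 'D_(b i) g y| < e'.
have Hi i : nbhs x (Pd i).
  have c1 : \forall y \near x, `|'D_(b i) g x - 'D_(b i) g y| < e'.
    by have := cg i; move/cvgrPdist_lt; apply.
  by apply: filterS2 (dg i) c1 => y.
have /nbhs_ballP[r /= r0 Hr] : nbhs x (fun y => forall i, Pd i y) by refine (@filter_forall E _ Pd (nbhs x) _ Hi).
near=> h.
have hr : `|h| < r.
  by near: h; apply/nbhs_ballP; exists r => //= z; rewrite -ball_normE /ball_ /= sub0r normrN.
(* The vertices of the path from 0 to [h] that changes one coordinate at a time. *)
pose hk k : E := \row_i (if (i < k)%N then h 0 i else 0).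
have hk_le k (s : R) (i : 'I_n) : (i = k :> nat) -> `|s| <= `|h 0 i| -> `|s *: b i + hk k| <= `|h|.
  move=> ik sh; apply: norm_le_coord => // j; rewrite !mxE eqxx /=.
  have [->|ji] := eqVneq j i; first by rewrite ik ltnn addr0 mulr1 (le_trans sh) // coord_le_norm.
  by rewrite mulr0 add0r; case: ifP => _; rewrite ?normr0 ?coord_le_norm.
have step (i : 'I_n) : `|g (hk i.+1 + x) - g (hk i + x) - h 0 i * 'D_(b i) g x| <= e' * `|h|.
  have hS : hk i.+1 = h 0 i *: b i + hk i.
    apply/rowP => j; rewrite !mxE eqxx /= ltnS leq_eqVlt.
    have [->|ji] := eqVneq j i; first by rewrite eqxx ltnn addr0 mulr1.
    by rewrite mulr0 add0r (inj_eq val_inj) (negPf ji).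
  have inb (s : R) : `|s| <= `|h 0 i| -> ball x r (s *: b i + (hk i + x)).
    move=> sh; rewrite -ball_normE /ball_ /= addrA opprD addrCA subrr addr0 normrN.
    exact: le_lt_trans (hk_le i s i erefl sh) hr.
  have [s|s sh] := @mvt_line R E g (hk i + x) (b i) (h 0 i).
    by move=> /inb/Hr/(_ i)[].
  rewrite addrA -hS => ->; rewrite -mulrBr normrM mulrC.
  apply: ler_pM => //; last exact: coord_le_norm.
  by rewrite distrC ltW //; have [_] := Hr _ (inb s sh) i.
have -> : (g \o shift x - (cst (g x) + LL)) h =
   \sum_(i < n) (g (hk i.+1 + x) - g (hk i + x) - h 0 i * 'D_(b i) g x).
  have hn : hk n = h by apply/rowP => j; rewrite !mxE ltn_ord.
  have h0 : hk 0%N = 0 by apply/rowP => j; rewrite !mxE ltn0.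
  rewrite sumrB -(big_mkord xpredT (fun i => g (hk i.+1 + x) - g (hk i + x))).
  rewrite telescope_sumr // hn h0 add0r.
  by rewrite !fctE /= opprD addrA.
apply: (le_trans (ler_norm_sum _ _ _)).
apply: (@le_trans _ _ (\sum_(i < n) e' * `|h|)); first by apply: ler_sum.
rewrite sumr_const card_ord -mulr_natl mulrA ler_wpM2r //.
rewrite /e' mulrCA -[leRHS]mulr1 ler_pM2l // ler_pdivrMr // mul1r ler_nat //.
Unshelve. all: by end_near. Qed.

End Partials.

Section Chain.
Context {R : realType}.

Lemma derive_rVE n (g : 'rV[R]_n -> R) x v : differentiable g x ->
  'D_v g x = \sum_i v 0 i * 'D_(delta_mx 0 i) g x.
Proof.
move=> dg; rewrite deriveE // {1}(row_sum_delta v) linear_sum.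
by apply: eq_bigr => i _; rewrite linearZ deriveE.
Qed.

Lemma differentiable_rV n m (F : 'rV[R]_n -> 'rV[R]_m) x :
  (forall j, differentiable (fun y => F y 0 j) x) -> differentiable F x.
Proof.
move=> dF.
have -> : F = \sum_j (fun y => F y 0 j *: (delta_mx 0 j : 'rV[R]_m)).
  by apply/funext => y; rewrite fct_sumE {1}(row_sum_delta (F y)).
by apply: differentiable_sum => j; apply: differentiableZl.
Qed.

Lemma derive_rV_coord n m (F : 'rV[R]_n -> 'rV[R]_m) x v j : differentiable F x ->
  ('D_v F x) 0 j = 'D_v (fun y => F y 0 j) x.
Proof. by move=> dF; rewrite derive_mx ?mxE //; exact: diff_derivable. Qed.

Lemma differentiable_rV_coord n m (F : 'rV[R]_n -> 'rV[R]_m) x j :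
  differentiable F x -> differentiable (fun y => F y 0 j) x.
Proof.
move=> dF; apply: (@differentiable_comp _ _ _ _ F (fun v : 'rV[R]_m => v 0 j)) => //.
exact: differentiable_coord.
Qed.

Lemma derive_compE n m (F : 'rV[R]_n -> 'rV[R]_m) (g : 'rV[R]_m -> R) x v :
  differentiable F x -> differentiable g (F x) ->
  'D_v (g \o F) x = 'D_('D_v F x) g (F x).
Proof.
move=> dF dg; rewrite deriveE; last exact: differentiable_comp.
by rewrite diff_comp //= !deriveE.
Qed.

End Chain.

(** * The function exp(-1/t) and its derivatives *)

Section Bump1.
Context {R : realType}.

(* [t^-k exp (-1/t)] on the positive reals, extended by zero. *)
Definition expinv (k : nat) (t : R) : R := if 0 < t then t ^- k * expR (- t^-1) else 0.

(** From exp(1/t) >= t^-(k+2) / (k+2)!. The bound by t^2 makes the difference quotient at 0 tend to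
    0. *)
Lemma expinv_le k (t : R) : 0 < t -> expinv k t <= k.+2`!%:R * t ^+ 2.
Proof.
move=> t0; rewrite /expinv t0 expRN.
have t1 : 0 < t^-1 by rewrite invr_gt0.
have := expR_ge1Dxn k.+1 (ltW t1) => H.
have {}H : t^-1 ^+ k.+2 / k.+2`!%:R <= expR t^-1.
  by apply: le_trans H; rewrite lerDr.
have f0 : 0 < k.+2`!%:R :> R by rewrite ltr0n fact_gt0.
rewrite ler_pdivrMr ?expR_gt0 //.
have p0 : 0 < k.+2`!%:R * t ^+ 2 by rewrite mulr_gt0 // exprn_gt0.
move: H; rewrite -(ler_pM2l p0); apply: le_trans.
rewrite le_eqVlt; apply/orP; left; apply/eqP.
have tn : t != 0 by rewrite gt_eqF.
rewrite exprVn -[k.+2]addn2 exprD invfM.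
by field; rewrite expf_neq0 ?tn //= pnatr_eq0 -lt0n fact_gt0.
Qed.

Lemma expinv_ge0 k (t : R) : 0 <= expinv k t.
Proof.
rewrite /expinv; case: ifP => // t0.
by rewrite mulr_ge0 ?expR_ge0 // invr_ge0 exprn_ge0 ?ltW.
Qed.

Lemma expinv_gt0 k (t : R) : 0 < t -> 0 < expinv k t.
Proof.
move=> t0; rewrite /expinv t0.
by rewrite mulr_gt0 ?expR_gt0 // invr_gt0 exprn_gt0.
Qed.

Lemma expinv_eq0 k (t : R) : t <= 0 -> expinv k t = 0.
Proof. by move=> t0; rewrite /expinv ltNge t0. Qed.

Lemma is_derive_expinv0 k : is_derive (0 : R) (1 : R) (expinv k) 0.
Proof.
suff H : (fun h : R => h^-1 *: (expinv k (h *: (1 : R) + 0) - expinv k 0)) @ (0 : R)^' --> (0 : R).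
  split; first by apply/cvg_ex; exists 0.
  by rewrite /derive; apply/cvg_lim.
apply/cvgrPdist_le => e e0.
pose C : R := k.+2`!%:R; have C0 : 0 < C by rewrite ltr0n fact_gt0.
have eC : 0 < e / C by rewrite divr_gt0.
near=> h; rewrite sub0r normrN (@expinv_eq0 k 0) // subr0 addr0 [h *: 1]mulr1.
have hn : h != 0 by near: h; exact: nbhs_dnbhs_neq.
have he : `|h| <= e / C by near: h; exact: dnbhs0_le.
have [h0|h0] := leP h 0; first by rewrite expinv_eq0 // scaler0 normr0 ltW.
rewrite normrM normfV !gtr0_norm ?expinv_gt0 // in he *.
rewrite mulrC ler_pdivrMr //; apply: le_trans (expinv_le k h0) _.
rewrite expr2 mulrA; apply: ler_wpM2r; first exact: ltW.
by rewrite mulrC -ler_pdivlMr.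
Unshelve. all: by end_near. Qed.

(** Thanks to the index [k], the derivative is again a combination of members of the family, as the
    class [sm] requires. *)
Lemma is_derive_expinv k (t : R) :
  is_derive t (1 : R) (expinv k) (- k%:R * expinv k.+1 t + expinv k.+2 t).
Proof.
have [t0|t0|->] := ltgtP t 0.
- rewrite !expinv_eq0 ?ltW // mulr0 addr0.
  apply: (@near_eq_is_derive _ _ _ (cst (0 : R))).
    by apply: filterS (lt_nbhsl t0) => s s0; rewrite expinv_eq0 // ltW.
- have tn : t != 0 by rewrite gt_eqF.
  pose u : R -> R := fun s => s^-1.
  have dV : is_derive t (1 : R) u (- t ^- 2).
    by apply: is_derive_eq (is_deriveV tn (is_derive_id t 1)) _; rewrite [_ *: _]mulr1.
  apply: (@near_eq_is_derive _ _ _ (u ^+ k * (expR \o (- u)))).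
    apply: filterS (lt_nbhsr t0) => s s0.
    have -> : (u ^+ k * (expR \o - u)) s = (u ^+ k) s * expR (- u s) by [].
    by rewrite /expinv s0 -exprVn exprfctE.
  have dE : is_derive t (1 : R) (expR \o (- u)) (expR (- u t) * (- (- t ^- 2))).
    by apply: is_derive1_comp.
  apply: is_derive_eq (is_deriveM (is_deriveX k dV) dE) _.
  rewrite /expinv t0 /= -!exprVn exprfctE /GRing.scale /= /u.
  case: k => [|k]; first by rewrite /= !expr0 !mul0r; ring.
  have -> : (- (fun s : R => s^-1)) t = - t^-1 by [].
  by rewrite -[k.+1.-1]/k !exprS expr0; ring.
- by rewrite !(@expinv_eq0 _ 0) // mulr0 addr0; apply: is_derive_expinv0.
Qed.

End Bump1.

Lemma near_eq_differentiable (R : numFieldType) (V W : normedModType R) (f g : V -> W) x :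
  {near x, f =1 g} -> differentiable f x -> differentiable g x.
Proof.
move=> fg df; have fgx : f x = g x := nbhs_singleton fg.
have dc := diff_continuous df.
suff H : g \o shift x = cst (g x) + 'd f x +o_ (0 : V) id.
  have dE := diff_unique dc H.
  by apply/diff_locallyP; rewrite dE; split.
apply/eqaddoP => e e0.
have /eqaddoP/(_ e e0) H := diff_locally df.
have N : \forall h \near (0 : V), f (h + x) = g (h + x).
  by rewrite (near_shift x 0) /= sub0r; near=> y; rewrite /= addrNK; near: y.
apply: filterS2 H N => h; rewrite !fctE /= -fgx => H <-; exact: H.
Unshelve. all: by end_near. Qed.

Section Smooth.
Context {R : realType}.
Notation b i := (delta_mx 0 i).

(* [smooth_on] speaks of the iterated partial derivatives, so its stability under the
   operations is proved for all the operations at once: the class [sm] is stable under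
   partial derivatives. *)
Inductive sm n (W : set 'rV[R]_n) : ('rV[R]_n -> R) -> Prop :=
| sm_base g : smooth_on W g -> sm W g
| sm_cst c : sm W (fun=> c)
| sm_coord j : sm W (fun x => x 0 j)
| sm_add g h : sm W g -> sm W h -> sm W (fun x => g x + h x)
| sm_mul g h : sm W g -> sm W h -> sm W (fun x => g x * h x)
| sm_inv g : (forall x, W x -> g x != 0) -> sm W g -> sm W (fun x => (g x)^-1)
| sm_expinv k g : sm W g -> sm W (fun x => expinv k (g x))
| sm_comp m (W' : set 'rV[R]_m) g (F : 'rV[R]_n -> 'rV[R]_m) : open W' -> smooth_on W' g ->
    (forall j, sm W (fun x => F x 0 j)) -> (forall x, W x -> W' (F x)) -> sm W (g \o F)
| sm_ext g h : (forall x, W x -> g x = h x) -> sm W g -> sm W h.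

Lemma iter_partial_rcons n l i (g : 'rV[R]_n -> R) :
  iter_partial (rcons l i) g = iter_partial l (fun x => 'D_(b i) g x).
Proof. by rewrite /iter_partial foldr_rcons. Qed.

Lemma smooth_on_partial n (W : set 'rV[R]_n) g i :
  smooth_on W g -> smooth_on W (fun x => 'D_(b i) g x).
Proof. by move=> sg l x Wx; have := sg (rcons l i) x Wx; rewrite iter_partial_rcons. Qed.

Lemma smooth_on_differentiable n (W : set 'rV[R]_n) g x :
  open W -> smooth_on W g -> W x -> differentiable g x.
Proof.
move=> oW sg Wx; apply: (differentiable_C1 _ _).1 => i.
  by apply: filterS (open_nbhs_nbhs (conj oW Wx)) => y Wy; have [_] := sg [::] y Wy; apply.
by have [] := sg [:: i] x Wx.
Qed.

Lemma near_open n (W : set 'rV[R]_n) (g h : 'rV[R]_n -> R) x :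
  open W -> (forall x, W x -> g x = h x) -> W x -> {near x, g =1 h}.
Proof. by move=> oW E Wx; apply: filterS (open_nbhs_nbhs (conj oW Wx)). Qed.

Lemma differentiable_expinv k (t : R) : differentiable (expinv k) t.
Proof. by apply/derivable1_diffP; have [] := is_derive_expinv k t. Qed.

Lemma sm_differentiable n (W : set 'rV[R]_n) g x :
  open W -> sm W g -> W x -> differentiable g x.
Proof.
move=> oW sg; elim: sg x => {g} [g sg|c|j|g h _ Hg _ Hh|g h _ Hg _ Hh|g g0 _ Hg|k g _ Hg
  |m W' g F oW' sg _ HF WW'|g h E _ Hg] x Wx.
- exact: smooth_on_differentiable Wx.
- exact: differentiable_cst.
- exact: differentiable_coord.
- by apply: differentiableD; [exact: Hg|exact: Hh].
- by apply: differentiableM; [exact: Hg|exact: Hh].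
- by apply: differentiableV; [exact: Hg|exact: g0].
- by apply: (differentiable_comp (Hg x Wx)); apply: differentiable_expinv.
- apply: differentiable_comp; first by apply: differentiable_rV => j; apply: HF.
  by apply: smooth_on_differentiable sg _; [|exact: WW'].
- exact: near_eq_differentiable (near_open oW E Wx) (Hg x Wx).
Qed.

Lemma sm_sum n (W : set 'rV[R]_n) (I : Type) (r : seq I) (F : I -> 'rV[R]_n -> R) :
  (forall i, sm W (F i)) -> sm W (fun x => \sum_(i <- r) F i x).
Proof.
move=> H; elim: r => [|i r IH].
  by apply: sm_ext (sm_cst _ 0) => x _; rewrite big_nil.
by apply: sm_ext (sm_add (H i) IH) => x _; rewrite big_cons.
Qed.

Lemma sm_partial n (W : set 'rV[R]_n) g i :
  open W -> sm W g -> sm W (fun x => 'D_(b i) g x).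
Proof.
move=> oW sg; elim: sg => {g} [g sg|c|j|g h sg Hg sh Hh|g h sg Hg sh Hh|g g0 sg Hg|k g sg Hg
  |m W' g F oW' sg sF HF WW'|g h E sg Hg].
- exact/sm_base/smooth_on_partial.
- by apply: sm_ext (sm_cst _ 0) => x _; rewrite derive_cst.
- apply: sm_ext (sm_cst _ ((b i : 'rV[R]_n) 0 j)) => x _.
  rewrite -(derive_rV_coord (F := id)) ?derive_id //.
- apply: sm_ext (sm_add Hg Hh) => x Wx; rewrite deriveD //; apply: diff_derivable;
    exact: sm_differentiable Wx.
- apply: sm_ext (sm_add (sm_mul sg Hh) (sm_mul sh Hg)) => x Wx.
  by rewrite deriveM //; apply: diff_derivable; exact: sm_differentiable Wx.
- apply: sm_ext (sm_mul (sm_cst _ (-1)) (sm_mul (sm_mul (sm_inv g0 sg) (sm_inv g0 sg)) Hg)) => x Wx.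
  rewrite deriveV ?g0 //; last by apply: diff_derivable; exact: sm_differentiable Wx.
  by rewrite /GRing.scale /= expr2 invfM; ring.
- apply: sm_ext (sm_mul (sm_add (sm_mul (sm_cst _ (- k%:R)) (sm_expinv k.+1 sg)) (sm_expinv k.+2 sg)) Hg) => x Wx.
  have dg := sm_differentiable oW sg Wx.
  rewrite [RHS]deriveE; last by apply: (differentiable_comp dg); apply: differentiable_expinv.
  rewrite diff_comp //=; last exact: differentiable_expinv.
  have [_ E] := is_derive_expinv k (g x).
  have H (v : R) : 'd (expinv k) (g x) v = 'D_1 (expinv k) (g x) * v.
    rewrite deriveE; last exact: differentiable_expinv.
    by rewrite -{1}[v]mulr1 -[v * 1]/(v *: (1 : R)) linearZ mulrC.
  by rewrite H E -deriveE.
- have dF x : W x -> differentiable F x.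
    by move=> Wx; apply: differentiable_rV => j; apply: sm_differentiable Wx.
  apply: sm_ext (sm_sum (index_enum 'I_m) (F := fun j x => 'D_(b i) (fun x => F x 0 j) x * ((fun y => 'D_(b j) g y) \o F) x) _) => [x Wx|j].
    have dg : differentiable g (F x) by apply: smooth_on_differentiable sg _ => //; exact: WW'.
    rewrite (derive_compE _ (dF x Wx) dg) derive_rVE //; apply: eq_bigr => j _.
    by rewrite derive_rV_coord //; exact: dF.
  apply: sm_mul => //; apply: sm_comp oW' (smooth_on_partial j sg) sF WW'.
- by apply: sm_ext Hg => x Wx; apply: near_eq_derive (near_open oW E Wx).
Qed.

Lemma sm_smooth n (W : set 'rV[R]_n) g : open W -> sm W g -> smooth_on W g.
Proof.
move=> oW sg l x Wx.
have {}sg : sm W (iter_partial l g).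
  by elim: l => //= i l IH; apply: sm_partial.
have d := sm_differentiable oW sg Wx.
by split=> [|i]; [exact: differentiable_continuous|exact: diff_derivable].
Qed.

Lemma dist_half (e A C Z : R) : `|C - Z| < e / 2 -> `|A - Z| < e / 2 -> `|A - C| <= e.
Proof.
move=> h1 h2; rewrite -(subrKA Z); apply: le_trans (ler_normD _ _) _.
rewrite (distrC Z); lra.
Qed.

(** The mean value theorem, applied twice in either order, expresses one and the same second
    difference by both mixed derivatives at points near [x]; continuity concludes. *)
Lemma schwarz n (W : set 'rV[R]_n) g x (i j : 'I_n) : open W -> smooth_on W g -> W x ->
  'D_(b i) (fun y => 'D_(b j) g y) x = 'D_(b j) (fun y => 'D_(b i) g y) x.
Proof.
move: i j => i0 j0 oW sg Wx.
have key (i j : 'I_n) (t : R) : (forall s u : R, `|s| <= `|t| -> `|u| <= `|t| ->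
      W (u *: b j + (s *: b i + x))) ->
    exists s u, [/\ `|s| <= `|t|, `|u| <= `|t| &
      g (t *: b j + (t *: b i + x)) - g (t *: b i + x) - (g (t *: b j + x) - g x) =
      t * (t * 'D_(b j) (fun y => 'D_(b i) g y) (u *: b j + (s *: b i + x)))].
  move=> H; have t0 : `|(0 : R)| <= `|t| by rewrite normr0.
  have W0 s : `|s| <= `|t| -> W (s *: b i + x).
    by move=> st; have := H s 0 st t0; rewrite scale0r add0r.
  pose phi y := g (t *: b j + y) - g y.
  have der y : W y -> forall k, derivable g y (b k) by move=> Wy; have [] := sg [::] y Wy.
  have dphi s : `|s| <= `|t| -> is_derive (s *: b i + x) (b i) phi
      ('D_(b i) g (t *: b j + (s *: b i + x)) - 'D_(b i) g (s *: b i + x)).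
    move=> st; apply: is_deriveB; last by apply: derivableP; apply: der; apply: W0.
    have d := der _ (H s t st (lexx _)) i.
    have E (z : 'rV[R]_n) : (fun h : R => h^-1 *: ((fun y => g (t *: b j + y)) (h *: b i + z) - (fun y => g (t *: b j + y)) z)) =
      (fun h : R => h^-1 *: (g (h *: b i + (t *: b j + z)) - g (t *: b j + z))).
      by apply/funext => h; rewrite addrCA.
    by split; rewrite /derivable /derive E.
  have [s|s st E] := @mvt_line R _ phi x (b i) t.
    by move=> /dphi[].
  have [_ dE] := dphi s st; rewrite dE in E.
  have [u|u ut E2] := @mvt_line R _ (fun y => 'D_(b i) g y) (s *: b i + x) (b j) t.
    by move=> ut; have [_] := sg [:: i] _ (H s u st ut); apply.
  by exists s, u; split => //; rewrite -E2 -E.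
move: i0 j0 => i j; set a := LHS; set c := RHS; apply/eqP; rewrite -subr_eq0 -normr_le0.
apply/ler_addgt0Pl => e e0; rewrite addr0.
have e2 : 0 < e / 2 by rewrite divr_gt0.
have ca : \forall y \near x, `|a - 'D_(b i) (fun y => 'D_(b j) g y) y| < e / 2.
  have [ct _] := sg [:: i; j] x Wx.
  by move/cvgrPdist_lt: ct; apply.
have cc : \forall y \near x, `|c - 'D_(b j) (fun y => 'D_(b i) g y) y| < e / 2.
  have [ct _] := sg [:: j; i] x Wx.
  by move/cvgrPdist_lt: ct; apply.
have [r /= r0 Hr] := (nbhs_ballP _ _).1 (filterI (filterI ca cc) (open_nbhs_nbhs (conj oW Wx))).
(* Two displacements of length at most [t] stay within r / 2 of [x]. *)
pose t := r / 4; have t0 : 0 < t by rewrite divr_gt0.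
have inb (k l : 'I_n) (s u : R) : `|s| <= `|t| -> `|u| <= `|t| -> ball x r (u *: b l + (s *: b k + x)).
  move=> st ut; rewrite -ball_normE /ball_ /= addrA opprD addrCA subrr addr0 normrN.
  apply: le_lt_trans (ler_normD _ _) _; rewrite !normrZ.
  have h1 : `|u| * `|b l : 'rV[R]_n| <= t.
    by rewrite -[leRHS]mulr1 ler_pM ?norm_basis // -[leRHS](gtr0_norm t0).
  have h2 : `|s| * `|b k : 'rV[R]_n| <= t.
    by rewrite -[leRHS]mulr1 ler_pM ?norm_basis // -[leRHS](gtr0_norm t0).
  apply: le_lt_trans (lerD h1 h2) _; rewrite /t; lra.
have [s1 [u1 [st1 ut1 E1]]] := key i j t (fun s u st ut => (Hr _ (inb i j s u st ut)).2).
have [s2 [u2 [st2 ut2 E2]]] := key j i t (fun s u st ut => (Hr _ (inb j i s u st ut)).2).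
have [[_ H1] _] := Hr _ (inb i j s1 u1 st1 ut1).
have [[H2 _] _] := Hr _ (inb j i s2 u2 st2 ut2).
have tn : t != 0 by rewrite gt_eqF.
have sw (p q r' s : R) : p - q - (r' - s) = p - r' - (q - s) by ring.
have cancel (A B : R) : t * (t * A) = t * (t * B) -> A = B by move=> /(mulfI tn)/(mulfI tn).
have EE := cancel _ _ (etrans (esym E1) (etrans (congr1 (fun z => g z - g (t *: b i + x) - (g (t *: b j + x) - g x)) (addrCA _ _ _)) (etrans (sw _ _ _ _) E2))).
by apply: dist_half H2; rewrite -EE.
Qed.

End Smooth.

Section Bump.
Context {R : realType} {n : nat}.
Notation E := 'rV[R]_n.

Definition sqdist (x y : E) : R := \sum_i (y 0 i - x 0 i) * (y 0 i - x 0 i).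

Lemma sm_sqdist (W : set E) x : sm W (sqdist x).
Proof.
apply: sm_sum => i; apply: sm_mul; apply: sm_add; exact: sm_coord || exact: sm_cst.
Qed.

Lemma sqdist_cont x : continuous (sqdist x).
Proof.
move=> y; apply: differentiable_continuous.
by apply: sm_differentiable (sm_sqdist setT x) _; [exact: openT|].
Qed.

Lemma sqdist_coord x y i (r : R) : 0 <= r -> sqdist x y <= r ^+ 2 -> `|y 0 i - x 0 i| <= r.
Proof.
move=> r0 H; rewrite -(ler_pXn2r (n := 2)) ?nnegrE // real_normK ?num_real //.
apply: le_trans H; rewrite /sqdist (bigD1 i) //= -expr2 lerDl.
by apply: sumr_ge0 => j _; rewrite -expr2 sqr_ge0.
Qed.

(** The function is u / (u + v), with u zero for q >= rho^2 and v zero for q <= rho^2 / 4; at every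
    point u or v is positive. The compact set outside [B] is what survives the passage to a
    manifold, where its image is closed. *)
Lemma bump_exists (x : E) (N : set E) : nbhs x N ->
  exists (be : E -> R) (B : set E),
    [/\ smooth_on setT be, \forall y \near x, be y = 1, open B, compact (~` B) &
        (forall y, B y -> be y = 0) /\ (~` B `<=` N)].
Proof.
move=> /nbhs_ballP[r /= r0 Hr]; pose rho := r / 2.
have rho0 : 0 < rho by rewrite divr_gt0.
pose q := sqdist x; pose u y := expinv 0 (rho ^+ 2 - q y).
pose v y := expinv 0 (q y - rho ^+ 2 / 4).
have sq W : sm W q by apply: sm_sqdist.
have su : sm setT u by apply: sm_expinv; apply: sm_ext (sm_add (sm_cst _ (rho ^+ 2)) (sm_mul (sm_cst _ (-1)) (sq _))) => y _; rewrite mulN1r.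
have sv : sm setT v by apply: sm_expinv; apply: sm_add (sq _) (sm_cst _ _).
have p0 : 0 < rho ^+ 2 by rewrite exprn_gt0.
have uv y : 0 < u y + v y.
  have [h|h] := ltP (q y) (rho ^+ 2).
    by rewrite ltr_wpDr ?expinv_ge0 // expinv_gt0 // subr_gt0.
  by rewrite ltr_wpDl ?expinv_ge0 // expinv_gt0 //; lra.
exists (fun y => u y * (u y + v y)^-1), [set y | rho ^+ 2 < q y]; split.
- apply: sm_smooth; first exact: openT.
  apply: sm_mul => //; apply: sm_inv; last exact: sm_add.
  by move=> y _; rewrite gt_eqF.
- have qx : q x < rho ^+ 2 / 4.
    by rewrite /q /sqdist big1 ?divr_gt0 // => i _; rewrite subrr mulr0.
  have : \forall y \near x, q y < rho ^+ 2 / 4.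
    have H : q y @[y --> x] --> q x by apply: sqdist_cont.
    exact: (H [set t | t < rho ^+ 2 / 4] (lt_nbhsl qx)).
  apply: filterS => y hy; rewrite /v expinv_eq0 ?addr0; last by rewrite subr_le0 ltW.
  by rewrite mulfV // gt_eqF // expinv_gt0 //; lra.
- rewrite (_ : [set y | _] = q @^-1` [set t | rho ^+ 2 < t]) //.
  apply: open_comp; last exact: open_gt.
  by move=> y _; apply: sqdist_cont.
- apply: bounded_closed_compact.
    exists (`|x| + rho); split; first exact: num_real.
    move=> M HM y /= /negP; rewrite -leNgt => hy.
    apply: le_trans (ltW HM); rewrite -(subrK x y) addrC; apply: le_trans (ler_normD _ _) _.
    rewrite lerD2l; apply: norm_le_coord; first exact: ltW.
    by move=> i; rewrite !mxE; apply: sqdist_coord => //; exact: ltW.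
  have -> : ~` [set y | rho ^+ 2 < q y] = q @^-1` [set t | t <= rho ^+ 2].
    by apply/seteqP; split => y /=; rewrite leNgt => /negP.
  apply: closed_comp; last exact: closed_le.
  by move=> y _; apply: sqdist_cont.
split=> [y /= hy|].
  by rewrite /u expinv_eq0 ?mul0r //; lra.
move=> y /= /negP; rewrite -leNgt => hy; apply: Hr.
rewrite -ball_normE /ball_ /= distrC; apply: (@le_lt_trans _ _ rho).
  apply: norm_le_coord => [|i]; first exact: ltW.
  by rewrite !mxE; apply: sqdist_coord => //; exact: ltW.
by rewrite /rho; lra.
Qed.

End Bump.

(** * The ring of smooth functions on an open set *)

Section SmoothRing.
Context {R : realType} {n : nat}.
Notation E := 'rV[R]_n.
Notation b i := (delta_mx 0 i : 'rV[R]_n).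

Record openset := OpenSet { oset :> set E; oset_open : open oset }.

(* Vanishing outside of [O] makes extensional equality on [O] an equality of [sfun]. *)
Record sfun (O : openset) := Sfun {
  sfun_val :> E -> R;
  sfun_smooth : smooth_on O sfun_val;
  sfun_out : forall x, ~ oset O x -> sfun_val x = 0 }.

HB.instance Definition _ (O : openset) := gen_eqMixin (sfun O).
HB.instance Definition _ (O : openset) := gen_choiceMixin (sfun O).

Variable O : openset.
Implicit Types (g h : sfun O).

Lemma sfun_eq g h : (forall x, oset O x -> g x = h x) -> g = h.
Proof.
case: g h => [g sg og] [h sh oh] /= E0; have gh : g = h.
  by apply/funext => x; have [Ox|nOx] := pselect (oset O x); [exact: E0|rewrite og // oh].
by subst h; congr Sfun; exact: Prop_irrelevance.
Qed.

Definition patch0 (g : E -> R) x : R := if `[< oset O x >] then g x else 0.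

Lemma patch0E (g : E -> R) x : oset O x -> patch0 g x = g x.
Proof. by move=> Ox; rewrite /patch0 asboolT. Qed.

Lemma sm_patch0 (g : E -> R) : sm O g -> smooth_on O (patch0 g).
Proof.
move=> sg; apply: sm_smooth; first exact: oset_open.
by apply: sm_ext sg => x Ox; rewrite patch0E.
Qed.

Lemma mk_sfun_subproof (g : E -> R) (sg : sm O g) :
  {h : sfun O | forall x, oset O x -> h x = g x}.
Proof.
have out x : ~ oset O x -> patch0 g x = 0 by move=> nOx; rewrite /patch0 asboolF.
by exists (Sfun (sm_patch0 sg) out) => x Ox /=; rewrite patch0E.
Qed.

Definition mk_sfun (g : E -> R) (sg : sm O g) : sfun O := sval (mk_sfun_subproof sg).

Lemma mk_sfunE (g : E -> R) sg x : oset O x -> @mk_sfun g sg x = g x.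
Proof. exact: (svalP (mk_sfun_subproof sg)). Qed.

Lemma sm_sfun g : sm O g. Proof. exact/sm_base/sfun_smooth. Qed.

Definition sfun_add g h := mk_sfun (sm_add (sm_sfun g) (sm_sfun h)).
Definition sfun_mul g h := mk_sfun (sm_mul (sm_sfun g) (sm_sfun h)).
Definition sfun_cst c := mk_sfun (sm_cst O c).
Definition sfun_opp g := mk_sfun (sm_mul (sm_cst O (-1)) (sm_sfun g)).

Lemma sfun_addA : associative sfun_add.
Proof. by move=> f g h; apply: sfun_eq => x Ox; rewrite !mk_sfunE // addrA. Qed.
Lemma sfun_addC : commutative sfun_add.
Proof. by move=> f g; apply: sfun_eq => x Ox; rewrite !mk_sfunE // addrC. Qed.
Lemma sfun_add0 : left_id (sfun_cst 0) sfun_add.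
Proof. by move=> f; apply: sfun_eq => x Ox; rewrite !mk_sfunE // add0r. Qed.
Lemma sfun_addN : left_inverse (sfun_cst 0) sfun_opp sfun_add.
Proof. by move=> f; apply: sfun_eq => x Ox; rewrite !mk_sfunE // mulN1r addNr. Qed.

HB.instance Definition _ := GRing.isZmodule.Build (sfun O) sfun_addA sfun_addC sfun_add0 sfun_addN.

Lemma sfun_mulA : associative sfun_mul.
Proof. by move=> f g h; apply: sfun_eq => x Ox; rewrite !mk_sfunE // mulrA. Qed.
Lemma sfun_mulC : commutative sfun_mul.
Proof. by move=> f g; apply: sfun_eq => x Ox; rewrite !mk_sfunE // mulrC. Qed.
Lemma sfun_mul1 : left_id (sfun_cst 1) sfun_mul.
Proof. by move=> f; apply: sfun_eq => x Ox; rewrite !mk_sfunE // mul1r. Qed.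
Lemma sfun_mulD : left_distributive sfun_mul sfun_add.
Proof. by move=> f g h; apply: sfun_eq => x Ox; rewrite !mk_sfunE // mulrDl. Qed.

HB.instance Definition _ := GRing.Zmodule_isComPzRing.Build (sfun O) sfun_mulA sfun_mulC sfun_mul1 sfun_mulD.

Definition sfun_partial i g : sfun O := mk_sfun (sm_partial i (@oset_open O) (sm_sfun g)).

Lemma sfunD g h x : oset O x -> (g + h) x = g x + h x. Proof. exact: mk_sfunE. Qed.
Lemma sfunM g h x : oset O x -> (g * h) x = g x * h x. Proof. exact: mk_sfunE. Qed.
Lemma sfunN g x : oset O x -> (- g) x = - g x. Proof. by move=> Ox; rewrite mk_sfunE // mulN1r. Qed.
Lemma sfun0 x : (0 : sfun O) x = 0.
Proof.
have [Ox|nOx] := pselect (oset O x); first exact: mk_sfunE.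
exact: sfun_out.
Qed.
Lemma sfun1 x : oset O x -> (1 : sfun O) x = 1. Proof. exact: mk_sfunE. Qed.

Lemma sfun_sum (I : Type) (r : seq I) (F : I -> sfun O) x : oset O x ->
  (\sum_(i <- r) F i) x = \sum_(i <- r) F i x.
Proof.
move=> Ox; elim: r => [|i r IH]; first by rewrite !big_nil sfun0.
by rewrite !big_cons sfunD // IH.
Qed.

Lemma sfun_differentiable g x : oset O x -> differentiable g x.
Proof. by move=> Ox; apply: sm_differentiable (sm_sfun g) Ox; exact: oset_open. Qed.

Lemma sfun_near_eq g (h : E -> R) x : oset O x -> (forall y, oset O y -> g y = h y) -> {near x, g =1 h}.
Proof. by move=> Ox H; apply: near_open Ox; [exact: oset_open|]. Qed.

Lemma sfun_partialE i g x : oset O x -> sfun_partial i g x = 'D_(b i) g x.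
Proof. exact: mk_sfunE. Qed.

Lemma sfun_partialD i g h : sfun_partial i (g + h) = sfun_partial i g + sfun_partial i h.
Proof.
apply: sfun_eq => x Ox; rewrite sfunD // !sfun_partialE //.
rewrite (near_eq_derive _ (sfun_near_eq Ox (fun y Oy => sfunD g h Oy))).
by rewrite deriveD //; apply: diff_derivable; exact: sfun_differentiable.
Qed.

Lemma sfun_partialM i g h : sfun_partial i (g * h) = sfun_partial i g * h + g * sfun_partial i h.
Proof.
apply: sfun_eq => x Ox; rewrite sfunD // !sfunM // !sfun_partialE //.
rewrite (near_eq_derive _ (sfun_near_eq Ox (fun y Oy => sfunM g h Oy))).
rewrite deriveM //; do ?[by apply: diff_derivable; exact: sfun_differentiable].
by rewrite addrC [_ *: _]mulrC.
Qed.

Lemma sfun_partialC i j g : sfun_partial i (sfun_partial j g) = sfun_partial j (sfun_partial i g).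
Proof.
apply: sfun_eq => x Ox.
have E k l : sfun_partial k (sfun_partial l g) x = 'D_(b k) (fun y => 'D_(b l) g y) x.
  rewrite (sfun_partialE k (sfun_partial l g) Ox).
  exact: near_eq_derive (sfun_near_eq Ox (fun y Oy => sfun_partialE l g Oy)).
exact: etrans (E i j) (etrans (schwarz i j (@oset_open O) (sfun_smooth g) Ox) (esym (E j i))).
Qed.

Lemma sfun_cstE c x : oset O x -> sfun_cst c x = c. Proof. exact: mk_sfunE. Qed.

Lemma sfun_half : sfun_cst 2^-1 + sfun_cst 2^-1 = 1.
Proof. by apply: sfun_eq => x Ox; rewrite sfunD // sfun1 // sfun_cstE // -[2^-1]mul1r -splitr. Qed.

Lemma sfun_inv g : (forall x, oset O x -> g x != 0) -> exists h, g * h = 1.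
Proof.
move=> g0; exists (mk_sfun (sm_inv g0 (sm_sfun g))).
by apply: sfun_eq => x Ox; rewrite sfunM // sfun1 // mk_sfunE // mulfV // g0.
Qed.

(** A bump function around [x] brings functions that are smooth only near [x] into the ring without
    changing their germ at [x]. *)
Lemma sfun_extend (g : E -> R) (N : set E) x : oset O x -> open N -> N x -> sm N g ->
  exists h : sfun O, \forall y \near x, h y = g y.
Proof.
move=> Ox oN Nx sg.
have [be [B [sbe be1 oB _ [be0 BN]]]] := bump_exists (open_nbhs_nbhs (conj oN Nx)).
pose h y := be y * (if `[< N y >] then g y else 0).
have shN : sm N h.
  apply: sm_ext (sm_mul _ sg) => [y Ny|]; first by rewrite /h asboolT.
  by apply: sm_base => l y _; apply: sbe.
have shB : sm B h by apply: sm_ext (sm_cst _ 0) => y By; rewrite /h be0 // mul0r.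
have sh : sm O h.
  apply: sm_base => l y _; have [By|nBy] := pselect (B y).
    exact: (sm_smooth oB shB).
  by apply: (sm_smooth oN shN); apply: BN.
exists (mk_sfun sh).
have nO := open_nbhs_nbhs (conj (@oset_open O) Ox).
have nN := open_nbhs_nbhs (conj oN Nx).
apply: filterS3 nO nN be1 => y Oy Ny b1.
by rewrite mk_sfunE // /h b1 mul1r asboolT.
Qed.

End SmoothRing.

(** * Changes of charts *)

Section Charts.
Context {R : realType} {n : nat} {T : topologicalType} (c : chart R n T).

Definition img (W : set T) : set 'rV[R]_n := c @` (W `&` chart_dom c).

Lemma imgP W y : img W y <-> (c @` chart_dom c) y /\ W (of_coord c y).
Proof.
split=> [[q [Wq dq] <-]|[[q dq <-]]].
  by rewrite to_coordK //; split => //; exists q.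
by rewrite to_coordK // => Wq; exists q.
Qed.

Lemma codP y : (c @` chart_dom c) y -> chart_dom c (of_coord c y) /\ c (of_coord c y) = y.
Proof. by move=> [q dq <-]; rewrite to_coordK. Qed.

Lemma img_in W q : W q -> chart_dom c q -> img W (c q).
Proof. by move=> Wq dq; exists q. Qed.

Lemma near_coord (Q : set T) q : chart_dom c q ->
  (\forall q' \near q, Q q') -> \forall y \near c q, Q (of_coord c y).
Proof.
move=> dq HQ; have Cq : (c @` chart_dom c) (c q) by exists q.
have H : of_coord c y @[y --> c q] --> of_coord c (c q) := of_coord_continuous Cq.
by rewrite to_coordK // in H; exact: H.
Qed.

Lemma near_point (Q : set 'rV[R]_n) q : chart_dom c q ->
  (\forall y \near c q, Q y) -> \forall q' \near q, Q (c q').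
Proof. by move=> dq HQ; have := to_coord_continuous dq; apply. Qed.

Lemma near_dom q : chart_dom c q -> \forall q' \near q, chart_dom c q'.
Proof. by move=> dq; apply: open_nbhs_nbhs; split => //; apply: open_dom. Qed.

Lemma near_cod q : chart_dom c q -> \forall y \near c q, (c @` chart_dom c) y.
Proof.
by move=> dq; apply: open_nbhs_nbhs; split; [apply: open_codom|exists q].
Qed.

Lemma img_open W : open W -> open (img W).
Proof.
move=> oW; rewrite openE => y /imgP[Cy Wy].
have [dq e] := codP Cy.
have H1 : \forall y' \near y, W (of_coord c y').
  by rewrite -e; apply: near_coord => //; apply: open_nbhs_nbhs.
have H2 : \forall y' \near y, (c @` chart_dom c) y' by rewrite -e; apply: near_cod.
by apply: filterS2 H1 H2 => y' ? ?; apply/imgP.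
Qed.

End Charts.

Section Manifold.
Context {R : realType} {n : nat} {P : manifold R n}.
Notation b i := (delta_mx 0 i : 'rV[R]_n).
Notation E := 'rV[R]_n.
Notation dom x := (chart_dom (chart_at (m := P) x)).
Implicit Types (x q : P) (h : P -> R).

Definition coordfun (x x' : P) (y : E) : E := chart_at x' (of_coord (chart_at x) y).

Lemma coordfun_smooth x x' j :
  smooth_on (img (chart_at x) (dom x')) (fun y => coordfun x x' y 0 j).
Proof. by rewrite /img setIC; apply: chart_at_smooth. Qed.

Lemma open_img x (W : set P) : open W -> open (img (chart_at x) W).
Proof. exact: img_open. Qed.

Lemma img_mono x (W W' : set P) : W `<=` W' -> img (chart_at x) W `<=` img (chart_at x) W'.
Proof. by move=> WW' y [q [Wq dq] <-]; exists q => //; split => //; apply: WW'. Qed.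

Lemma smooth_on_sub m (W W' : set 'rV[R]_m) g : W `<=` W' -> smooth_on W' g -> smooth_on W g.
Proof. by move=> WW' sg l y /WW'; apply: sg. Qed.

Lemma sm_sub m (W W' : set 'rV[R]_m) g : open W' -> W `<=` W' -> sm W' g -> sm W g.
Proof. by move=> oW' WW' /(sm_smooth oW') sg; apply/sm_base/(smooth_on_sub WW'). Qed.

Lemma coordfun_differentiable x x' q : dom x q -> dom x' q ->
  differentiable (coordfun x x') (chart_at x q).
Proof.
move=> dx dx'; apply: differentiable_rV => j.
apply: smooth_on_differentiable (coordfun_smooth (x := x) (x' := x') j) _.
  exact/open_img/open_dom.
exact: img_in.
Qed.

(* Vectors are rows: [v *m Jac x x' q] are the coordinates in [chart_at x'] of the
   vector at [q] with coordinates [v] in [chart_at x]. *)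
Definition Jac x x' q : 'M[R]_n :=
  \matrix_(i, j) 'D_(b i) (fun y => coordfun x x' y 0 j) (chart_at x q).

Definition dch x h q : 'cV[R]_n := \col_i 'D_(b i) (h \o of_coord (chart_at x)) (chart_at x q).

Lemma derive_coordfun x x' q v : dom x q -> dom x' q ->
  'D_v (coordfun x x') (chart_at x q) = v *m Jac x x' q.
Proof.
move=> dx dx'; have df := coordfun_differentiable dx dx'.
apply/rowP => j; rewrite derive_rV_coord // derive_rVE; last exact: differentiable_rV_coord.
by rewrite mxE; apply: eq_bigr => i _; rewrite mxE.
Qed.

Lemma near_coordfun x x' h q : dom x q -> dom x' q ->
  \forall y \near chart_at x q,
    (h \o of_coord (chart_at x')) (coordfun x x' y) = (h \o of_coord (chart_at x)) y.
Proof.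
move=> dx dx'; have H := near_coord dx (near_dom dx').
by apply: filterS H => y dy; rewrite /= /coordfun to_coordK.
Qed.

Definition chart_diff x h q := differentiable (h \o of_coord (chart_at x)) (chart_at x q).

Lemma chart_diff_change x x' h q : dom x q -> dom x' q -> chart_diff x' h q -> chart_diff x h q.
Proof.
move=> dx dx' dh; apply: near_eq_differentiable (near_coordfun h dx dx') _.
apply: (@differentiable_comp _ _ _ _ (coordfun x x')).
  exact: coordfun_differentiable.
by rewrite /coordfun to_coordK.
Qed.

Lemma derive_change x x' h q v : dom x q -> dom x' q -> chart_diff x' h q ->
  'D_v (h \o of_coord (chart_at x)) (chart_at x q) =
  'D_(v *m Jac x x' q) (h \o of_coord (chart_at x')) (chart_at x' q).
Proof.
move=> dx dx' dh.
rewrite -(near_eq_derive v (near_coordfun h dx dx')).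
have e : coordfun x x' (chart_at x q) = chart_at x' q by rewrite /coordfun to_coordK.
rewrite (derive_compE _ (coordfun_differentiable dx dx')) ?e //.
by rewrite derive_coordfun.
Qed.

Lemma dch_pairE x h q v : chart_diff x h q ->
  'D_v (h \o of_coord (chart_at x)) (chart_at x q) = (v *m dch x h q) 0 0.
Proof.
by move=> dh; rewrite derive_rVE // mxE; apply: eq_bigr => i _; rewrite mxE.
Qed.

Lemma dch_change x x' h q : dom x q -> dom x' q -> chart_diff x' h q ->
  dch x h q = Jac x x' q *m dch x' h q.
Proof.
move=> dx dx' dh; apply/colP => i; rewrite mxE (derive_change _ dx dx' dh) dch_pairE //.
by rewrite -mulmxA -rowE !mxE.
Qed.

Lemma coord_chart_diff x x' q j : dom x q -> dom x' q -> chart_diff x (fun q => chart_at x' q 0 j) q.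
Proof.
move=> dx dx'; apply: smooth_on_differentiable (coordfun_smooth (x := x) (x' := x') j) _.
  exact/open_img/open_dom.
exact: img_in.
Qed.

Lemma dch_coord x x' q j : dch x (fun q => chart_at x' q 0 j) q = col j (Jac x x' q).
Proof. by apply/colP => i; rewrite !mxE. Qed.

Lemma Jac_id x q : dom x q -> Jac x x q = 1%:M.
Proof.
move=> dx; apply/matrixP => i j; rewrite !mxE.
have H : \forall y \near chart_at x q, coordfun x x y 0 j = y 0 j.
  by apply: filterS (near_cod dx) => y /codP[_]; rewrite /coordfun => ->.
rewrite (near_eq_derive _ H) -(derive_rV_coord (F := id)) ?derive_id ?mxE ?eqxx //.
by rewrite eq_sym.
Qed.

Lemma Jac_comp x x' x'' q : dom x q -> dom x' q -> dom x'' q ->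
  Jac x x' q *m Jac x' x'' q = Jac x x'' q.
Proof.
move=> dx dx' dx''; apply/matrixP => i j.
have := congr1 (fun M : 'cV_n => M i 0) (dch_change dx dx' (coord_chart_diff j dx' dx'')).
rewrite !dch_coord /= mxE => ->; rewrite !mxE; apply: eq_bigr => k _.
by rewrite !mxE.
Qed.

Lemma dfunE h q : dfun h q = dch q h q. Proof. by []. Qed.

Lemma from_chartE x q v : dom x q -> from_chart x q v = v *m Jac x q q.
Proof. by move=> dx; rewrite -derive_coordfun //; apply: chart_at_dom. Qed.

Lemma coord_covectorE x i q : coord_covector x i q = Jac q x q *m delta_mx i 0.
Proof. by rewrite /coord_covector dfunE dch_coord colE. Qed.

Lemma coord_vectorE x i q : dom x q -> coord_vector x i q = delta_mx 0 i *m Jac x q q.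
Proof. exact: from_chartE. Qed.

(** Smoothness read in a single chart. For an open [W] inside its domain it amounts to
    [smooth_fun W] ([smf_smooth_fun], [smooth_fun_smf]). *)
Definition smf x (W : set P) h := sm (img (chart_at x) W) (h \o of_coord (chart_at x)).

Lemma smf_change x x' (W : set P) h : open W -> W `<=` dom x -> smf x W h -> smf x' W h.
Proof.
move=> oW Wx sh.
apply: (@sm_ext _ _ _ ((h \o of_coord (chart_at x)) \o coordfun x' x)).
  by move=> y /imgP[Cy Wy]; rewrite /= /coordfun to_coordK //; apply: Wx.
apply: (sm_comp (W' := img (chart_at x) W)).
- exact: open_img.
- by apply: sm_smooth sh; apply: open_img.
- move=> j; apply: sm_base; apply: smooth_on_sub (coordfun_smooth (x := x') (x' := x) j).
  exact: img_mono.
- by move=> y /imgP[Cy Wy]; apply: img_in => //; apply: Wx.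
Qed.

Lemma smf_smooth_fun x (W : set P) h : open W -> W `<=` dom x -> smf x W h -> smooth_fun W h.
Proof.
move=> oW Wx sh x'; apply: sm_smooth; first exact: open_img.
exact: smf_change sh.
Qed.

Lemma smooth_fun_smf x (W : set P) h : smooth_fun W h -> smf x W h.
Proof. by move=> sh; apply: sm_base; apply: sh. Qed.

Lemma smf_sub x (W W' : set P) h : open W' -> W `<=` W' -> smf x W' h -> smf x W h.
Proof. by move=> oW' WW'; apply: sm_sub; [apply: open_img|apply: img_mono]. Qed.

Lemma smf_chart_diff x (W : set P) h q : open W -> W q -> dom x q -> smf x W h -> chart_diff x h q.
Proof.
by move=> oW Wq dq sh; apply: sm_differentiable sh _; [apply: open_img|apply: img_in].
Qed.

Lemma smf_partial x (W : set P) h i : open W -> smf x W h ->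
  smf x W (fun q => 'D_(b i) (h \o of_coord (chart_at x)) (chart_at x q)).
Proof.
move=> oW sh; apply: sm_ext (sm_partial i (open_img (x := x) oW) sh) => y /imgP[Cy _] /=.
by rewrite (codP Cy).2.
Qed.

Lemma smf_Jac x x' i j : smf x (dom x `&` dom x') (fun q => Jac x x' q i j).
Proof.
have o : open (dom x `&` dom x') by apply: openI; apply: open_dom.
apply: (sm_ext (g := (fun q => 'D_(b i) ((fun q => chart_at x' q 0 j) \o of_coord (chart_at x)) (chart_at x q)) \o of_coord (chart_at x))).
  by move=> y _; rewrite /= mxE.
apply: smf_partial => //; apply: sm_base.
apply: smooth_on_sub (coordfun_smooth (x := x) (x' := x') j).
by apply: img_mono => q [].
Qed.

End Manifold.

(** * Tensors in a chart *)

Section Representation.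
Context {R : realType} {n : nat} {P : manifold R n} (p : P).
Notation dom x := (chart_dom (chart_at (m := P) x)).
Notation b i := (delta_mx 0 i : 'rV[R]_n).

Definition chart_open : openset := OpenSet (@open_codom R n P (chart_at p)).
Local Notation K := (sfun chart_open).
Notation d := (@sfun_partial R n chart_open).
Implicit Types (q : P) (g : K).

Definition ev q g : R := g (chart_at p q).
Definition evm q {k l} (x : 'M[K]_(k, l)) : 'M[R]_(k, l) := map_mx (ev q) x.

Lemma cod_in q : dom p q -> oset chart_open (chart_at p q).
Proof. by move=> dq; exists q. Qed.

Section Eval.
Variables (q : P) (dq : dom p q).
Let yq := cod_in dq.

Lemma evD g h : ev q (g + h) = ev q g + ev q h. Proof. exact: sfunD. Qed.
Lemma evM g h : ev q (g * h) = ev q g * ev q h. Proof. exact: sfunM. Qed.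
Lemma evN g : ev q (- g) = - ev q g. Proof. exact: sfunN. Qed.
Lemma ev0 : ev q 0 = 0. Proof. exact: sfun0. Qed.
Lemma ev1 : ev q 1 = 1. Proof. exact: sfun1. Qed.
Lemma ev_cst a : ev q (sfun_cst chart_open a) = a. Proof. exact: sfun_cstE. Qed.
Lemma ev_sum (I : Type) (r : seq I) (F : I -> K) :
  ev q (\sum_(i <- r) F i) = \sum_(i <- r) ev q (F i).
Proof. exact: sfun_sum. Qed.

Lemma evm_lin k l g (x y : 'M[K]_(k, l)) : evm q (g *: x + y) = ev q g *: evm q x + evm q y.
Proof. by apply/matrixP => i j; rewrite !mxE evD evM. Qed.

Lemma evm_mul k l m (x : 'M[K]_(k, l)) (y : 'M[K]_(l, m)) : evm q (x *m y) = evm q x *m evm q y.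
Proof.
apply/matrixP => i j; rewrite !mxE ev_sum; apply: eq_bigr => a _.
by rewrite evM !mxE.
Qed.

Lemma evm_cov i : evm q (@cov K n i) = cov i.
Proof. by apply/colP => j; rewrite !mxE; case: (_ && _); rewrite ?ev1 ?ev0. Qed.

Lemma evm_vec i : evm q (@vec K n i) = vec i.
Proof. by apply/rowP => j; rewrite !mxE; case: (_ && _); rewrite ?ev1 ?ev0. Qed.

Lemma ev_bil Q (x y : 'cV[K]_n) : ev q (bil Q x y) = bil (evm q Q) (evm q x) (evm q y).
Proof.
rewrite ev_sum; apply: eq_bigr => i _; rewrite ev_sum; apply: eq_bigr => j _.
by rewrite !evM !mxE.
Qed.

Lemma ev_kpair (x : 'cV[K]_n) (v : 'rV[K]_n) : ev q (kpair x v) = kpair (evm q x) (evm q v).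
Proof. by rewrite !kpairE ev_sum; apply: eq_bigr => k _; rewrite evM !mxE. Qed.

Lemma ev_sign k : ev q ((-1) ^+ k) = (-1) ^+ k.
Proof. by elim: k => [|k IH]; rewrite ?expr0 ?ev1 // !exprS evM IH evN ev1. Qed.

(** Tensoriality: the coefficients of the difference of two arguments vanish at [q], and linearity
    over [K] takes them out of [T]. *)
Lemma ev_ext_cov (T : seq 'cV[K]_n -> K) (s s' : seq 'cV[K]_n) : multilin T ->
  map (evm q) s = map (evm q) s' -> ev q (T s) = ev q (T s').
Proof.
suff H l : multilin T -> map (evm q) s = map (evm q) s' -> ev q (T (l ++ s)) = ev q (T (l ++ s')).
  exact: (H [::]).
move=> mT; elim: s s' l => [|x s IH] [|x' s'] l //= [ex es].
rewrite -[x](subrK x') multilinD // evD -!cat_rcons (IH s' (rcons l x')) // [X in X + _](_ : _ = 0) ?add0r //.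
rewrite (col_covE (x - x')) cat_rcons multilin_sum // ev_sum big1 // => i _.
rewrite multilinZ // evM.
have -> : ev q ((x - x') i 0) = 0.
  have := congr1 (fun M : 'cV[R]_n => M i 0) ex; rewrite !mxE => e.
  by rewrite evD evN e subrr.
by rewrite mul0r.
Qed.

Lemma ev_ext_vec (T : seq 'rV[K]_n -> K) (s s' : seq 'rV[K]_n) : multilin T ->
  map (evm q) s = map (evm q) s' -> ev q (T s) = ev q (T s').
Proof.
suff H l : multilin T -> map (evm q) s = map (evm q) s' -> ev q (T (l ++ s)) = ev q (T (l ++ s')).
  exact: (H [::]).
move=> mT; elim: s s' l => [|x s IH] [|x' s'] l //= [ex es].
rewrite -[x](subrK x') multilinD // evD -!cat_rcons (IH s' (rcons l x')) // [X in X + _](_ : _ = 0) ?add0r //.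
rewrite (row_vecE (x - x')) cat_rcons multilin_sum // ev_sum big1 // => i _.
rewrite multilinZ // evM.
have -> : ev q ((x - x') 0 i) = 0.
  have := congr1 (fun M : 'rV[R]_n => M 0 i) ex; rewrite !mxE => e.
  by rewrite evD evN e subrr.
by rewrite mul0r.
Qed.

End Eval.

Definition cstm {k l} (x : 'M[R]_(k, l)) : 'M[K]_(k, l) := map_mx (sfun_cst chart_open) x.

Lemma evm_cst q k l (x : 'M[R]_(k, l)) : dom p q -> evm q (cstm x) = x.
Proof. by move=> dq; apply/matrixP => i j; rewrite !mxE ev_cst. Qed.

Lemma d_cst i a : d i (sfun_cst chart_open a) = 0.
Proof.
apply: sfun_eq => x Ox; rewrite sfun_partialE // sfun0.
rewrite (near_eq_derive _ (sfun_near_eq Ox (fun y Oy => sfun_cstE a Oy))).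
exact: derive_cst.
Qed.

Lemma const_cov_cst x : const_cov d (cstm x).
Proof. by move=> k; apply/colP => i; rewrite !mxE d_cst. Qed.

Lemma const_vec_cst x : const_vec d (cstm x).
Proof. by move=> k; apply/rowP => i; rewrite !mxE d_cst. Qed.

Lemma cstm_lin k l a (x y : 'M[R]_(k, l)) :
  cstm (a *: x + y) = sfun_cst chart_open a *: cstm x + cstm y.
Proof.
by apply/matrixP => i j; rewrite !mxE; apply: sfun_eq => z Oz; rewrite sfunD // sfunM // !sfun_cstE.
Qed.

Definition agree q (F : P -> R) g := \forall q' \near q, F q' = ev q' g.

Lemma agree_near q F g : agree q F g -> \forall q' \near q, agree q' F g.
Proof. by move=> H; apply: nbhs_interior H. Qed.

Lemma agree_at q F g : agree q F g -> F q = ev q g.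
Proof. exact: nbhs_singleton. Qed.

Lemma agree_coord q F g : dom p q -> agree q F g ->
  \forall y \near chart_at p q, (F \o of_coord (chart_at p)) y = g y.
Proof.
move=> dq H; apply: filterS2 (near_coord dq H) (near_cod dq) => y /= -> /codP[_ e].
by rewrite /ev e.
Qed.

Lemma agree_chart_diff q F g : dom p q -> agree q F g -> chart_diff p F q.
Proof.
move=> dq H; apply: near_eq_differentiable (sfun_differentiable g (cod_in dq)).
by apply: filterS (agree_coord dq H) => y /= ->.
Qed.

Lemma agree_dch q F g : dom p q -> agree q F g -> dch p F q = evm q (grad d g).
Proof.
move=> dq H; apply/colP => i; rewrite !mxE.
rewrite (near_eq_derive _ (agree_coord dq H)).
by rewrite /ev sfun_partialE //; apply: cod_in.
Qed.

(* From the coordinates in [chart_at p] to those in [chart_at q], which identify the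
   cotangent and tangent spaces at [q] with R^n. *)
Definition pull q : 'cV[R]_n -> 'cV[R]_n := mulmx (Jac q p q).
Definition push q : 'rV[R]_n -> 'rV[R]_n := mulmxr (Jac p q q).

Lemma agree_dfun q F g : dom p q -> agree q F g -> dfun F q = pull q (evm q (grad d g)).
Proof.
move=> dq H; rewrite dfunE (dch_change (x' := p)) //; last exact: agree_chart_diff H.
  by rewrite (agree_dch dq H).
exact: chart_at_dom.
Qed.

Lemma agree_derive q F g v : dom p q -> agree q F g ->
  'D_v (F \o of_coord (chart_at q)) (chart_at q q) = ev q (vec_act d (cstm (v *m Jac q p q)) g).
Proof.
move=> dq H; have qq := chart_at_dom q.
have cd := agree_chart_diff dq H.
rewrite dch_pairE; last exact: chart_diff_change cd.
rewrite (dch_change qq dq cd) mulmxA (agree_dch dq H) mxE /vec_act ev_sum //.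
by apply: eq_bigr => i _; rewrite evM // !mxE ev_cst.
Qed.

Lemma agree_exists q F (N : set P) : dom p q -> open N -> N q -> smf p N F ->
  exists g, agree q F g.
Proof.
move=> dq oN Nq sF.
have [g Hg] := sfun_extend (O := chart_open) (cod_in dq) (open_img (x := p) oN) (img_in (c := chart_at p) Nq dq) sF.
exists g; apply: filterS2 (near_point dq Hg) (near_dom dq) => q' e dq'.
by rewrite /ev e /= to_coordK.
Qed.

Lemma Jac_pq q : dom p q -> Jac p q q *m Jac q p q = 1%:M.
Proof. by move=> dq; rewrite Jac_comp // ?Jac_id //; apply: chart_at_dom. Qed.

Lemma Jac_qp q : dom p q -> Jac q p q *m Jac p q q = 1%:M.
Proof. by move=> dq; rewrite Jac_comp // ?Jac_id //; apply: chart_at_dom. Qed.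

Lemma kpair_pull_push q xi v : dom p q -> kpair (pull q xi) (push q v) = kpair xi v.
Proof. by move=> dq; rewrite /kpair /pull /push /= !mulmxA -(mulmxA v) Jac_pq // mulmx1. Qed.

Lemma pull_inj q : dom p q -> injective (pull q).
Proof.
move=> dq x y /(congr1 (mulmx (Jac p q q))).
by rewrite /pull !mulmxA Jac_pq // !mul1mx.
Qed.

Lemma pull_cov q i : pull q (cov i) = coord_covector p i q.
Proof. by rewrite coord_covectorE. Qed.

Lemma push_vec q i : dom p q -> push q (vec i) = coord_vector p i q.
Proof. by move=> dq; rewrite coord_vectorE. Qed.

Definition unpull q (xi : 'cV[R]_n) : 'cV[K]_n := cstm (Jac p q q *m xi).
Definition unpush q (v : 'rV[R]_n) : 'rV[K]_n := cstm (v *m Jac q p q).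

Lemma unpullK q xi : dom p q -> pull q (evm q (unpull q xi)) = xi.
Proof. by move=> dq; rewrite evm_cst // /pull mulmxA Jac_qp // mul1mx. Qed.

Lemma unpushK q v : dom p q -> push q (evm q (unpush q v)) = v.
Proof. by move=> dq; rewrite evm_cst // /push /= -mulmxA Jac_qp // mulmx1. Qed.

Lemma map_unpullK q s : dom p q -> map (pull q \o evm q) (map (unpull q) s) = s.
Proof. by move=> dq; rewrite -map_comp map_id_in // => x _ /=; rewrite unpullK. Qed.

Lemma map_unpushK q s : dom p q -> map (push q \o evm q) (map (unpush q) s) = s.
Proof. by move=> dq; rewrite -map_comp map_id_in // => x _ /=; rewrite unpushK. Qed.

(** [AK] is the expression of [A] in [chart_at p]. It is required at every [q] of the chart, in
    spite of the coordinates of [A q] being those of [chart_at q], so that differential operators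
    can be applied repeatedly. *)
Definition rep (A : P -> seq 'cV[R]_n -> R) (AK : seq 'cV[K]_n -> K) :=
  forall q, dom p q -> forall s, A q (map (pull q \o evm q) s) = ev q (AK s).

Definition rep_form (eta : P -> seq 'rV[R]_n -> R) (etaK : seq 'rV[K]_n -> K) :=
  forall q, dom p q -> forall s, eta q (map (push q \o evm q) s) = ev q (etaK s).

Lemma rep_alternating a A AK q : dom p q -> rep A AK ->
  multilin AK -> altern AK -> degree a AK -> Defs.alternating a (A q).
Proof.
move=> dq rA mA aA dA.
have E s : A q s = ev q (AK (map (unpull q) s)) by rewrite -rA // map_unpullK.
apply: alternatingP.
- by move=> s sz; rewrite E dA ?size_map // ev0.
- move=> s1 s2 k u v; rewrite !E !map_cat /= /unpull linearD linearZ /= cstm_lin mA.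
  by rewrite evD // evM // ev_cst.
- by move=> s1 u s2; rewrite E map_cat /= aA ev0.
Qed.

Lemma sm_multilin (W : set 'rV[R]_n) (T : 'rV[R]_n -> seq 'cV[R]_n -> R) (s : seq 'cV[K]_n) :
  open W -> W `<=` oset chart_open -> (forall y, W y -> multilin (T y)) ->
  (forall I, sm W (fun y => T y (map cov I))) ->
  sm W (fun y => T y (map (map_mx (fun g : K => g y)) s)).
Proof.
move=> oW WO mT sT.
suff H I : sm W (fun y => T y (map cov I ++ map (map_mx (fun g : K => g y)) s)) by apply: (H [::]).
elim: s I => [|x s IH] I; first by apply: sm_ext (sT I) => y _; rewrite cats0.
apply: (sm_ext (g := fun y => \sum_i (x i 0) y *
   T y (map cov (rcons I i) ++ map (map_mx (fun g : K => g y)) s))).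
  move=> y Wy /=; rewrite (col_covE (map_mx _ x)) multilin_sum //; last exact: mT.
  apply: eq_bigr => i _; rewrite multilinZ; last exact: mT.
  by rewrite mxE map_rcons cat_rcons.
apply: sm_sum => i; apply: sm_mul => //.
by apply: sm_sub (sm_sfun (x i 0)) => //; apply: oset_open.
Qed.

(** The values of [A] on covector fields are smooth functions, obtained by choice; an element of the
    ring is determined by its values on the chart, so the algebraic laws are inherited pointwise. *)
Lemma rep_exists a A : (forall q, dom p q -> Defs.alternating a (A q)) ->
  (forall l : seq 'I_n, smf p (dom p) (fun q => A q [seq coord_covector p i q | i <- l])) ->
  exists AK, [/\ rep A AK, multilin AK, altern AK & degree a AK].
Proof.
move=> aA sA.
have H (s : seq 'cV[K]_n) : exists g, forall q, dom p q -> ev q g = A q (map (pull q \o evm q) s).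
  have sg : sm (oset chart_open) (fun y => A (of_coord (chart_at p) y)
     (map (pull (of_coord (chart_at p) y)) (map (map_mx (fun g : K => g y)) s))).
    apply: (sm_multilin (T := fun y s => A (of_coord (chart_at p) y) (map (pull (of_coord (chart_at p) y)) s))) => //.
    - exact: oset_open.
    - move=> y /codP[dy _] s1 s2 k u v; rewrite !map_cat /= /pull linearD linearZ /=.
      exact: (alternating_multilin (aA _ dy)).
    - move=> I; have := sA I; rewrite /smf.
      have -> : img (chart_at p) (dom p) = oset chart_open by rewrite /img setIid.
      apply: sm_ext => y _ /=; rewrite -map_comp; congr (A _ _).
      by apply: eq_map => i /=; rewrite pull_cov.
  exists (mk_sfun sg) => q dq; rewrite /ev mk_sfunE; last exact: cod_in.
  by rewrite to_coordK // -map_comp.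
have [AK HAK] := choice H; exists AK; split.
- by move=> q dq s; rewrite HAK.
- move=> s1 s2 k u v; apply: sfun_eq => y Oy.
  have [dy e] := codP Oy; rewrite sfunD // sfunM // -e -!/(ev _ _) !HAK //.
  rewrite !map_cat /= evm_lin // /pull linearD linearZ /=.
  by rewrite (alternating_multilin (aA _ dy)).
- move=> s1 u s2; apply: sfun_eq => y Oy.
  have [dy e] := codP Oy; rewrite sfun0 -e -/(ev _ _) HAK // map_cat /=.
  exact: (alternating_altern (aA _ dy)).
- move=> s sz; apply: sfun_eq => y Oy.
  have [dy e] := codP Oy; rewrite sfun0 -e -/(ev _ _) HAK //.
  by apply: (alternating_degree (aA _ dy)); rewrite size_map.
Qed.

End Representation.

(** * The operators of Poisson geometry in a chart *)

Section ShuffleSums.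
Context {R : comPzRingType} {T : Type}.
Implicit Types (Phi : seq T -> seq T -> R) (s : seq T).

Lemma shufsum0 Phi s : shufsum 0 Phi s = Phi [::] s.
Proof. by elim: s Phi => [|x s IH] Phi; rewrite ?shufsum_nil // shufsum0_cons IH. Qed.

Lemma shufsum1 Phi s : (0 < size s)%N -> shufsum 1 Phi s = altsum (fun x l => Phi [:: x] l) s.
Proof.
elim: s Phi => [//|x s IH] Phi _; rewrite shufsumS_cons // shufsum0 /=; congr (_ + _).
case: s IH => [|y s] IH; first by rewrite oppr0.
by rewrite ltn0Sn IH // expr1 mulN1r.
Qed.

Lemma shufsum2 Phi s : (1 < size s)%N -> shufsum 2 Phi s = altsum2 (fun x y l => Phi [:: x; y] l) s.
Proof.
elim: s Phi => [//|x s IH] Phi /= ls; rewrite shufsumS_cons // shufsum1 //; congr (_ + _).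
case: ltnP => h; first by rewrite IH // sqrrN expr1n mul1r.
by case: s ls h IH => [//|y [|//]] _ _ _ /=; rewrite addr0.
Qed.

Lemma shufsum_full Phi s : shufsum (size s) Phi s = Phi s [::].
Proof.
elim: s Phi => [|x s IH] Phi /=; first exact: shufsum_nil.
by rewrite shufsumS_cons // IH ltnn addr0.
Qed.

Lemma shufsum_last a Phi s : size s = a.+1 ->
  shufsum a Phi s = (-1) ^+ a * altsum (fun x l => Phi l [:: x]) s.
Proof.
elim: s a Phi => [//|x s IH] [|a] Phi /= [sa].
  by rewrite shufsum0 (size0nil sa) /= subr0 mul1r.
rewrite shufsumS_cons ?sa // ltnSn (IH a) // -[in shufsum a.+1 _ s]sa shufsum_full.
by rewrite mulrBr addrC exprS mulN1r !mulNr opprK.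
Qed.

End ShuffleSums.

Section AltSumMap.
Context {K : comPzRingType} {V W : Type} (f : V -> W).

Lemma altsum_map (Psi : W -> seq W -> K) s :
  altsum Psi (map f s) = altsum (fun x l => Psi (f x) (map f l)) s.
Proof. by elim: s Psi => //= x s IH Psi; rewrite IH. Qed.

Lemma altsum2_map (Psi : W -> W -> seq W -> K) s :
  altsum2 Psi (map f s) = altsum2 (fun x y l => Psi (f x) (f y) (map f l)) s.
Proof. by elim: s Psi => //= x s IH Psi; rewrite IH altsum_map. Qed.

End AltSumMap.

Lemma altsum_degree (V : Type) (K : comPzRingType) a (Psi : V -> seq V -> K) :
  (forall x, degree a (Psi x)) -> degree a.+1 (altsum Psi).
Proof.
move=> H s sz; rewrite (@eq_altsum _ _ _ (fun _ _ => 0)) ?altsum0 // => x l sl.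
by apply: H; rewrite -eqSS sl.
Qed.

Lemma altsum2_degree (V : Type) (K : comPzRingType) a (Psi : V -> V -> seq V -> K) :
  (forall x y l, (size l).+1 != a -> Psi x y l = 0) -> degree a.+1 (altsum2 Psi).
Proof.
move=> H s; elim: s a Psi H => [//|x s IH] a Psi H /=; rewrite eqSS => sz.
rewrite (@eq_altsum _ _ _ (fun _ _ => 0)) ?altsum0 ?add0r; last first.
  by move=> y l sl; apply: H; rewrite sl.
case: a H sz => [|a] H sz.
  rewrite (@eq_altsum2 _ _ _ (fun _ _ _ => 0)) ?altsum2_0 // => y z l; exact: H.
by apply: (IH a) => // y z l sl; apply: H; rewrite /= eqSS.
Qed.

Lemma poisson_diff_degree (K : comPzRingType) n (d : 'I_n -> K -> K) (Pm : 'M[K]_n) a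
  (T : seq 'cV[K]_n -> K) : (forall k x y, d k (x + y) = d k x + d k y) ->
  degree a T -> degree a.+1 (poisson_diff d Pm T).
Proof.
move=> dD dT s sz; rewrite /poisson_diff /lr_d.
rewrite (altsum_degree (a := a)) // ?(altsum2_degree (a := a)) ?subrr //.
  by move=> x y l sl; apply: dT.
by move=> x l sl; rewrite dT // act0 //; apply: biv_actD.
Qed.

Section Schouten.
Context {R : realType} {n : nat} {P : manifold R n} (p : P).
Notation dom x := (chart_dom (chart_at (m := P) x)).
Local Notation K := (sfun (chart_open p)).
Notation d := (@sfun_partial R n (chart_open p)).

Lemma near_list (X : Type) (Q : X -> set P) (q : P) (L : seq X) : (forall x, \forall q' \near q, Q x q') ->
  \forall q' \near q, foldr (fun x acc => Q x q' /\ acc) True L.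
Proof.
move=> H; elim: L => [|x L IH]; first by apply: filterE.
by apply: filterS2 (H x) IH.
Qed.

Lemma on_funs_agree A AK (X : Type) (f : X -> P -> R) (fh : X -> K) (q : P) L :
  dom p q -> rep (p := p) A AK -> (forall x, agree q (f x) (fh x)) ->
  agree q (on_funs A (map f L)) (AK (map (grad d \o fh) L)).
Proof.
move=> dq rA ag.
have H := near_list L (fun x => agree_near (ag x)).
apply: filterS2 H (near_dom dq) => q' H dq'.
rewrite /on_funs -rA //; congr (A q' _).
elim: L H => //= x L IH [agx agL]; rewrite IH //; congr (_ :: _).
by rewrite (agree_dfun dq' agx).
Qed.

Lemma fun_with_diff_smf (q : P) (xi : 'cV[R]_n) : smf q (dom q) (fun_with_diff q xi).
Proof.
apply: (sm_ext (g := fun y => \sum_k y 0 k * xi k 0)).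
  by move=> y /imgP[/codP[_ e] _] /=; rewrite /fun_with_diff e /pair mxE.
by apply: sm_sum => k; apply: sm_mul; [exact: sm_coord|exact: sm_cst].
Qed.

Lemma dch_fun_with_diff (q q' : P) (xi : 'cV[R]_n) : dom q q' -> dch q (fun_with_diff q xi) q' = xi.
Proof.
move=> dq'; apply/colP => i; rewrite mxE.
have H : \forall y \near chart_at q q', (fun_with_diff q xi \o of_coord (chart_at q)) y
     = (\sum_k (xi k 0 \*: (fun y : 'rV[R]_n => y 0 k : R))) y.
  apply: filterS (near_cod dq') => y /codP[_ e] /=.
  rewrite /fun_with_diff e /pair mxE fct_sumE; apply: eq_bigr => k _.
  by rewrite mulrC.
have dc k : derivable (fun y : 'rV[R]_n => y 0 k : R) (chart_at q q') (delta_mx 0 i).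
  exact/diff_derivable/differentiable_coord.
rewrite (near_eq_derive _ H) derive_sum; last by move=> k; apply: derivableZ.
rewrite (bigD1 i) //= deriveZ // -(derive_rV_coord (F := id)) // derive_id mxE !eqxx.
rewrite big1 ?addr0; first by rewrite [_ *: _]mulr1.
move=> k ki; rewrite deriveZ // -(derive_rV_coord (F := id)) // derive_id mxE eqxx (negPf ki).
by rewrite scaler0.
Qed.

Lemma dfun_fun_with_diff (q : P) (xi : 'cV[R]_n) : dfun (fun_with_diff q xi) q = xi.
Proof. by rewrite dfunE dch_fun_with_diff //; apply: chart_at_dom. Qed.

Lemma fun_with_diff_agree (q : P) (xi : 'cV[R]_n) : dom p q -> exists g, agree (p := p) q (fun_with_diff q xi) g.
Proof.
move=> dq; apply: (agree_exists (N := dom q `&` dom p)) => //.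
- by apply: openI; apply: open_dom.
- by split => //; apply: chart_at_dom.
- apply: (smf_change (x := q)); [by apply: openI; apply: open_dom|by move=> z []|].
  by apply: smf_sub (fun_with_diff_smf q xi); [apply: open_dom|move=> z []].
Qed.

Lemma poisson_diff_closed (Pm : 'M[K]_n) T (s : seq 'cV[K]_n) : (forall i j, Pm i j = - Pm j i) ->
  (forall x, x \in s -> forall k l, d k (x l 0) = d l (x k 0)) ->
  poisson_diff d Pm T s = altsum (fun x l => bil Pm x (grad d (T l))) s
                   - altsum2 (fun x y l => T (grad d (bil Pm x y) :: l)) s.
Proof.
move=> PC cs; rewrite /poisson_diff /lr_d; congr (_ - _).
apply: eq_altsum2_in => x y l xs ys _.
rewrite biv_br_closed //; [exact: sfun_partialD|exact: sfun_partialM|exact: cs|exact: cs].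
Qed.

Definition biv_tensor (Pm : 'M[K]_n) (l : seq 'cV[K]_n) : K :=
  if l is [:: x; y] then bil Pm x y else 0.

Lemma schouten_shufsum a b' (A B : P -> seq 'cV[R]_n -> R) F q :
  schouten_on_funs a b' A B F q =
  if (size F).+1 == (a + b')%N then
    shufsum b' (fun l r => on_funs A (on_funs B l :: r) q) F
    - (-1) ^+ (a.+1 * b'.+1) * shufsum a (fun l r => on_funs B (on_funs A l :: r) q) F
  else 0.
Proof.
by [].
Qed.

(** On exact covectors the brackets inside [poisson_diff] are the differentials of Pi(x, y). The
    2-shuffles of the Schouten bracket give these terms, the a-shuffles those that differentiate
    values of [A]. *)
Lemma poisson_d_rep (w : P -> seq 'rV[R]_n -> R) (Pm : 'M[K]_n) a A AK :
  (forall i j, Pm i j = - Pm j i) -> rep (p := p) (poisson w) (biv_tensor Pm) ->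
  rep (p := p) A AK -> multilin AK -> altern AK -> degree a AK ->
  rep (p := p) (poisson_d w a A) (poisson_diff d Pm AK).
Proof.
move=> PC rP rA mA aA dA q dq s.
have dD := @sfun_partialD R n (chart_open p); have dM := @sfun_partialM R n (chart_open p).
set s0 := map _ s; rewrite /poisson_d /schouten schouten_shufsum !size_map addn2 eqSS.
case: eqVneq => [sz|ne]; last first.
  by rewrite oppr0 (poisson_diff_degree _ dD dA) ?ev0.
have [fh ag] := choice (fun xi => fun_with_diff_agree xi dq).
set F := map _ s0.
have sF : size F = a.+1 by rewrite !size_map.
have mQ := poisson_diff_multilin dD dM PC mA aA.
pose df := grad d \o fh.
(* By tensoriality the arguments may be replaced by the differentials of the functions used in
   [schouten], which have the same values at [q]. *)
have -> : ev q (poisson_diff d Pm AK s) = ev q (poisson_diff d Pm AK (map df s0)).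
  apply: ev_ext_cov => //; rewrite -!map_comp; apply: eq_map => x /=.
  apply: (pull_inj dq); rewrite -(agree_dfun dq (ag _)) dfun_fun_with_diff //.
rewrite poisson_diff_closed //; last first.
  by move=> x /mapP[xi _ ->] k l; rewrite !mxE sfun_partialC.
have agA L : agree q (on_funs A (map (fun_with_diff q) L)) (AK (map df L)).
  exact: on_funs_agree.
have agP L : agree q (on_funs (poisson w) (map (fun_with_diff q) L)) (biv_tensor Pm (map df L)).
  exact: on_funs_agree.
have dfE L : [seq dfun h q | h <- map (fun_with_diff q) L] = map (pull p q \o evm q) (map df L).
  by rewrite -!map_comp; apply: eq_map => xi /=; rewrite (agree_dfun dq (ag xi)).
rewrite (shufsum_last _ sF) [altsum _ F]altsum_map.
have E1 : altsum (fun xi l => on_funs (poisson w) [:: on_funs A (map (fun_with_diff q) l); fun_with_diff q xi] q) s0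
        = - ev q (altsum (fun x l => bil Pm x (grad d (AK l))) (map df s0)).
  rewrite altsum_map raddf_altsum; last by move=> g h; exact: evD.
  rewrite -altsumN; apply: eq_altsum => xi l _.
  rewrite /on_funs /= (agree_dfun dq (agA l)) (agree_dfun dq (ag xi)).
  apply: etrans (rP q dq [:: grad d (AK (map df l)); df xi]) _.
  by rewrite /= (bilC _ _ PC) evN.
rewrite [altsum _ s0]E1.
have E2 : shufsum 2 (fun l r => on_funs A (on_funs (poisson w) l :: r) q) F
    = ev q (altsum2 (fun x y l => AK (grad d (bil Pm x y) :: l)) (map df s0)).
  (* In degree 0, [A] receives at least one argument and vanishes, while a single covector contains
     no pair. *)
  case: a dA sz sF {E1} => [|a] dA sz sF.
    rewrite /shufsum big1; last first.
      move=> sg _; rewrite /on_funs.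
      by rewrite (alternating_degree (rep_alternating dq rA mA aA dA)) // mulr0.
    have : size (map df s0) = 1%N by rewrite !size_map sz.
    by case: (map df s0) => [//|x [|//]] _ /=; rewrite addr0 ev0.
  rewrite shufsum2 ?sF // [altsum2 _ F]altsum2_map [altsum2 _ (map df s0)]altsum2_map raddf_altsum2; last by move=> g h; exact: evD.
  apply: eq_altsum2 => xi eta l; rewrite /on_funs /= dfE.
  have := agree_dfun dq (agP [:: xi; eta]); rewrite /on_funs /= => ->.
  by rewrite -rA //= .
rewrite [shufsum 2 _ F]E2 evD // evN // opprB mulrN mulrN mulrA.
(* The first exponent is that of the bracket with a bivector; the second sign comes from
   [shufsum_last]. *)
have -> : (-1) ^+ (a.+1 * 3) * (-1) ^+ a = -1 :> R.
  rewrite -exprD -signr_odd; have -> : odd (a.+1 * 3 + a) by lia.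
  by rewrite expr1.
by rewrite mulN1r opprK.
Qed.

End Schouten.

Section FrameBracket.
Context {K : comPzRingType} {n : nat} (d : 'I_n -> K -> K).
Hypothesis dD : forall k a b, d k (a + b) = d k a + d k b.
Hypothesis dM : forall k a b, d k (a * b) = d k a * b + a * d k b.

Lemma vec_act_suml (I : finType) (X : I -> 'rV[K]_n) h :
  vec_act d (\sum_i X i) h = \sum_i vec_act d (X i) h.
Proof.
rewrite /vec_act exchange_big; apply: eq_bigr => k _.
by rewrite summxE mulr_suml.
Qed.

Lemma vec_act_mulmx (u v : 'rV[K]_n) J l : (forall k i, d k (v 0 i) = 0) ->
  vec_act d (u *m J) ((v *m J) 0 l) =
  \sum_i \sum_j u 0 i * v 0 j * vec_act d (row i J) (J j l).
Proof.
move=> cv; rewrite mulmx_sum_row vec_act_suml; apply: eq_bigr => i _.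
rewrite vec_actZ [in LHS]mxE /vec_act mulr_sumr.
under eq_bigr => k _ do rewrite (d_sum dD) mulr_sumr mulr_sumr.
rewrite exchange_big; apply: eq_bigr => j _; rewrite mulr_sumr; apply: eq_bigr => k _.
rewrite dM cv mul0r add0r; ring.
Qed.

End FrameBracket.

Section ExteriorDerivative.
Context {R : realType} {n : nat} {P : manifold R n} (p : P).
Notation dom x := (chart_dom (chart_at (m := P) x)).
Local Notation K := (sfun (chart_open p)).
Notation d := (@sfun_partial R n (chart_open p)).
Local Notation dD := (@sfun_partialD R n (chart_open p)).
Local Notation dM := (@sfun_partialM R n (chart_open p)).

Lemma Jac_agree (q : P) : dom p q ->
  exists JK : 'M[K]_n, forall i j, agree q (fun q' => Jac q p q' i j) (JK i j).
Proof.
move=> dq.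
have H (ij : 'I_n * 'I_n) : exists g, agree (p := p) q (fun q' => Jac q p q' ij.1 ij.2) g.
  apply: (agree_exists (N := dom q `&` dom p)) => //.
  - by apply: openI; apply: open_dom.
  - by split => //; apply: chart_at_dom.
  - apply: (smf_change (x := q)); [by apply: openI; apply: open_dom|by move=> z []|].
    exact: smf_Jac.
have [g Hg] := choice H; exists (\matrix_(i, j) g (i, j)) => i j.
rewrite mxE; exact: (Hg (i, j)).
Qed.

(* The extensions used by [ext_d] at [q] have coordinates [v *m Jac q p] in [chart_at p];
   by the symmetry of second derivatives their brackets vanish at [q]. *)
Lemma extd_rep (eta : P -> seq 'rV[R]_n -> R) etaK : multilin etaK -> altern etaK ->
  rep_form (p := p) eta etaK -> rep_form (p := p) (ext_d eta) (de_rham d etaK).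
Proof.
move=> mE aE rE q dq s; have [JK agJ] := Jac_agree dq.
have qq := chart_at_dom q.
set s0 := map _ s; pose X (v : 'rV[R]_n) : 'rV[K]_n := cstm p v *m JK.
have JE : \forall q' \near q, evm q' JK = Jac q p q'.
  have : \forall q' \near q, forall ij : 'I_n * 'I_n, Jac q p q' ij.1 ij.2 = ev q' (JK ij.1 ij.2).
    by refine (@filter_forall _ _ _ _ _ _) => ij; apply: agJ.
  by apply: filterS => q' H; apply/matrixP => i j; rewrite mxE (H (i, j)).
have XE v : \forall q' \near q, evm q' (X v) = v *m Jac q p q'.
  by apply: filterS2 JE (near_dom dq) => q' <- dq'; rewrite evm_mul // evm_cst.
have ag l : agree q (fun q' => eta q' [seq from_chart q q' v | v <- l]) (etaK (map X l)).
  have H := near_list l XE.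
  apply: filterS3 H (near_dom dq) (near_dom qq) => q' H dq' dqq'.
  rewrite -rE //; congr (eta q' _).
  elim: l H => //= v l IH [e H]; rewrite IH // e from_chartE // /push /= -mulmxA.
  by rewrite Jac_comp //; apply: chart_at_dom.
have XvE v : evm q (X v) = v *m Jac q p q by exact: nbhs_singleton (XE v).
have DE v g : ev q (vec_act d (cstm p (v *m Jac q p q)) g) = ev q (vec_act d (X v) g).
  rewrite /vec_act !ev_sum //; apply: eq_bigr => i _; rewrite !evM //; congr (_ * _).
  by have := congr1 (fun M : 'rV[R]_n => M 0 i) (XvE v); rewrite !mxE => ->; rewrite ev_cst.
have brX u v l : ev q (vec_act d (X u) (X v 0 l)) = ev q (vec_act d (X v) (X u 0 l)).
  have c0 (w : 'rV[R]_n) k i : d k (cstm p w 0 i) = 0 by rewrite mxE d_cst.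
  have rE' i : row i JK = X (delta_mx 0 i).
    by rewrite /X rowE; congr (_ *m _); apply/rowP => k; rewrite !mxE; apply: sfun_eq => z Oz;
       case: (_ && _); rewrite ?sfun_cstE ?sfun1 ?sfun0.
  (* The rows of [JK] extend the basis vectors at [q], so these are second derivatives of the
     transition map from [chart_at q] to [chart_at p]. *)
  have sy i j : ev q (vec_act d (row i JK) (JK j l)) = ev q (vec_act d (row j JK) (JK i l)).
    rewrite !rE' -!DE -(agree_derive _ dq (agJ _ _)) -(agree_derive _ dq (agJ _ _)).
    have DD a b : 'D_(delta_mx 0 a) ((fun q' => Jac q p q' b l) \o of_coord (chart_at q)) (chart_at q q)
        = 'D_(delta_mx 0 a) (fun y => 'D_(delta_mx 0 b) (fun z => coordfun q p z 0 l) y) (chart_at q q).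
      apply: near_eq_derive; apply: filterS (near_cod qq) => y /codP[_ e] /=.
      by rewrite mxE e.
    rewrite !DD; apply: (schwarz (W := img (chart_at q) (dom p))).
    - exact/open_img/open_dom.
    - exact: coordfun_smooth.
    - exact: img_in.
  have XE' a b : vec_act d (X a) (X b 0 l) = \sum_i \sum_j cstm p a 0 i * cstm p b 0 j * vec_act d (row i JK) (JK j l).
    by apply: (vec_act_mulmx dD dM) => k i; exact: c0.
  rewrite (XE' u v) (XE' v u) [X in _ = ev q X]exchange_big /= !(ev_sum dq).
  apply: eq_bigr => i _; rewrite !(ev_sum dq); apply: eq_bigr => j _.
  by rewrite !(evM dq) sy [X in X * _ = _]mulrC.
clearbody X.
have brX0 u v : evm q (vec_br d (X u) (X v)) = evm q (0 : 'rV[K]_n).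
  apply/rowP => k; rewrite [LHS]mxE [RHS]mxE [vec_br _ _ _ _ _]mxE [X in _ = ev q X]mxE.
  by rewrite evD // evN // brX subrr ev0.
have -> : ev q (de_rham d etaK s) = ev q (de_rham d etaK (map X s0)).
  apply: ev_ext_vec => //; first exact: de_rham_multilin dD dM _ mE aE.
  rewrite -!map_comp; apply: eq_map => x /=.
  by rewrite XvE /push /= -mulmxA Jac_pq // mulmx1.
rewrite /de_rham /lr_d evD // evN // (_ : ev q (altsum2 _ _) = 0) ?subr0; last first.
  rewrite altsum2_map raddf_altsum2; last by move=> g h; exact: evD.
  rewrite (@eq_altsum2 _ _ _ (fun _ _ _ => 0)) ?altsum2_0 // => u v l.
  rewrite (@ev_ext_vec _ _ _ p q dq _ _ (0 :: map X l)) //.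
    by rewrite (multilin0 [::] _ mE) ev0.
  by rewrite /= brX0.
rewrite altsum_map raddf_altsum; last by move=> g h; exact: evD.
rewrite /ext_d -(altsumE 0 (fun v l => 'D_v (fun y => eta (of_coord (chart_at q) y)
   [seq from_chart q (of_coord (chart_at q) y) v | v <- l]) (chart_at q q))).
apply: eq_altsum => v l _.
by rewrite -DE -(agree_derive _ dq (ag l)).
Qed.

End ExteriorDerivative.

Section Curl.
Context {R : realType} {n : nat} {P : manifold R n} (p : P).
Notation dom x := (chart_dom (chart_at (m := P) x)).
Local Notation K := (sfun (chart_open p)).
Notation d := (@sfun_partial R n (chart_open p)).
Local Notation dD := (@sfun_partialD R n (chart_open p)).
Local Notation dM := (@sfun_partialM R n (chart_open p)).

Lemma ev_wdet (q : P) (X : seq 'rV[K]_n) (l : seq 'cV[K]_n) : dom p q ->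
  ev q (wdet kpair X l) = wdet kpair (map (evm q) X) (map (evm q) l).
Proof.
move=> dq; elim: l X => [|xi l IH] X /=.
  by rewrite size_map; case: eqP => _; rewrite ?ev1 ?ev0.
rewrite raddf_altsum; last by move=> g h; exact: evD.
by rewrite altsum_map; apply: eq_altsum => x X' _; rewrite evM // ev_kpair // IH.
Qed.

Lemma evm_std_cov q : dom p q -> map (evm q) (std (@cov K n)) = std cov.
Proof. by move=> dq; rewrite -map_comp; apply: eq_map => i /=; rewrite evm_cov. Qed.

Lemma vol_flat_rep (nu : P -> seq 'rV[R]_n -> R) rho a A AK :
  (forall q, dom p q -> Defs.alternating n (nu q)) ->
  (forall q, dom p q -> nu q (map (push p q) (std vec)) = ev q rho) ->
  rep (p := p) A AK -> multilin AK -> altern AK -> degree a AK ->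
  rep_form (p := p) (vol_flat nu A) (vol rho AK).
Proof.
move=> anu rnu rA mA aA dA q dq s; rewrite /vol_flat map_comp.
rewrite (interior_vec_frame _ (Jac_pq dq) (anu q dq) (rep_alternating dq rA mA aA dA)).
rewrite /vol evM // (rnu q dq); congr (_ * _).
rewrite morph_rwedge; [|by move=> *; rewrite evD|by move=> *; rewrite evM|by rewrite ev1].
rewrite -(evm_std_cov dq) rwedge_map; apply: eq_rwedge => l /=; last by rewrite ev_wdet.
by rewrite -rA // map_comp.
Qed.

(** The way back from [rep], which supplies the witness for the choice made in [vol_sharp]. *)
Definition realize (AK : seq 'cV[K]_n -> K) (q : P) (s : seq 'cV[R]_n) : R :=
  ev q (AK (map (unpull p q) s)).

Lemma realize_rep AK : multilin AK -> rep (p := p) (realize AK) AK.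
Proof.
move=> mA q dq s; apply: ev_ext_cov => //; rewrite -!map_comp; apply: eq_map => x /=.
by rewrite evm_cst // /pull mulmxA Jac_pq // mul1mx.
Qed.

Lemma interior_vec_inj a (nu : seq 'rV[R]_n -> R) B B' : Defs.alternating n nu ->
  nu (std vec) != 0 -> Defs.alternating a B -> Defs.alternating a B' ->
  interior_vec B nu = interior_vec B' nu -> B = B'.
Proof.
move=> anu nz aB aB' E; apply/funext => l; apply/eqP; rewrite -subr_eq0; apply/eqP.
apply: (@interior_inj _ _ _ cov (fun i x => x i 0) (@col_covE R n) _ kpair vec
  (@kpair_linl R n) kpair_dual a (fun l => B l - B' l)).
- move=> s1 s2 k u v; rewrite (alternating_multilin aB) (alternating_multilin aB'); ring.
- by move=> s1 u s2; rewrite (alternating_altern aB) (alternating_altern aB') subrr.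
- by move=> s sz; rewrite (alternating_degree aB) // (alternating_degree aB') // subrr.
- move=> s; have := congr1 (fun f => f s) E; have dn := alternating_degree anu.
  rewrite !interior_vecE // => /(mulfI nz) E'.
  rewrite (@eq_rwedge _ _ _ (fun l => B l + (-1) * B' l) _ (wdet kpair s)) //; last first.
    by move=> t; rewrite mulN1r.
  by rewrite rwedgeDl rwedgeZl E' mulN1r subrr.
Qed.

(** [vol_sharp] is a choice. By [de_rham_vol] the realized divergence satisfies the equation that
    defines it, and [interior_vec_inj] makes the solution unique. *)
Lemma curl_rep (nu : P -> seq 'rV[R]_n -> R) rho (lam : 'cV[K]_n) a A AK :
  (forall q, dom p q -> Defs.alternating n (nu q)) ->
  (forall q, dom p q -> nu q (map (push p q) (std vec)) = ev q rho) ->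
  (forall q, dom p q -> ev q rho != 0) -> (forall k, d k rho = rho * lam k 0) ->
  rep (p := p) A AK -> multilin AK -> altern AK -> degree a AK ->
  rep (p := p) (curl nu a A) (div_right d lam AK).
Proof.
move=> anu rnu nz drho rA mA aA; case: a => [|a] dA.
  by move=> q dq s /=; rewrite (div_right_degree0 dD) ?ev0.
have rF := vol_flat_rep anu rnu rA mA aA dA.
have rE := extd_rep (vol_multilin _ _) (vol_altern _ _) rF.
set DK := div_right d lam AK.
have mDK : multilin DK := div_right_multilin dD dM lam mA.
have aDK : altern DK := div_right_altern dD lam mA aA.
have dDK : degree a DK := div_right_degree dD lam dA.
have rR := realize_rep mDK.
suff E q : dom p q -> curl nu a.+1 A q = realize DK q by move=> q dq s; rewrite E // rR.
move=> dq; have aR := rep_alternating dq rR mDK aDK dDK.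
have nzq : nu q (std vec) != 0.
  have := nz q dq; rewrite -rnu // (altern_top_vec (Jac p q q) (alternating_multilin (anu q dq)) (alternating_altern (anu q dq))).
  by rewrite mulf_eq0 negb_or => /andP[].
have HR : interior_vec (realize DK q) (nu q) = ext_d (vol_flat nu A) q.
  apply/funext => s; rewrite -(map_unpushK s dq) rE // (de_rham_vol dD dM _ mA aA drho).
  exact: (vol_flat_rep anu rnu rR mDK aDK dDK).
rewrite /= /vol_sharp; set S := [set B | _].
have /= [aX eX] : S (xget (fun=> 0) S) by apply: (@xgetPex _ _ S); exists (realize DK q).
by apply: (interior_vec_inj (anu q dq) nzq aX aR); rewrite eX HR.
Qed.

End Curl.

Lemma multilin2E (K : comPzRingType) n (T : seq 'rV[K]_n -> K) x y : multilin T ->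
  T [:: x; y] = (x *m (\matrix_(i, j) T [:: vec i; vec j]) *m y^T) 0 0.
Proof.
move=> mT; rewrite [in LHS](row_vecE x) [in LHS](row_vecE y).
rewrite (@multilin_sum _ _ _ [::]) // -mulmxA mxE; apply: eq_bigr => i _.
rewrite (@multilinZ _ _ _ [::]) //; congr (_ * _).
rewrite (@multilin_sum _ _ _ [:: _]) // mxE; apply: eq_bigr => j _.
by rewrite (@multilinZ _ _ _ [:: _]) // !mxE mulrC.
Qed.

Section PointwiseSymplectic.
Context {R : realType} {n : nat} (w : seq 'rV[R]_n -> R).
Hypothesis aw : Defs.alternating 2 w.
Hypothesis nw : forall v, (forall u, w [:: v; u] = 0) -> v = 0.

Lemma kpair_flat v u : kpair (flat_at w v) u = w [:: v; u].
Proof.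
rewrite kpairE [in RHS](row_vecE u) (@multilin_sum _ _ _ [:: v]); last exact: alternating_multilin aw.
apply: eq_bigr => i _; rewrite (@multilinZ _ _ _ [:: v]) ?mxE //; exact: alternating_multilin aw.
Qed.

Lemma sharp_at_eq xi v : (forall u, w [:: v; u] = kpair xi u) -> sharp_at w xi = v.
Proof.
move=> H; rewrite /sharp_at; set S := [set _ | _].
have Sv : S v by rewrite /S /=; apply/colP => i; rewrite mxE H kpairE (bigD1 i) //= mxE !eqxx mul1r
  big1 ?addr0 // => j ji; rewrite mxE (negPf ji) andbF mul0r.
have : S (xget 0 S) by apply: (@xgetPex _ _ S); exists v.
move=> /= E; apply/eqP; rewrite -subr_eq0; apply/eqP/nw => u.
rewrite (@multilinB _ _ _ [::]); last exact: alternating_multilin aw.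
by rewrite -!kpair_flat E Sv subrr.
Qed.

Lemma w_skew u v : w [:: u; v] = - w [:: v; u].
Proof.
exact: (multilin_skew (alternating_multilin aw) (alternating_altern aw) [::]).
Qed.

End PointwiseSymplectic.

Section SymplecticLocal.
Context {R : realType} {n : nat} {P : manifold R n} (p : P).
Notation dom x := (chart_dom (chart_at (m := P) x)).
Local Notation K := (sfun (chart_open p)).
Notation d := (@sfun_partial R n (chart_open p)).
Local Notation dD := (@sfun_partialD R n (chart_open p)).
Local Notation dM := (@sfun_partialM R n (chart_open p)).
Local Notation dC := (@sfun_partialC R n (chart_open p)).
Local Notation half := (sfun_cst (chart_open p) 2^-1).

Lemma ev_eq (g h : K) : (forall q, dom p q -> ev q g = ev q h) -> g = h.
Proof. by move=> H; apply: sfun_eq => y /codP[dq <-]; exact: H. Qed.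

Lemma ev_det q (W : 'M[K]_n) : dom p q -> ev q (\det W) = \det (evm q W).
Proof.
move=> dq; rewrite /determinant ev_sum //; apply: eq_bigr => sg _.
rewrite evM // ev_sign //; congr (_ * _).
rewrite (big_morph (ev q) (fun g h => evM dq g h) (ev1 dq)).
by apply: eq_bigr => i _; rewrite mxE.
Qed.

Lemma ev_two_form q (W : 'M[K]_n) s : dom p q ->
  ev q (two_form W s) = two_form (evm q W) (map (evm q) s).
Proof.
move=> dq; case: s => [|x [|y [|z s]]] /=; rewrite ?ev0 //.
have -> : (evm q x *m evm q W *m (evm q y)^T) = evm q (x *m W *m y^T).
  by rewrite !evm_mul //; congr (_ *m _); apply/matrixP => i j; rewrite !mxE.
by rewrite [RHS]mxE.
Qed.

Lemma ev_form_pow q (W : 'M[K]_n) m s : dom p q ->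
  ev q (form_pow W m s) = form_pow (evm q W) m (map (evm q) s).
Proof.
move=> dq; elim: m s => [|m IH] s.
  by rewrite /form_pow /= /form1_unit size_map; case: eqP => _; rewrite ?ev1 ?ev0.
rewrite /form_pow !iterS -!/(form_pow _ _) rwedge_map.
rewrite morph_rwedge; [|by move=> *; rewrite evD|by move=> *; rewrite evM|by rewrite ev1].
by apply: eq_rwedge => l /=; [exact: ev_two_form|exact: IH].
Qed.

Lemma rep_form_pow (w : P -> seq 'rV[R]_n -> R) (W : 'M[K]_n) m :
  rep_form (p := p) w (two_form W) ->
  rep_form (p := p) (fun q => iter m (wedge (w q)) (wedge_covectors [::])) (form_pow W m).
Proof.
move=> rw q dq; elim: m => [|m IH] s.
  rewrite /= wedge_covectorsE /form_pow /= /form1_unit size_map.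
  by case: eqP => _; rewrite ?ev1 ?ev0.
rewrite iterS wedge_rwedge rwedge_map /form_pow iterS -/(form_pow _ _).
rewrite morph_rwedge; [|by move=> *; rewrite evD|by move=> *; rewrite evM|by rewrite ev1].
by apply: eq_rwedge => l /=; [exact: rw|exact: IH].
Qed.

Lemma rep_form_alternating a eta etaK q : dom p q -> rep_form (p := p) eta etaK ->
  multilin etaK -> altern etaK -> degree a etaK -> Defs.alternating a (eta q).
Proof.
move=> dq rA mA aA dA.
have E s : eta q s = ev q (etaK (map (unpush p q) s)) by rewrite -rA // map_unpushK.
apply: alternatingP.
- by move=> s sz; rewrite E dA ?size_map // ev0.
- move=> s1 s2 k u v; rewrite !E !map_cat /= /unpush mulmxDl -scalemxAl cstm_lin mA.
  by rewrite evD // evM // ev_cst.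
- by move=> s1 u s2; rewrite E map_cat /= aA ev0.
Qed.

Lemma sfun_of (h : P -> R) : smf p (dom p) h -> exists g : K, forall q, dom p q -> ev q g = h q.
Proof.
move=> sh; have sg : sm (oset (chart_open p)) (h \o of_coord (chart_at p)).
  by move: sh; rewrite /smf /img setIid.
exists (mk_sfun sg) => q dq; rewrite /ev mk_sfunE; last exact: cod_in.
by rewrite /= to_coordK.
Qed.

Lemma two_form_exists (w : P -> seq 'rV[R]_n -> R) : smooth_form 2 setT w ->
  exists W : 'M[K]_n, rep_form (p := p) w (two_form W).
Proof.
move=> [aw sw].
have H (ij : 'I_n * 'I_n) : exists g : K, forall q, dom p q ->
    ev q g = w q [seq coord_vector p i q | i <- [:: ij.1; ij.2]].
  by apply: sfun_of; apply: smooth_fun_smf; have := sw p [:: ij.1; ij.2]; rewrite setTI.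
have [g Hg] := choice H; exists (\matrix_(i, j) g (i, j)) => q dq s.
have aq := aw q I; have mq := alternating_multilin aq.
have [sz|ne] := eqVneq (size s) 2%N; last first.
  by rewrite two_form_degree // ev0 (alternating_degree aq) // size_map.
rewrite ev_two_form // map_comp.
case: s sz => [|x [|y []]] //= _.
pose T s := w q (map (push p q) s).
have mT : multilin T.
  by move=> s1 s2 k u v; rewrite /T !map_cat /= /push linearD linearZ mq.
have := multilin2E (evm q x) (evm q y) mT; rewrite {1}/T /= => ->.
congr ((_ *m _ *m _) _ _); apply/matrixP => i j; rewrite !mxE Hg //= /T /=.
by rewrite !push_vec.
Qed.

Lemma symplectic_local (w : P -> seq 'rV[R]_n -> R) : symplectic w ->
  exists W G : 'M[K]_n,
   [/\ rep_form (p := p) w (two_form W) /\ rep (p := p) (poisson w) (biv_tensor G^T),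
    (forall i j, W i j = - W j i) /\ (forall i j, G i j = - G j i),
    W *m G = 1%:M /\ G *m W = 1%:M,
    (forall i j k, d i (W j k) + d j (W k i) + d k (W i j) = 0)
    & forall q, dom p q -> evm q W \in unitmx].
Proof.
move=> [sw cw nw]; have [W rW] := two_form_exists sw; have aw q := sw.1 q I.
have Wvec (i j : 'I_n) : two_form W [:: vec i; vec j] = W i j.
  by rewrite /= /vec -rowE trmx_delta -colE !mxE.
have WC i j : W i j = - W j i.
  apply: ev_eq => q dq; rewrite -!Wvec evN // -!rW //=.
  exact: (w_skew (aw q)).
have WU q : dom p q -> evm q W \in unitmx.
  move=> dq; rewrite -row_free_unit -kermx_eq0; apply/rowV0P => v /sub_kermxP vW.
  have : push p q v = 0.
    apply: (nw q) => u; have := rW q dq [:: cstm p v; unpush p q u].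
    rewrite ev_two_form //= unpushK // !evm_cst // => ->.
    by rewrite vW mul0mx mxE.
  by move=> /(congr1 (mulmxr (Jac q p q))); rewrite /push /= -mulmxA Jac_pq // mulmx1 mul0mx.
have [dI dE] : exists g, \det W * g = 1.
  apply: sfun_inv => y /codP[dq <-]; rewrite -/(ev _ _) ev_det //.
  by have := WU _ dq; rewrite unitmxE unitfE.
(* [K] is not a field, but the determinant of [W] has no zero on the chart and is therefore
   invertible in [K]. *)
pose G := dI *: \adj W.
have WG : W *m G = 1%:M by rewrite -scalemxAr mul_mx_adj scale_scalar_mx mulrC dE.
have GW : G *m W = 1%:M by rewrite -scalemxAl mul_adj_mx scale_scalar_mx mulrC dE.
have trW : W^T = - W by apply/matrixP => i j; rewrite mxE WC [in RHS]mxE.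
have trG : G^T = - G.
  have E : W *m G^T = - 1%:M.
    by rewrite -[W]opprK -trW mulNmx -trmx_mul GW trmx1.
  by rewrite -[LHS]mul1mx -GW -mulmxA E mulmxN mulmx1.
have GC i j : G i j = - G j i.
  have := congr1 (fun M : 'M[K]_n => M j i) trG; rewrite mxE => ->; by rewrite mxE.
exists W, G; split => //.
- split=> // q dq s; case: s => [|be [|al [|z s]]] /=; rewrite ?ev0 //.
  (* Contracting omega with al^T G gives al^T G W = al^T. So be(sharp al) = al^T G be, which
     explains the transpose in the matrix of Pi. *)
  have -> : sharp_at (w q) (pull p q (evm q al)) = push p q (evm q (al^T *m G)).
    apply: (sharp_at_eq (aw q) (nw q)) => u; rewrite -[in RHS](unpushK (p := p) u dq).
    rewrite kpair_pull_push // -ev_kpair //.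
    have := rW q dq [:: al^T *m G; unpush p q u]; rewrite /= unpushK // => ->.
    rewrite -(mulmxA al^T) GW mulmx1 /kpair; congr (ev q _).
    by rewrite [LHS]mxE [RHS]mxE; apply: eq_bigr => i _; rewrite !mxE mulrC.
  rewrite -[pair _ _]/(kpair _ _) kpair_pull_push // -ev_kpair //; congr (ev q _).
  rewrite kpairE /bil; apply: eq_bigr => i _; rewrite mxE mulr_suml; apply: eq_bigr => j _.
  by rewrite !mxE; ring.
- move=> i j k; apply: ev_eq => q dq; rewrite ev0.
  have mW := @two_form_multilin _ _ W.
  have aW : altern (two_form W) := two_form_altern (skew_quadratic (@sfun_half _ _ _) WC).
  have := extd_rep mW aW rW dq [:: vec i; vec j; vec k]; rewrite cw => E.
  rewrite [RHS]E de_rham_const //; last first.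
    move=> x; rewrite !inE => /or3P[] /eqP->; exact: const_vec_vec dD dM _.
  congr (ev q _); rewrite /=.
  have va a h : vec_act d (vec a) h = d a h.
    rewrite /vec_act (bigD1 a) //= big1 ?addr0; first by rewrite mxE !eqxx mul1r.
    by move=> b ba; rewrite mxE (negPf ba) andbF mul0r.
  have Wvec' a b : (vec a *m W *m (vec b)^T) 0 0 = W a b by rewrite -[RHS]Wvec.
  rewrite !va !Wvec' (WC i k) (dN dD); ring.
Qed.

End SymplecticLocal.

Section LogDerivative.
Context {R : realType} {n : nat}.
Implicit Types (F : 'rV[R]_n -> R) (x v : 'rV[R]_n).

Lemma derive_ln F x v : differentiable F x -> 0 < F x ->
  'D_v (@ln R \o F) x = (F x)^-1 * 'D_v F x.
Proof.
move=> dF F0; have dl := is_derive1_ln F0.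
have dln : differentiable (@ln R) (F x) by apply/derivable1_diffP; apply: ex_derive.
rewrite deriveE; last exact: differentiable_comp.
rewrite diff_comp //= deriveE // diff1E; last by apply/derivable1_diffP.
by rewrite derive1E (@derive_val _ _ _ _ _ _ _ dl) [LHS]mulrC.
Qed.

Lemma derive_ln_abs F x v : differentiable F x -> F x != 0 ->
  'D_v (fun y => ln `|F y|) x = (F x)^-1 * 'D_v F x.
Proof.
move=> dF; have cF : F y @[y --> x] --> F x := differentiable_continuous dF.
rewrite neq_lt => /orP[F0|F0].
  have H : \forall y \near x, (fun y => ln `|F y|) y = (@ln R \o (- F)) y.
    have : \forall y \near x, F y < 0 by have := @cvgr_lt _ _ _ _ _ _ cF; apply.
    by apply: filterS => y Fy; rewrite /= ltr0_norm.
  rewrite (near_eq_derive _ H) derive_ln; [|exact: differentiableN|by rewrite oppr_gt0].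
  rewrite deriveN; last exact: diff_derivable.
  by rewrite invrN mulrNN.
have H : \forall y \near x, (fun y => ln `|F y|) y = (@ln R \o F) y.
  have : \forall y \near x, 0 < F y by have := @cvgr_gt _ _ _ _ _ _ cF; apply.
  by apply: filterS => y Fy; rewrite /= gtr0_norm.
by rewrite (near_eq_derive _ H) derive_ln.
Qed.

End LogDerivative.

Section DlogManifold.
Context {R : realType} {n : nat} {P : manifold R n}.
Notation dom x := (chart_dom (chart_at (m := P) x)).

Lemma smooth_chart_diff (h : P -> R) x q : smooth_fun setT h -> dom x q -> chart_diff x h q.
Proof.
by move=> sh dq; apply: (smf_chart_diff (@openT _) _ dq (smooth_fun_smf x sh)).
Qed.

Lemma dfun_log (f : P -> R) q : smooth_fun setT f -> f q != 0 ->
  dfun (fun q => ln `|f q|) q = (f q)^-1 *: dfun f q.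
Proof.
move=> sf f0; have qq := chart_at_dom q; apply/colP => i; rewrite !mxE.
have := derive_ln_abs (F := f \o of_coord (chart_at q)) (x := chart_at q q) (delta_mx 0 i)
  (smooth_chart_diff sf qq).
by rewrite /= to_coordK // => ->.
Qed.

Lemma dfun_fun_with_diff_near p q xi : dom p q -> dfun (fun_with_diff p xi) q = pull p q xi.
Proof.
move=> dq; rewrite dfunE (dch_change (chart_at_dom q) dq) ?dch_fun_with_diff //.
exact: (smf_chart_diff (open_dom _) dq dq (fun_with_diff_smf p xi)).
Qed.

Lemma pull_id p : pull (P := P) p p = id.
Proof. by apply/funext => xi; rewrite /pull Jac_id ?mul1mx //; apply: chart_at_dom. Qed.

End DlogManifold.

Lemma map_set_nth (T T' : Type) (g : T -> T') x0 y0 s i y : (i < size s)%N ->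
  map g (set_nth x0 s i y) = set_nth y0 (map g s) i (g y).
Proof. by elim: s i => [//|x s IH] [|i] //= si; rewrite IH. Qed.

(** * The modular operator as a Lie derivative *)

Section ModularLie.
Context {R : realType} {n : nat} {P : manifold R n} (p : P).
Notation dom x := (chart_dom (chart_at (m := P) x)).
Local Notation K := (sfun (chart_open p)).
Notation d := (@sfun_partial R n (chart_open p)).
Local Notation dD := (@sfun_partialD R n (chart_open p)).
Local Notation dM := (@sfun_partialM R n (chart_open p)).
Local Notation dC := (@sfun_partialC R n (chart_open p)).
Local Notation half := (sfun_cst (chart_open p) 2^-1).
Variables (w : P -> seq 'rV[R]_n -> R) (m : nat) (f : P -> R).
Hypotheses (w_symplectic : symplectic w) (mn : (m + m)%N = n).
Hypotheses (f_smooth : smooth_fun setT f) (f_neq0 : forall q, f q != 0).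

Let nu q s := f q * liouville_form m w q s.
Let phi q := ln `|f q|.

(** [mu] is f^-1 df, formed inside [K]. Its closedness follows from d_k d_l f = f mu_k mu_l + f d_k
    mu_l after cancelling the symmetric term and dividing by f. *)
Lemma dlog_rep : exists (fK : K) (mu : 'cV[K]_n),
  [/\ (forall q, dom p q -> ev q fK = f q), (forall k, d k fK = fK * mu k 0),
    (forall k l, d k (mu l 0) = d l (mu k 0))
    & forall q, dom p q -> dfun phi q = pull p q (evm q mu)].
Proof.
have [fK fKE] : exists g : K, forall q, dom p q -> ev q g = f q.
  apply: sfun_of; apply: smf_sub (smooth_fun_smf p f_smooth) => //; exact: openT.
have [fI fIE] : exists g, fK * g = 1.
  by apply: sfun_inv => y /codP[dq <-]; rewrite -/(ev _ _) fKE.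
pose mu : 'cV[K]_n := fI *: grad d fK.
have dmu k : d k fK = fK * mu k 0 by rewrite !mxE mulrA fIE mul1r.
exists fK, mu; split => //.
- move=> k l; have E : fK * d k (mu l 0) = fK * d l (mu k 0).
    have H a b : d a (d b fK) = fK * mu a 0 * mu b 0 + fK * d a (mu b 0).
      by rewrite dmu dM dmu.
    have := dC k l fK; rewrite !H mulrAC => /addrI //.
  have := congr1 ( *%R fI) E; rewrite !(mulrA fI fK) [fI * fK]mulrC fIE.
  by rewrite !mul1r.
- move=> q dq; rewrite dfun_log // -fKE //.
  have -> : dfun f q = pull p q (evm q (grad d fK)).
    apply: (agree_dfun dq); apply: filterS (near_dom dq) => q' dq'; by rewrite fKE.
  have -> : evm q mu = (ev q fK)^-1 *: evm q (grad d fK).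
    apply/colP => i; rewrite !mxE evM //; congr (_ * _).
    apply: (mulfI (x := ev q fK)); first by rewrite fKE.
    by rewrite -evM // fIE ev1 // mulfV // fKE.
  by rewrite /pull linearZ.
Qed.

(** The density of nu is f times the Liouville density, so [lam] is the sum of two logarithmic
    gradients. The Liouville part has zero modular field by [liouville_unimodular], which leaves
    Pi(mu, x). *)
Lemma modular_data : exists (G : 'M[K]_n) (rho : K) (lam mu : 'cV[K]_n),
  [/\ rep (p := p) (poisson w) (biv_tensor G^T) /\ (forall i j, G^T i j = - G^T j i),
    (forall q, dom p q -> Defs.alternating n (nu q)) /\
    (forall q, dom p q -> nu q (map (push p q) (std vec)) = ev q rho),
    (forall q, dom p q -> ev q rho != 0) /\ (forall k, d k rho = rho * lam k 0),
    (forall k l, d k (lam l 0) = d l (lam k 0)) /\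
    (forall x, modular_covec d G^T lam x = bil G^T mu x)
    & forall q, dom p q -> dfun phi q = pull p q (evm q mu)].
Proof.
have [W [G [[rW rG] [WC GC] [WG GW] W_closed WU]]] := symplectic_local p w_symplectic.
have GTC i j : G^T i j = - G^T j i by rewrite !mxE GC.
have [fK [mu [fKE dmu muC muE]]] := dlog_rep.
have W0 := skew_quadratic (@sfun_half R n (chart_open p)) WC.
pose fp : K := form_pow W m (std vec); pose c : K := sfun_cst (chart_open p) (m`!%:R^-1).
pose rho := fK * (c * fp).
pose lam := liouville_covec d half W G + mu.
pose nuK s := fK * (c * form_pow W m s).
have rnu : rep_form (p := p) nu nuK.
  move=> q dq s; rewrite /nu /liouville_form /nuK !evM // fKE // ev_cst //.
  by rewrite (rep_form_pow m rW).
have anu q : dom p q -> Defs.alternating n (nu q).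
  move=> dq; apply: (rep_form_alternating dq rnu).
  - by move=> s1 s2 k u v; rewrite /nuK (form_pow_multilin W m); ring.
  - by move=> s1 u s2; rewrite /nuK (form_pow_altern W0) !mulr0.
  - by move=> s sz; rewrite /nuK form_pow_degree ?mulr0 // mn.
have rhoE q : dom p q -> nu q (map (push p q) (std vec)) = ev q rho.
  move=> dq; rewrite -[RHS](rnu q dq) map_comp; congr (nu q (map _ _)).
  by rewrite -map_comp; apply: eq_map => i /=; rewrite evm_vec.
have rho0 q : dom p q -> ev q rho != 0.
  move=> dq; rewrite !evM // fKE // ev_cst // !mulf_neq0 ?invr_eq0 ?pnatr_eq0 -?lt0n ?fact_gt0 //.
  rewrite ev_form_pow //.
  have -> : map (evm q) (std (@vec K n)) = std vec.
    by rewrite -map_comp; apply: eq_map => i /=; rewrite evm_vec.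
  apply: form_pow_std_neq0 => //; last exact: WU.
  move=> x; have := congr1 (evm q) (W0 (cstm p x)); rewrite !evm_mul // => E.
  have -> : x *m evm q W *m x^T = evm q (cstm p x) *m evm q W *m evm q (cstm p x)^T.
    by rewrite evm_cst //; congr (_ *m _); apply/matrixP => i j; rewrite !mxE ev_cst.
  by rewrite E; apply/matrixP => i j; rewrite !mxE ev0.
have drho k : d k rho = rho * lam k 0.
  rewrite /rho dM [d k (c * _)]dM d_cst mul0r add0r.
  rewrite [d k fp](d_liouville dD dM (@sfun_half R n (chart_open p)) WC GC WG GW) -/fp.
  by rewrite [lam k 0]mxE dmu; ring.
have [rI rIE] : exists g, rho * g = 1.
  by apply: sfun_inv => y /codP[dq <-]; rewrite -/(ev _ _) rho0.
have lamC k l : d k (lam l 0) = d l (lam k 0).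
  have E : rho * d k (lam l 0) = rho * d l (lam k 0).
    have H a b : d a (d b rho) = rho * lam a 0 * lam b 0 + rho * d a (lam b 0).
      by rewrite drho dM drho.
    have := dC k l rho; rewrite !H mulrAC => /addrI //.
  have := congr1 ( *%R rI) E; rewrite !(mulrA rI rho) [rI * rho]mulrC rIE.
  by rewrite !mul1r.
exists G, rho, lam, mu; split => //; split => // x.
rewrite /modular_covec /lam.
have -> : bil G^T (liouville_covec d half W G + mu) x
        = bil G^T (liouville_covec d half W G) x + bil G^T mu x.
  by rewrite -[liouville_covec _ _ _ _]scale1r bil_linl mul1r scale1r.
rewrite addrA -/(modular_covec d G^T _ x).
by rewrite (liouville_unimodular dD dM (@sfun_half R n (chart_open p)) WC GC WG GW W_closed) add0r.
Qed.

(** The covectors of [s] are extended with constant coordinates in [chart_at p], where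
    [modular_commutator] applies; its terms are then read back as functions and differentials on
    P. *)
Lemma modular_lie a A s : smooth_mvfield a setT A ->
  modular w nu a A p s = if size s == a then (-1) ^+ a *
    (poisson w p [:: dfun phi p; dfun (fun q => A q [seq dfun (fun_with_diff p x) q | x <- s]) p]
     - \sum_(i < size s) A p (set_nth 0 s i
         (dfun (fun q => poisson w q [:: dfun phi q; dfun (fun_with_diff p (nth 0 s i)) q]) p)))
  else 0.
Proof.
move=> [aA sA]; have pp := chart_at_dom p.
have [AK [rA mA altA dA]] : exists AK, [/\ rep (p := p) A AK, multilin AK, altern AK & degree a AK].
  apply: rep_exists => [q _|l]; first exact: aA.
  by apply: smooth_fun_smf; have := sA p l; rewrite setTI.
have [G [rho [lam [mu [[rP PC] [anu rnu] [nz drho] [lamC modE] muE]]]]] := modular_data.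
have halfE := @sfun_half R n (chart_open p).
pose sK := map (cstm p) s.
have evp x : pull p p (evm p (cstm p x)) = x by rewrite pull_id evm_cst.
have sKE : map (pull p p \o evm p) sK = s.
  by rewrite -map_comp map_id_in // => x _ /=; rewrite evp.
have mQ T : multilin T -> altern T -> multilin (poisson_diff d G^T T).
  exact: poisson_diff_multilin dD dM PC _.
have rQ := poisson_d_rep PC rP rA mA altA dA.
have rCQ := curl_rep anu rnu nz drho rQ (mQ _ mA altA) (poisson_diff_altern dD PC halfE mA altA)
  (poisson_diff_degree _ dD dA).
have rC := curl_rep anu rnu nz drho rA mA altA dA.
(* For a = 0 the predecessor is 0 again; the divergence is then zero and has every degree. *)
have dC0 : degree a.-1 (div_right d lam AK).
  case: (a) dA => [|a'] dA' l sl; first exact: (div_right_degree0 dD lam l dA').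
  exact: (div_right_degree dD lam dA').
have rQC := poisson_d_rep PC rP rC (div_right_multilin dD dM lam mA) (div_right_altern dD lam mA altA) dC0.
rewrite /modular -[in LHS]sKE rCQ // rQC // -evN // -evD //.
case: eqVneq => [sz|ne]; last first.
  rewrite (div_right_degree dD lam (poisson_diff_degree _ dD dA)) ?size_map // add0r.
  case: (a) ne dA => [|a'] ne dA'.
    rewrite (poisson_diff_degree (a := size s) _ dD) ?oppr0 ?ev0 //.
      by move=> l _; exact: (div_right_degree0 dD lam l dA').
    by rewrite size_map neq_ltn ltnSn.
  by rewrite (poisson_diff_degree _ dD (div_right_degree dD lam dA')) ?oppr0 ?ev0 // size_map.
rewrite (modular_commutator dD dM dC PC halfE mA altA dA lamC modE); last 2 first.
- by move=> x /mapP[y _ ->]; apply: const_cov_cst.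
- by rewrite size_map.
rewrite evM // ev_sign // evD // evN //; congr (_ * (_ - _)).
  have agA : agree p (fun q => A q [seq dfun (fun_with_diff p x) q | x <- s]) (AK sK).
    apply: filterS (near_dom pp) => q dq; rewrite -rA //; congr (A q _).
    rewrite -map_comp; apply: eq_map => x /=.
    by rewrite dfun_fun_with_diff_near // evm_cst.
  by rewrite (agree_dfun pp agA) muE // -(rP p pp [:: mu; grad d (AK sK)]).
rewrite dsumE ev_sum // size_map; apply: eq_bigr => i _.
have agP : agree p (fun q => poisson w q [:: dfun phi q; dfun (fun_with_diff p (nth 0 s i)) q])
    (bil G^T mu (cstm p (nth 0 s i))).
  apply: filterS (near_dom pp) => q dq.
  rewrite -(rP q dq [:: mu; cstm p (nth 0 s i)]) /= muE //.
  by rewrite dfun_fun_with_diff_near // evm_cst.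
rewrite (agree_dfun pp agP) -rA //; congr (A p _).
have si : (i < size sK)%N by rewrite size_map.
by rewrite (map_set_nth _ _ 0 _ si) sKE (nth_map 0).
Qed.

End ModularLie.

(** * Smooth forms and their globalization *)

Section SmoothForms.
Context {R : realType} {n : nat} {P : manifold R n}.
Notation dom x := (chart_dom (chart_at (m := P) x)).
Notation b i := (delta_mx 0 i : 'rV[R]_n).
Implicit Types (h g : P -> R) (al be : P -> 'cV[R]_n) (W O : set P) (p q x : P).

Lemma smooth_fun_ext W h h' : open W -> (forall q, W q -> h' q = h q) ->
  smooth_fun W h -> smooth_fun W h'.
Proof.
move=> oW E sh x; have oI := open_img (x := x) oW; rewrite -/(img _ _).
apply: (sm_smooth oI); apply: (sm_ext (g := h \o of_coord (chart_at x))).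
  by move=> y /imgP[_ Wy] /=; rewrite E.
exact/sm_base/sh.
Qed.

Lemma smooth_fun_sub W W' h : W `<=` W' -> smooth_fun W' h -> smooth_fun W h.
Proof. by move=> WW' sh x; apply: smooth_on_sub (sh x); apply: img_mono. Qed.

Lemma smooth_fun_cover W h :
  (forall q, W q -> exists V, V q /\ smooth_fun V h) -> smooth_fun W h.
Proof.
move=> H x l y [q [Wq dq] <-]; have [V [Vq sV]] := H q Wq.
by apply: (sV x); exists q.
Qed.

Lemma smooth_funM W h g : open W -> smooth_fun W h -> smooth_fun W g ->
  smooth_fun W (fun q => h q * g q).
Proof.
move=> oW sh sg x; apply: (sm_smooth (open_img (x := x) oW)).
by apply: sm_mul; apply: sm_base; [exact: sh|exact: sg].
Qed.

Lemma smooth_funD W h g : open W -> smooth_fun W h -> smooth_fun W g ->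
  smooth_fun W (fun q => h q + g q).
Proof.
move=> oW sh sg x; apply: (sm_smooth (open_img (x := x) oW)).
by apply: sm_add; apply: sm_base; [exact: sh|exact: sg].
Qed.

Lemma smooth_fun_cst W (c : R) : open W -> smooth_fun W (fun=> c).
Proof. by move=> oW x; apply: (sm_smooth (open_img (x := x) oW)); apply: sm_cst. Qed.

Lemma smooth_form1P W al :
  smooth_form1 W al <->
  forall x i, smooth_fun (W `&` dom x) (fun q => pair (al q) (coord_vector x i q)).
Proof.
have E (xi : 'cV[R]_n) v : wedge_covectors [:: xi] [:: v] = pair xi v.
  by rewrite wedge_covectorsE /= mulr1 subr0.
have E0 (xi : 'cV[R]_n) s : size s != 1%N -> wedge_covectors [:: xi] s = 0.
  by move=> sz; rewrite wedge_covectorsE wdet_size // eq_sym.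
split=> [[_ H] x i|H].
  have := H x [:: i]; rewrite /= /form_of.
  by under eq_fun => q do rewrite E.
split=> [p Wp|x l].
  apply: alternatingP => [s sz|s1 s2 k u v|s1 u s2]; rewrite /form_of.
  - exact: E0.
  - by rewrite !wedge_covectorsE; apply: (wdet_multilinr (@kpair_linr R n)).
  - by rewrite wedge_covectorsE; apply: wdet_alternr.
have [sz|sz] := eqVneq (size l) 1%N.
  case: l sz => [|i []] //= _; rewrite /form_of.
  under eq_fun => q do rewrite E; exact: H.
rewrite /form_of; under eq_fun => q do rewrite E0 ?size_map //.
by apply: smooth_fun_sub (@subsetT _ _) (smooth_fun_cst 0 openT).
Qed.

Lemma smooth_form1_lin W h al be : open W -> smooth_fun W h -> smooth_form1 W al ->
  smooth_form1 W be -> smooth_form1 W (fun q => h q *: al q + be q).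
Proof.
move=> oW sh /smooth_form1P sal /smooth_form1P sbe; apply/smooth_form1P => x i.
have o : open (W `&` dom x) by apply: openI => //; apply: open_dom.
apply: (smooth_fun_ext (h := fun q => h q * pair (al q) (coord_vector x i q)
    + pair (be q) (coord_vector x i q))) => // [q _|].
  exact: kpair_linl.
apply: smooth_funD => //; apply: smooth_funM => //.
by apply: smooth_fun_sub sh => q [].
Qed.

Lemma smooth_form1_ext W al be : open W -> (forall q, W q -> be q = al q) ->
  smooth_form1 W al -> smooth_form1 W be.
Proof.
move=> oW E /smooth_form1P sal; apply/smooth_form1P => x i.
apply: smooth_fun_ext (sal x i) => [|q [Wq _]]; last by rewrite E.
by apply: openI => //; apply: open_dom.
Qed.

Lemma smooth_form1_cover W al :
  (forall q, W q -> exists V, V q /\ smooth_form1 V al) -> smooth_form1 W al.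
Proof.
move=> H; apply/smooth_form1P => x i; apply: smooth_fun_cover => q [Wq dq].
have [V [Vq /smooth_form1P sV]] := H q Wq.
by exists (V `&` dom x); split.
Qed.

Lemma smooth_form1_0 W : smooth_form1 W (fun=> 0).
Proof.
apply/smooth_form1P => x i.
have -> : (fun q => pair 0 (coord_vector x i q)) = (fun=> 0 : R).
  by apply/funext => q; rewrite /pair mulmx0 mxE.
exact: smooth_fun_sub (@subsetT _ _) (smooth_fun_cst 0 openT).
Qed.

Lemma smooth_form1_dfun W h : open W -> smooth_fun W h -> smooth_form1 W (dfun h).
Proof.
move=> oW sh; apply/smooth_form1P => x i.
have o : open (W `&` dom x) by apply: openI => //; apply: open_dom.
have sh' : smf x (W `&` dom x) h by apply: smooth_fun_smf; apply: smooth_fun_sub sh => q [].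
apply: (smooth_fun_ext (h := fun q => 'D_(b i) (h \o of_coord (chart_at x)) (chart_at x q))) => //.
  move=> q [Wq dq]; have qq := chart_at_dom q.
  rewrite coord_vectorE // dfunE (dch_change qq dq); last exact: (smf_chart_diff o _ dq sh').
  rewrite /pair mulmxA -(mulmxA (b i)) Jac_comp // Jac_id // mulmx1 -rowE mxE.
  by rewrite [dch x h q i 0]mxE.
by apply: (smf_smooth_fun (x := x)) => //; apply: smf_partial.
Qed.

(** The set outside which the bump vanishes in the chart is compact, so its image in P is closed by
    the Hausdorff property; hence extension by zero beyond the chart is smooth. *)
Lemma manifold_bump p O : open O -> O p -> exists (be : P -> R) C,
  [/\ smooth_fun setT be, \forall q \near p, be q = 1, open C,
     (forall q, C q -> be q = 0) & ~` C `<=` O].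
Proof.
move=> oO Op; have pp := chart_at_dom p; set c := chart_at p.
have nN : nbhs (c p) (img c O).
  by apply: open_nbhs_nbhs; split; [exact: open_img|exact: img_in].
have [be0 [B [sbe be1 oB cB [be0B BN]]]] := bump_exists nN.
pose be q := if `[< dom p q >] then be0 (c q) else 0.
pose S := of_coord c @` ~` B; exists be, (~` S).
have cS : closed S.
  apply: (compact_closed (@points_hausdorff _ _ P)); apply: continuous_compact cB.
  apply: continuous_in_subspaceT => y /set_mem nBy.
  by apply: of_coord_continuous; have /imgP[] := BN y nBy.
have oS : open (~` S) by apply: closed_openC.
have S0 q : (~` S) q -> be q = 0.
  move=> nS; rewrite /be; case: asboolP => // dq; apply: be0B.
  apply: contrapT => nBq; apply: nS; exists (c q) => //; exact: to_coordK.
split => //.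
- apply: smooth_fun_cover => q _; have [dq|ndq] := pselect (dom p q).
    exists (dom p); split => //; apply: (smf_smooth_fun (x := p)) => //; first exact: open_dom.
    apply: (sm_ext (g := be0)); last by apply: sm_base => l y _; apply: sbe.
    by move=> y /imgP[/codP[dy e] _] /=; rewrite /be asboolT // /c e.
  exists (~` S); split.
    move=> [y nBy e]; apply: ndq; rewrite -e.
    by have /imgP[/codP[] //] := BN y nBy.
  by apply: smooth_fun_ext (smooth_fun_cst 0 oS).
- have := near_point pp be1; apply: filterS2 (near_dom pp) => q dq.
  by rewrite /be asboolT.
- rewrite setCK => q [y nBy <-].
  by have /imgP[] := BN y nBy.
Qed.

Lemma globalize_exists p O al : open O -> O p -> smooth_form1 O al ->
  exists be, smooth_form1 setT be /\ \forall q \near p, be q = al q.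
Proof.
move=> oO Op sal; have [h [C [sh h1 oC hC CO]]] := manifold_bump oO Op.
exists (fun q => h q *: (if `[< O q >] then al q else 0)); split; last first.
  apply: filterS2 h1 (open_nbhs_nbhs (conj oO Op)) => q -> Oq.
  by rewrite asboolT // scale1r.
apply: smooth_form1_cover => q _; have [Cq|nCq] := pselect (C q).
  exists C; split; first exact: Cq.
  refine (smooth_form1_ext oC _ (smooth_form1_0 C)) => z Cz.
  by rewrite hC // scale0r.
exists O; split; first exact: CO.
have sO := smooth_form1_lin oO (smooth_fun_sub (@subsetT _ _) sh) sal (smooth_form1_0 O).
refine (smooth_form1_ext oO _ sO) => z Oz.
by rewrite asboolT // addr0.
Qed.

Definition smooth_at p al := exists O, [/\ open O, O p & smooth_form1 O al].

Lemma globalizeP p al : smooth_at p al ->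
  smooth_form1 setT (globalize p al) /\ \forall q \near p, globalize p al q = al q.
Proof.
move=> [V [oV Vp sal]]; rewrite /globalize; set S := [set _ | _].
by apply: (@xgetPex _ _ S); apply: globalize_exists sal.
Qed.

Lemma globalize_at p al : smooth_at p al -> globalize p al p = al p.
Proof. by move=> /globalizeP[_ /nbhs_singleton]. Qed.

End SmoothForms.

(** * Contravariant connections *)

#[local] Opaque smooth_form1 smooth_fun.

Section Connection.
Context {R : realType} {n : nat} {P : manifold R n}.
Notation dom x := (chart_dom (chart_at (m := P) x)).
Variables (w : P -> seq 'rV[R]_n -> R)
  (D : (P -> 'cV[R]_n) -> (P -> 'cV[R]_n) -> (P -> 'cV[R]_n)).
Hypothesis D_cd : contravariant_derivative w D.
Implicit Types (eta al be : P -> 'cV[R]_n) (h : P -> R) (p q : P).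

Lemma cd_linr (k : R) eta al be p : smooth_form1 setT eta -> smooth_form1 setT al ->
  smooth_form1 setT be ->
  D eta (fun q => k *: al q + be q) p = k *: D eta al p + D eta be p.
Proof. by case: D_cd => _ H _ _ *; exact: H. Qed.

Lemma cd_linl h eta eta' al p : smooth_fun setT h -> smooth_form1 setT eta ->
  smooth_form1 setT eta' -> smooth_form1 setT al ->
  D (fun q => h q *: eta q + eta' q) al p = h p *: D eta al p + D eta' al p.
Proof. by case: D_cd => _ _ H _ *; exact: H. Qed.

Lemma cd_leibniz h eta al p : smooth_fun setT h -> smooth_form1 setT eta ->
  smooth_form1 setT al ->
  D eta (fun q => h q *: al q) p = h p *: D eta al p + lie_fun (sharp w eta) h p *: al p.
Proof. by case: D_cd => _ _ _ H *; exact: H. Qed.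

Lemma smooth_form1Z h al : smooth_fun setT h -> smooth_form1 setT al ->
  smooth_form1 setT (fun q => h q *: al q).
Proof.
move=> sh sal.
have s0 := smooth_form1_lin openT sh sal (smooth_form1_0 _).
refine (smooth_form1_ext openT _ s0).
move=> q _.
by rewrite addr0.
Qed.

(** With a bump [h] around [p], h al = h be on all of P. In the Leibniz rule at [p] the terms with
    the derivative of [h] agree because al p = be p. *)
Lemma cd_local eta al be p : smooth_form1 setT eta -> smooth_form1 setT al ->
  smooth_form1 setT be -> (\forall q \near p, al q = be q) -> D eta al p = D eta be p.
Proof.
move=> seta sal sbe E; have := E; rewrite /prop_near1 nbhsE => -[V [oV Vp] VE].
have [h [C [sh h1 oC hC CV]]] := manifold_bump oV Vp.
have hE : (fun q => h q *: al q) = (fun q => h q *: be q).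
  apply/funext => q; have [Cq|nCq] := pselect (C q); first by rewrite hC // !scale0r.
  by rewrite (VE _ (CV _ nCq)).
have := congr1 (fun f => D eta f p) hE; rewrite /= !cd_leibniz //.
by rewrite (nbhs_singleton h1) !scale1r (nbhs_singleton E) => /addIr.
Qed.

Lemma cd_0l al p : smooth_form1 setT al -> D (fun=> 0) al p = 0.
Proof.
move=> sal; have s0 := @smooth_form1_0 R n P setT.
have := cd_linl p (smooth_fun_cst 1 openT) s0 s0 sal.
have -> : (fun q : P => 1 *: 0 + 0) = (fun=> 0 : 'cV[R]_n) by apply/funext => q; rewrite scaler0 addr0.
by rewrite scale1r => /eqP; rewrite -subr_eq subrr eq_sym => /eqP.
Qed.

Lemma cd_suml (I : Type) (r : seq I) (c : I -> P -> R) (xi : I -> P -> 'cV[R]_n) al p :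
  (forall i, smooth_fun setT (c i)) -> (forall i, smooth_form1 setT (xi i)) ->
  smooth_form1 setT al ->
  smooth_form1 setT (fun q => \sum_(i <- r) c i q *: xi i q) /\
  D (fun q => \sum_(i <- r) c i q *: xi i q) al p = \sum_(i <- r) c i p *: D (xi i) al p.
Proof.
move=> sc sxi sal; elim: r => [|i r [IHs IH]].
  have -> : (fun q : P => \sum_(i <- [::]) c i q *: xi i q) = (fun=> 0).
    by apply/funext => q; rewrite big_nil.
  by rewrite big_nil (cd_0l _ sal); split; first exact: smooth_form1_0.
have -> : (fun q : P => \sum_(i <- i :: r) c i q *: xi i q)
  = (fun q => c i q *: xi i q + \sum_(i <- r) c i q *: xi i q).
  by apply/funext => q; rewrite big_cons.
rewrite big_cons (cd_linl _ (sc i) (sxi i) IHs sal) IH; split; last by [].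
exact: (smooth_form1_lin openT (sc i) (sxi i) IHs).
Qed.

Lemma cd_sumr (I : Type) (r : seq I) (c : I -> P -> R) (xi : I -> P -> 'cV[R]_n) eta p :
  (forall i, smooth_fun setT (c i)) -> (forall i, smooth_form1 setT (xi i)) ->
  smooth_form1 setT eta ->
  smooth_form1 setT (fun q => \sum_(i <- r) c i q *: xi i q) /\
  D eta (fun q => \sum_(i <- r) c i q *: xi i q) p =
  \sum_(i <- r) (c i p *: D eta (xi i) p + lie_fun (sharp w eta) (c i) p *: xi i p).
Proof.
move=> sc sxi sal; elim: r => [|i r [IHs IH]].
  have s0 := @smooth_form1_0 R n P setT.
  have -> : (fun q : P => \sum_(i <- [::]) c i q *: xi i q) = (fun=> 0).
    by apply/funext => q; rewrite big_nil.
  rewrite big_nil; split; first exact: s0.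
  have := cd_linr 1 p sal s0 s0.
  have -> : (fun q : P => 1 *: 0 + 0) = (fun=> 0 : 'cV[R]_n) by apply/funext => q; rewrite scaler0 addr0.
  by rewrite scale1r => /eqP; rewrite -subr_eq subrr eq_sym => /eqP.
have -> : (fun q : P => \sum_(i <- i :: r) c i q *: xi i q)
  = (fun q => 1 *: (c i q *: xi i q) + \sum_(i <- r) c i q *: xi i q).
  by apply/funext => q; rewrite big_cons scale1r.
have sci := smooth_form1Z (sc i) (sxi i).
rewrite big_cons (cd_linr _ _ sal sci IHs) IH scale1r (cd_leibniz _ (sc i) sal (sxi i)); split; last by [].
exact: (smooth_form1_lin openT (smooth_fun_cst 1 openT) sci IHs).
Qed.

Lemma coord_covector_expand p q (xi : 'cV[R]_n) : dom p q ->
  xi = \sum_k pair xi (coord_vector p k q) *: coord_covector p k q.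
Proof.
move=> dq; rewrite -{1}(unpullK (p := p) xi dq) evm_cst // /pull.
rewrite [X in _ *m X](col_covE) linear_sum; apply: eq_bigr => k _.
rewrite linearZ /= -pull_cov; congr (_ *: _).
by rewrite coord_vectorE // /pair -mulmxA -rowE [RHS]mxE.
Qed.

Lemma smooth_coord_covector p k : smooth_form1 (dom p) (coord_covector p k).
Proof.
apply: smooth_form1_dfun; first exact: open_dom.
apply: (smf_smooth_fun (x := p)) => //; first exact: open_dom.
apply: (sm_ext (g := fun y => y 0 k)); last exact: sm_coord.
by move=> y /imgP[/codP[_ e] _] /=; rewrite e.
Qed.

(* With a bump function [h] around [p], [h^2 eta] is the global combination of the forms
   [h dx^k] with coefficients [h eta_k], which vanish at [p]. *)
Lemma cd_eq0 eta al p : smooth_form1 setT eta -> smooth_form1 setT al -> eta p = 0 ->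
  D eta al p = 0.
Proof.
move=> seta sal e0; have pp := chart_at_dom p.
have [h [C [sh h1 oC hC CV]]] := manifold_bump (open_dom (chart_at p)) pp.
have hp := nbhs_singleton h1.
pose c k q := h q * pair (eta q) (coord_vector p k q).
pose xi k q := h q *: (if `[< dom p q >] then coord_covector p k q else 0).
have sc k : smooth_fun setT (c k).
  apply: smooth_fun_cover => q _; have [Cq|nCq] := pselect (C q).
    exists C; split => //; apply: smooth_fun_ext (smooth_fun_cst 0 oC) => // z Cz.
    by rewrite /c hC // mul0r.
  exists (dom p); split; first exact: CV.
  apply: smooth_funM; [exact: open_dom|exact: smooth_fun_sub sh|].
  by move/smooth_form1P: seta => /(_ p k); rewrite setTI.
have sxi k : smooth_form1 setT (xi k).
  apply: smooth_form1_cover => q _; have [Cq|nCq] := pselect (C q).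
    exists C; split => //; apply: (smooth_form1_ext (al := fun=> 0)) => //.
      by move=> z Cz; rewrite /xi hC // scale0r.
    exact: smooth_form1_0.
  exists (dom p); split; first exact: CV.
  apply: (smooth_form1_ext (al := fun q => h q *: coord_covector p k q + 0)).
  - exact: open_dom.
  - by move=> z dz; rewrite /xi asboolT // addr0.
  - exact: (smooth_form1_lin (open_dom _) (smooth_fun_sub (@subsetT _ _) sh) (smooth_coord_covector p k) (smooth_form1_0 _)).
have s0 := @smooth_form1_0 R n P setT.
have hh : smooth_fun setT (fun q => h q * h q) by apply: smooth_funM => //; apply: openT.
have E : (fun q => (h q * h q) *: eta q + 0) = (fun q => \sum_(k <- index_enum 'I_n) c k q *: xi k q).
  apply/funext => q; have [Cq|nCq] := pselect (C q).
    by rewrite hC // mul0r scale0r addr0 big1 // => k _; rewrite /c hC // mul0r scale0r.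
  have dq := CV q nCq; rewrite addr0 {1}(coord_covector_expand (eta q) dq) scaler_sumr.
  apply: eq_bigr => k _; rewrite /c /xi asboolT // !scalerA; congr (_ *: _); ring.
have := cd_linl p hh seta s0 sal; rewrite E (cd_suml _ _ sc sxi sal).2 hp !mulr1 scale1r cd_0l // addr0 => <-.
by rewrite big1 // => k _; rewrite /c e0 /pair mulmx0 mxE mulr0 scale0r.
Qed.

(** [eta] minus the combination with constant coefficients is a global form that vanishes at [p], to
    which [cd_eq0] applies. *)
Lemma cd_point (I : finType) (c : I -> R) (xi : I -> P -> 'cV[R]_n) eta al p :
  smooth_form1 setT eta -> (forall i, smooth_form1 setT (xi i)) -> smooth_form1 setT al ->
  eta p = \sum_i c i *: xi i p -> D eta al p = \sum_i c i *: D (xi i) al p.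
Proof.
move=> seta sxi sal E.
have sc i : smooth_fun setT (fun _ : P => c i) by apply: smooth_fun_cst; apply: openT.
have [ss Ds] := cd_suml (index_enum I) p sc sxi sal.
have sN1 : smooth_fun setT (fun _ : P => -1 : R) by apply: smooth_fun_cst; apply: openT.
have z0 : -1 *: \sum_(i <- index_enum I) c i *: xi i p + eta p = 0 by rewrite scaleN1r E addrC subrr.
have := cd_linl p sN1 ss seta sal; rewrite Ds (cd_eq0 (smooth_form1_lin openT sN1 ss seta) sal z0).
by move=> /eqP; rewrite scaleN1r eq_sym addrC subr_eq0 => /eqP.
Qed.

Lemma cd_eq_point eta eta' al p : smooth_form1 setT eta -> smooth_form1 setT eta' ->
  smooth_form1 setT al -> eta p = eta' p -> D eta al p = D eta' al p.
Proof.
move=> seta seta' sal E.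
have := @cd_point 'I_1 (fun=> 1) (fun=> eta') eta al p seta (fun=> seta') sal.
by rewrite !big_ord1 !scale1r => /(_ E).
Qed.

End Connection.

Section BilinearLeibniz.
Context {K : comPzRingType} {n : nat} (d : 'I_n -> K -> K).
Hypothesis dD : forall k a b, d k (a + b) = d k a + d k b.
Hypothesis dM : forall k a b, d k (a * b) = d k a * b + a * d k b.

Lemma bil_sum2 (Q : 'M[K]_n) (I J : finType) (a : I -> K) (b : J -> K) x y :
  bil Q (\sum_i a i *: x i) (\sum_j b j *: y j) = \sum_i \sum_j a i * b j * bil Q (x i) (y j).
Proof.
have linl z u v : bil Q (u + v) z = bil Q u z + bil Q v z.
  by rewrite -[u]scale1r bil_linl mul1r scale1r.
have l0 z : bil Q 0 z = 0 by apply: (@addrI _ (bil Q 0 z)); rewrite -linl !addr0.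
have linr z u v : bil Q z (u + v) = bil Q z u + bil Q z v.
  by rewrite -[u]scale1r bil_linr mul1r scale1r.
have r0 z : bil Q z 0 = 0 by apply: (@addrI _ (bil Q z 0)); rewrite -linr !addr0.
rewrite (big_morph (bil Q ^~ _) (linl _) (l0 _)); apply: eq_bigr => i _.
rewrite (big_morph (bil Q _) (linr _) (r0 _)); apply: eq_bigr => j _.
rewrite -[a i *: x i]addr0 bil_linl l0 addr0 -[b j *: y j]addr0 bil_linr r0 addr0; ring.
Qed.

Lemma vec_act_sumr X (I : Type) (r : seq I) (F : I -> K) :
  vec_act d X (\sum_(i <- r) F i) = \sum_(i <- r) vec_act d X (F i).
Proof. exact: (big_morph _ (vec_actD dD X) (vec_act0 dD X)). Qed.

Lemma vec_act_bil X (Q : 'M[K]_n) (a b : 'cV[K]_n) :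
  vec_act d X (bil Q a b) = bil (map_mx (vec_act d X) Q) a b
    + (bil Q (map_mx (vec_act d X) a) b + bil Q a (map_mx (vec_act d X) b)).
Proof.
rewrite /bil vec_act_sumr -!big_split; apply: eq_bigr => i _ /=.
rewrite vec_act_sumr -!big_split; apply: eq_bigr => j _ /=.
by rewrite !(vec_actM dM) !mxE; ring.
Qed.

End BilinearLeibniz.

Section PoissonConnection.
Context {R : realType} {n : nat} {P : manifold R n} (p : P).
Notation dom x := (chart_dom (chart_at (m := P) x)).
Local Notation K := (sfun (chart_open p)).
Notation d := (@sfun_partial R n (chart_open p)).
Local Notation dD := (@sfun_partialD R n (chart_open p)).
Local Notation dM := (@sfun_partialM R n (chart_open p)).
Local Notation dC := (@sfun_partialC R n (chart_open p)).
Implicit Types (eta al be : P -> 'cV[R]_n) (F : P -> R).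

Let pp : dom p p := chart_at_dom p.

Lemma lie_fun_agree (X : P -> 'rV[R]_n) F g : agree p F g ->
  lie_fun X F p = ev p (vec_act d (cstm p (X p)) g).
Proof.
move=> ag; rewrite /lie_fun (agree_dfun pp ag) pull_id -[pair _ _]/(kpair _ _) kpairE.
by rewrite /vec_act ev_sum //; apply: eq_bigr => k _; rewrite evM // !mxE ev_cst.
Qed.

Lemma form1_rep al : smooth_form1 setT al ->
  exists aK : 'cV[K]_n, forall q, dom p q -> al q = pull p q (evm q aK).
Proof.
move=> /smooth_form1P sal.
have H k : exists g : K, forall q, dom p q -> ev q g = pair (al q) (coord_vector p k q).
  by apply: sfun_of; apply: smooth_fun_smf; have := sal p k; rewrite setTI.
have [g Hg] := choice H; exists (\col_k g k) => q dq.
rewrite [LHS](coord_covector_expand (p := p) (al q) dq) [evm q _]col_covE /pull linear_sum.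
by apply: eq_bigr => k _; rewrite linearZ /= !mxE Hg // -pull_cov.
Qed.

Lemma smooth_at_fun_with_diff xi : smooth_at p (dfun (fun_with_diff p xi)).
Proof.
exists (dom p); split; [exact: open_dom|exact: pp|].
have sF : smooth_fun (dom p) (fun_with_diff p xi).
  exact: (smf_smooth_fun (open_dom _) (@subset_refl _ _) (fun_with_diff_smf p xi)).
exact: (smooth_form1_dfun (open_dom _) sF).
Qed.

(** The coordinate differential dx^k near [p], continued to all of P so that D can be applied to
    it. *)
Definition coord_form k := globalize p (dfun (fun_with_diff p (cov k))).

Lemma coord_form_smooth k : smooth_form1 setT (coord_form k).
Proof. by have [] := globalizeP (smooth_at_fun_with_diff (cov k)). Qed.

Lemma coord_form_near k : \forall q \near p, coord_form k q = pull p q (cov k).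
Proof.
have [_ H] := globalizeP (smooth_at_fun_with_diff (cov k)).
by apply: filterS2 H (near_dom pp) => q E dq; rewrite /coord_form E dfun_fun_with_diff_near.
Qed.

Lemma fun_globalize F : smooth_fun (dom p) F ->
  exists h, smooth_fun setT h /\ \forall q \near p, h q = F q.
Proof.
move=> sF; have [h [C [sh h1 oC hC CV]]] := manifold_bump (open_dom (chart_at p)) pp.
exists (fun q => h q * F q); split; last first.
  by apply: filterS h1 => q ->; rewrite mul1r.
apply: smooth_fun_cover => q _; have [Cq|nCq] := pselect (C q).
  exists C; split; first by [].
  by apply: (smooth_fun_ext oC _ (smooth_fun_cst 0 oC)) => z Cz; rewrite hC // mul0r.
exists (dom p); split; first exact: CV.
exact: (smooth_funM (open_dom _) (smooth_fun_sub (@subsetT _ _) sh) sF).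
Qed.

Variables (w : P -> seq 'rV[R]_n -> R)
  (D : (P -> 'cV[R]_n) -> (P -> 'cV[R]_n) -> (P -> 'cV[R]_n)).
Hypothesis D_cd : contravariant_derivative w D.

Lemma cd_expand eta al (aK : 'cV[K]_n) : smooth_form1 setT eta -> smooth_form1 setT al ->
  (forall q, dom p q -> al q = pull p q (evm q aK)) ->
  D eta al p = \sum_k ev p (aK k 0) *: D eta (coord_form k) p
    + evm p (map_mx (vec_act d (cstm p (sharp w eta p))) aK).
Proof.
move=> seta sal alE.
have comp k q : dom p q -> pair (al q) (coord_vector p k q) = ev q (aK k 0).
  move=> dq; rewrite alE // -push_vec // -[pair _ _]/(kpair _ _) kpair_pull_push //.
  by rewrite /kpair /vec -rowE !mxE.
have H k : exists c, smooth_fun setT c /\ \forall q \near p, c q = ev q (aK k 0).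
  have [c [sc cE]] := @fun_globalize (fun q => pair (al q) (coord_vector p k q))
    (smooth_fun_sub (fun q dq => conj I dq) (proj1 (smooth_form1P setT al) sal p k)).
  exists c; split; first exact: sc.
  by apply: filterS2 cE (near_dom pp) => q -> dq; rewrite comp.
have [c Hc] := choice H.
have sc k := (Hc k).1; have cE k : agree p (c k) (aK k 0) := (Hc k).2.
have [ss Ds] := cd_sumr D_cd (index_enum 'I_n) p sc coord_form_smooth seta.
rewrite (cd_local D_cd (be := fun q => \sum_k c k q *: coord_form k q) seta sal ss); last first.
  have Hn : \forall q \near p, forall k, c k q = ev q (aK k 0) /\ coord_form k q = pull p q (cov k).
    by refine (@filter_forall _ _ _ _ _ _) => k; apply: filterS2 (cE k) (coord_form_near k).
  apply: filterS2 Hn (near_dom pp) => q Hq dq.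
  rewrite alE // [evm q aK]col_covE /pull linear_sum; apply: eq_bigr => k _.
  by rewrite linearZ /= (Hq k).1 (Hq k).2 mxE.
rewrite Ds big_split; congr (_ + _).
  by apply: eq_bigr => k _; rewrite (agree_at (cE k)).
rewrite [RHS]col_covE; apply: eq_bigr => k _.
by rewrite (lie_fun_agree _ (cE k)) (nbhs_singleton (coord_form_near k)) pull_id !mxE.
Qed.

Hypothesis w_symplectic : symplectic w.
Hypothesis D_poisson : forall eta, smooth_form1 setT eta ->
  forall q s, cd_mvfield w D eta (poisson w) q s = 0.

(** D Pi = 0 is tested on covectors extended with constant coordinates. By [cd_expand] both sides
    gain the same terms when the components of [al] and [be] are differentiated. *)
Lemma cd_poisson eta al be : smooth_form1 setT eta -> smooth_form1 setT al ->
  smooth_form1 setT be ->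
  lie_fun (sharp w eta) (fun q => poisson w q [:: al q; be q]) p =
  poisson w p [:: D eta al p; be p] + poisson w p [:: al p; D eta be p].
Proof.
move=> seta sal sbe.
have [W [G [[_ rP] _ _ _ _]]] := symplectic_local p w_symplectic.
set Q : 'M[K]_n := G^T in rP; pose Q0 := evm p Q.
have PE x y : poisson w p [:: x; y] = bil Q0 x y.
  have := rP p pp [:: cstm p x; cstm p y]; rewrite /= pull_id !evm_cst // => ->.
  by rewrite ev_bil // !evm_cst.
have [aK aE] := form1_rep sal; have [bK bE] := form1_rep sbe.
set X := cstm p (sharp w eta p).
have agab : agree p (fun q => poisson w q [:: al q; be q]) (bil Q aK bK).
  by apply: filterS (near_dom pp) => q dq; rewrite aE // bE // -(rP q dq [:: aK; bK]).
have dQ k l : ev p (vec_act d X (Q k l)) =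
    bil Q0 (D eta (coord_form k) p) (cov l) + bil Q0 (cov k) (D eta (coord_form l) p).
  have E : lie_fun (sharp w eta) (fun q => poisson w q
        [:: dfun (fun_with_diff p (cov k)) q; dfun (fun_with_diff p (cov l)) q]) p
      - (poisson w p [:: restrict_cd D eta (dfun (fun_with_diff p (cov k))) p; cov l]
         + poisson w p [:: cov k; restrict_cd D eta (dfun (fun_with_diff p (cov l))) p]) = 0.
    have := D_poisson seta p [:: cov k; cov l]; rewrite /cd_mvfield big_ord_recl big_ord1.
    exact.
  have ag : agree p (fun q => poisson w q [:: dfun (fun_with_diff p (cov k)) q; dfun (fun_with_diff p (cov l)) q]) (Q k l).
    apply: filterS (near_dom pp) => q dq; rewrite !dfun_fun_with_diff_near //.
    by have := rP q dq [:: cov k; cov l]; rewrite /= !evm_cov // bil_cov.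
  rewrite (lie_fun_agree _ ag) -/X in E.
  (* [restrict_cd] globalizes [eta] once more, which is harmless since only its value at [p]
     matters. *)
  have rE j : restrict_cd D eta (dfun (fun_with_diff p (cov j))) p = D eta (coord_form j) p.
    have se : smooth_at p eta by exists setT; split; [exact: openT|by []|exact: seta].
    have [ge gee] := globalizeP se.
    by apply: (cd_eq_point D_cd ge seta (coord_form_smooth j)); rewrite (globalize_at se).
  by move/eqP: E; rewrite !rE !PE subr_eq0 => /eqP.
rewrite (lie_fun_agree _ agab) -/X (vec_act_bil dD dM) !evD // !PE.
rewrite (cd_expand seta sal aE) (cd_expand seta sbe bE) -/X.
have a0 : al p = evm p aK by rewrite aE // pull_id.
have b0 : be p = evm p bK by rewrite bE // pull_id.
rewrite a0 b0 !ev_bil //.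
set a1 := evm p (map_mx _ aK); set b1 := evm p (map_mx _ bK).
have linl z u v : bil Q0 (u + v) z = bil Q0 u z + bil Q0 v z.
  by rewrite -[u]scale1r bil_linl mul1r scale1r.
have linr z u v : bil Q0 z (u + v) = bil Q0 z u + bil Q0 z v.
  by rewrite -[u]scale1r bil_linr mul1r scale1r.
rewrite linl linr addrACA; congr (_ + _).
rewrite [X in bil Q0 _ X](col_covE (evm p bK)) [X in _ + bil Q0 X _](col_covE (evm p aK)) !bil_sum2.
rewrite -big_split; apply: eq_bigr => k _ /=; rewrite -big_split; apply: eq_bigr => l _ /=.
by rewrite [evm p _ k l]mxE [map_mx (vec_act d X) Q k l]mxE dQ !mxE; ring.
Qed.

End PoissonConnection.

Lemma wdet_kpair1 (K : comPzRingType) n (mu : 'cV[K]_n) x : wdet kpair [:: x] [:: mu] = kpair mu x.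
Proof. by rewrite /= mulr1 subr0. Qed.

Lemma altsum_pair (V : Type) (K : comPzRingType) (Psi : V -> seq V -> K) x y :
  altsum Psi [:: x; y] = Psi x [:: y] - Psi y [:: x].
Proof. by rewrite /= subr0. Qed.

(** * Frames and the sharp map at a point *)

Section PointwisePoisson.
Context {R : realType} {n : nat} (w : seq 'rV[R]_n -> R).
Hypothesis aw : Defs.alternating 2 w.
Hypothesis nw : forall v, (forall u, w [:: v; u] = 0) -> v = 0.

Lemma sharp_atK xi u : w [:: sharp_at w xi; u] = kpair xi u.
Proof.
have mw := alternating_multilin aw.
pose M := \matrix_(i, j) w [:: vec i; vec j].
have wE x y : w [:: x; y] = (x *m M *m y^T) 0 0 := multilin2E x y mw.
have Mu : M \in unitmx.
  rewrite -row_free_unit -kermx_eq0; apply/rowV0P => v /sub_kermxP vM.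
  by apply: nw => y; rewrite wE vM mul0mx mxE.
have E y : w [:: xi^T *m invmx M; y] = kpair xi y.
  rewrite wE mulmxKV // /kpair [LHS]mxE [RHS]mxE.
  by apply: eq_bigr => i _; rewrite !mxE mulrC.
by rewrite (sharp_at_eq aw nw E) E.
Qed.

Lemma poisson_skew x y : kpair x (sharp_at w y) = - kpair y (sharp_at w x).
Proof. by rewrite -!sharp_atK (w_skew aw). Qed.

Lemma sharp_at_flat xi : flat_at w (sharp_at w xi) = xi.
Proof.
apply/colP => i; rewrite mxE sharp_atK kpairE (bigD1 i) //= mxE !eqxx mul1r big1 ?addr0 //.
by move=> j ji; rewrite mxE (negPf ji) andbF mul0r.
Qed.

Lemma kpair_suml (I : finType) (c : I -> R) (x : I -> 'cV[R]_n) y :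
  kpair (\sum_i c i *: x i) y = \sum_i c i * kpair (x i) y.
Proof.
rewrite /kpair mulmx_sumr summxE; apply: eq_bigr => i _.
by rewrite -scalemxAr mxE.
Qed.

Section Frame.
Variables (e : 'I_n -> 'rV[R]_n) (th : 'I_n -> 'cV[R]_n).
Hypothesis eu : (\matrix_i e i) \in unitmx.
Hypothesis dual : forall i j, kpair (th i) (e j) = (i == j)%:R.

Lemma coframe_expand xi : xi = \sum_i kpair xi (e i) *: th i.
Proof.
apply/eqP; rewrite -subr_eq0; set z := xi - _.
have ez : (\matrix_i e i) *m z = 0.
  apply/matrixP => j k; rewrite (ord1 k).
  have -> : ((\matrix_i e i) *m z) j 0 = kpair z (e j).
    by rewrite /kpair !mxE; apply: eq_bigr => l _; rewrite mxE.
  rewrite [RHS]mxE /z -scaleN1r addrC kpair_linl kpair_suml.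
  rewrite (bigD1 j) //= dual eqxx mulr1 big1 ?addr0 ?mulN1r ?addNr // => i ij.
  by rewrite dual (negPf ij) mulr0.
by rewrite -[z](mulKmx eu) ez mulmx0.
Qed.

Lemma frame_expand v : v = \sum_i kpair (th i) v *: e i.
Proof.
have E k : v 0 k = \sum_i kpair (th i) v * e i 0 k.
  rewrite -!kpair_cov {1}(coframe_expand (cov k)) kpair_suml; apply: eq_bigr => i _.
  by rewrite kpair_cov mulrC.
apply/rowP => k; rewrite summxE E; apply: eq_bigr => i _; by rewrite mxE.
Qed.

(** The frame components of sharp x are theta^l(sharp x) = -x(sharp theta^l), and flat recovers x
    from sharp x. *)
Lemma covector_sharp_ext x y :
  (forall l, kpair x (sharp_at w (th l)) = kpair y (sharp_at w (th l))) -> x = y.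
Proof.
move=> H; rewrite -[x]sharp_at_flat -[y]sharp_at_flat; congr flat_at.
rewrite [LHS]frame_expand [RHS]frame_expand; apply: eq_bigr => l _; congr (_ *: _).
by rewrite poisson_skew H -poisson_skew.
Qed.

Lemma flat_frame (H : 'I_n -> R) l :
  kpair (\sum_j H j *: flat_at w (e j)) (sharp_at w (th l)) = - H l.
Proof.
rewrite kpair_suml (bigD1 l) //= big1 => [|j jl].
  by rewrite kpair_flat // (w_skew aw) sharp_atK dual eqxx addr0 mulrN mulr1.
by rewrite kpair_flat // (w_skew aw) sharp_atK dual eq_sym (negPf jl) oppr0 mulr0.
Qed.

(** The coefficients are, up to sign, the frame components of sharp xi, so the sum is -omega(sharp
    xi, e_j). *)
Lemma frame_contract xi j :
  \sum_i kpair xi (sharp_at w (th i)) * w [:: e i; e j] = - kpair xi (e j).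
Proof.
rewrite -(sharp_atK xi) [in RHS](frame_expand (sharp_at w xi)).
have mw := alternating_multilin aw.
rewrite (@multilin_sum _ _ _ [::]) // -sumrN; apply: eq_bigr => i _.
by rewrite (@multilinZ _ _ _ [::]) // poisson_skew mulNr.
Qed.

End Frame.
End PointwisePoisson.

(** * Vanishing torsion on closed 1-forms *)

Section Torsion.
Context {R : realType} {n : nat} {P : manifold R n} (p : P).
Notation dom x := (chart_dom (chart_at (m := P) x)).
Local Notation K := (sfun (chart_open p)).
Notation d := (@sfun_partial R n (chart_open p)).
Local Notation dD := (@sfun_partialD R n (chart_open p)).
Local Notation dM := (@sfun_partialM R n (chart_open p)).
Implicit Types (eta al be : P -> 'cV[R]_n) (F : P -> R).

Let pp : dom p p := chart_at_dom p.

Lemma dfun_near F G : (\forall q \near p, F q = G q) -> dfun F p = dfun G p.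
Proof.
move=> E; apply/colP => i; rewrite !mxE; apply: near_eq_derive.
exact: near_coord pp E.
Qed.

Lemma ext_d_near (eta eta' : P -> seq 'rV[R]_n -> R) s :
  (\forall q \near p, eta q = eta' q) -> ext_d eta p s = ext_d eta' p s.
Proof.
move=> E; apply: eq_bigr => i _; congr (_ * _); apply: near_eq_derive.
by apply: filterS (near_coord pp E) => y /= ->.
Qed.

Lemma ext_d_closed al (mu : 'cV[K]_n) u v : (forall q, dom p q -> al q = pull p q (evm q mu)) ->
  (forall k l, d k (mu l 0) = d l (mu k 0)) -> ext_d (form_of al) p [:: u; v] = 0.
Proof.
move=> alE muC; pose T (l : seq 'rV[K]_n) := wdet kpair l [:: mu].
have mT : multilin T := wdet_multilinr (@kpair_linr K n) [:: mu].
have aT : altern T by exact: wdet_alternr.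
have rT : rep_form (p := p) (form_of al) T.
  move=> q dq s; rewrite /form_of wedge_covectorsE alE // map_comp /T ev_wdet //.
  apply: (@eq_wdet _ _ _ _ _ kpair kpair (push p q) (pull p q) (map (evm q) s) [:: evm q mu]).
  by move=> xi x; rewrite kpair_pull_push.
have := extd_rep mT aT rT pp [:: unpush p p u; unpush p p v].
rewrite /= !unpushK // => ->; rewrite de_rham_const //; last first.
  by move=> x; rewrite !inE => /orP[] /eqP ->; apply: const_vec_cst.
have TE x : T [:: x] = kpair mu x by exact: wdet_kpair1.
rewrite altsum_pair !TE (_ : _ - _ = 0) ?ev0 //.
have vk (x y : 'rV[R]_n) : vec_act d (cstm p x) (kpair mu (cstm p y)) =
    \sum_j \sum_k cstm p x 0 j * (cstm p y 0 k * d j (mu k 0)).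
  rewrite /vec_act; apply: eq_bigr => j _; rewrite kpairE (d_sum dD) mulr_sumr.
  by apply: eq_bigr => k _; rewrite dM [cstm p y 0 k]mxE d_cst mul0r add0r.
rewrite /unpush !vk exchange_big /= -sumrB big1 // => j _; rewrite -sumrB big1 // => k _.
by rewrite (muC k j); ring.
Qed.

Variables (w : P -> seq 'rV[R]_n -> R)
  (D : (P -> 'cV[R]_n) -> (P -> 'cV[R]_n) -> (P -> 'cV[R]_n)).
Hypothesis w_symplectic : symplectic w.

Lemma dfun_poisson_skew al be : smooth_form1 setT al -> smooth_form1 setT be ->
  dfun (fun q => poisson w q [:: be q; al q]) p = - dfun (fun q => poisson w q [:: al q; be q]) p.
Proof.
move=> sal sbe; have [W [G [[_ rP] [_ GC] _ _ _]]] := symplectic_local p w_symplectic.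
have [aK aE] := form1_rep p sal; have [bK bE] := form1_rep p sbe.
have ag : agree p (fun q => poisson w q [:: al q; be q]) (bil G^T aK bK).
  by apply: filterS (near_dom pp) => q dq; rewrite aE // bE // -(rP q dq [:: aK; bK]).
have ag' : agree p (fun q => poisson w q [:: be q; al q]) (bil G^T bK aK).
  by apply: filterS (near_dom pp) => q dq; rewrite aE // bE // -(rP q dq [:: bK; aK]).
rewrite (agree_dfun pp ag) (agree_dfun pp ag') bilC; last by move=> i j; rewrite !mxE GC.
by rewrite !pull_id; apply/colP => i; rewrite !mxE (dN dD) evN.
Qed.

Hypothesis D_torsion : torsion_free w D.

(** Both forms are closed near [p], so their Lie derivatives are differentials of pairings. Two of
    the three terms of the bracket cancel, and the third is d Pi(be, al) = -d Pi(al, be). *)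
Lemma torsion_exact al x (mu : 'cV[K]_n) : smooth_form1 setT al ->
  (forall q, dom p q -> al q = pull p q (evm q mu)) ->
  (forall k l, d k (mu l 0) = d l (mu k 0)) ->
  let be := globalize p (dfun (fun_with_diff p x)) in
  D al be p = D be al p - dfun (fun q => poisson w q [:: al q; dfun (fun_with_diff p x) q]) p.
Proof.
move=> sal alE muC be; have [sbe beE] := globalizeP (smooth_at_fun_with_diff p x).
rewrite -/be in sbe beE.
have := D_torsion sal sbe p; rewrite /torsion /form1_bracket /lie_form1.
have z1 X : \col_i ext_d (form_of al) p [:: X; delta_mx 0 i] = 0.
  by apply/colP => i; rewrite [LHS]mxE [RHS]mxE (ext_d_closed _ _ alE muC).
have z2 X : \col_i ext_d (form_of be) p [:: X; delta_mx 0 i] = 0.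
  apply/colP => i; rewrite [LHS]mxE [RHS]mxE.
  rewrite (@ext_d_near _ (form_of (dfun (fun_with_diff p x)))); last first.
    by apply: filterS beE => q; rewrite /form_of => ->.
  apply: (@ext_d_closed _ (cstm p x)) => [q dq|k l].
    by rewrite dfun_fun_with_diff_near // evm_cst.
  by rewrite !mxE !d_cst.
rewrite z1 z2 (add0r (dfun (fun q => pair (be q) _) p)) (add0r (dfun (fun q => pair (al q) _) p)).
rewrite -[dfun (fun q => pair (be q) _) p]/(dfun (fun q => poisson w q [:: be q; al q]) p).
rewrite -[dfun (fun q => pair (al q) _) p]/(dfun (fun q => poisson w q [:: al q; be q]) p).
rewrite subrK dfun_poisson_skew // opprK.
rewrite (@dfun_near (fun q => poisson w q [:: al q; be q])
  (fun q => poisson w q [:: al q; dfun (fun_with_diff p x) q])); last first.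
  by apply: filterS beE => q ->.
by move=> /eqP; rewrite -addrA addr_eq0 opprD opprK => /eqP.
Qed.

End Torsion.

(** * The modular operator in a frame *)

Lemma multilin_set_nth (K : comPzRingType) (V : lmodType K) (T : seq V -> K) (I : finType)
  (c : I -> K) (x : I -> V) s k : multilin T -> (k < size s)%N ->
  T (set_nth 0 s k (\sum_i c i *: x i)) = \sum_i c i * T (set_nth 0 s k (x i)).
Proof.
move=> mT ks; rewrite set_nthE ks multilin_sum //; apply: eq_bigr => i _.
by rewrite multilinZ // set_nthE ks.
Qed.

Lemma size_set_nth_id (V : Type) (x0 : V) s k y : (k < size s)%N -> size (set_nth x0 s k y) = size s.
Proof. by move=> ks; rewrite size_set_nth (maxn_idPr ks). Qed.

Section ModularConnection.
Context {R : realType} {n : nat} {P : manifold R n}.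
Variables (w : P -> seq 'rV[R]_n -> R) (m : nat) (f : P -> R).
Hypotheses (w_symplectic : symplectic w) (mn : (m + m)%N = n).
Hypotheses (f_smooth : smooth_fun setT f) (f_neq0 : forall q, f q != 0).
Variables (D : (P -> 'cV[R]_n) -> (P -> 'cV[R]_n) -> (P -> 'cV[R]_n)).
Hypotheses (D_poisson : poisson_connection w D) (D_torsion : torsion_free w D).
Variables (U : set P) (e : 'I_n -> P -> 'rV[R]_n) (theta : 'I_n -> P -> 'cV[R]_n).
Hypotheses (oU : open U) (e_frame : local_frame U e) (theta_dual : dual_coframe U e theta).
Variable Gamma : 'I_n -> 'I_n -> 'I_n -> P -> R.
Hypothesis GammaE : forall i j p, U p ->
  restrict_cd D (theta i) (theta j) p = \sum_(k < n) Gamma i j k p *: theta k p.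

Let phi q := ln `|f q|.
Let L i h := lie_fun (sharp w (theta i)) h.
Let H i j p := (\sum_(k < n) L k phi p * Gamma i j k p) - L i (L j phi) p.

Lemma smooth_dlog : smooth_form1 setT (dfun phi).
Proof.
have sV : smooth_fun setT (fun q => (f q)^-1).
  move=> x; apply: (sm_smooth (open_img (x := x) openT)).
  apply: (sm_inv _ (smooth_fun_smf x f_smooth)) => y _; exact: f_neq0.
have s0 := smooth_form1_lin openT sV (smooth_form1_dfun openT f_smooth) (smooth_form1_0 _).
refine (smooth_form1_ext openT _ s0) => q _.
by rewrite addr0 (dfun_log f_smooth).
Qed.

Let D_cd : contravariant_derivative w D := D_poisson.1.

Section AtPoint.
Variables (p : P) (Up : U p).

Let aw : Defs.alternating 2 (w p) := (let: And3 sw _ _ := w_symplectic in sw).1 p I.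
Let nw : forall v, (forall u, w p [:: v; u] = 0) -> v = 0 :=
  let: And3 _ _ nw := w_symplectic in nw p.
Let eu : (\matrix_i e i p) \in unitmx := e_frame.2 p Up.
Let dual i j : kpair (theta i p) (e j p) = (i == j)%:R := theta_dual.2 p Up i j.

Let th_at i : smooth_at p (theta i).
Proof. by exists U; split; [exact: oU|exact: Up|exact: theta_dual.1]. Qed.

Let Th i := globalize p (theta i).
Let Ths i : smooth_form1 setT (Th i). Proof. by have [] := globalizeP (th_at i). Qed.
Let ThE i : \forall q \near p, Th i q = theta i q. Proof. by have [] := globalizeP (th_at i). Qed.
Let Thp i : Th i p = theta i p. Proof. exact: nbhs_singleton (ThE i). Qed.

(** Both sides are tested on the vectors sharp theta^l, to which the covectors flat(e_j) are dual up
    to sign; there [cd_poisson] is applied to Pi(d phi, theta^l), which is the function L_l phi near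
    [p]. *)
Lemma cd_dlog i : D (Th i) (dfun phi) p = \sum_j H i j p *: flat_at (w p) (e j p).
Proof.
apply: (covector_sharp_ext aw nw eu dual) => l; rewrite (flat_frame aw nw dual).
have := cd_poisson p D_cd w_symplectic D_poisson.2 (Ths i) smooth_dlog (Ths l).
rewrite /poisson -![pair _ _]/(kpair _ _) Thp -[D (Th i) (Th l) p]/(restrict_cd D (theta i) (theta l) p).
rewrite GammaE // (poisson_skew aw nw (dfun phi p)) kpair_suml.
have -> : lie_fun (sharp w (Th i)) (fun q => pair (dfun phi q) (sharp_at (w q) (Th l q))) p
   = L i (L l phi) p.
  have E : \forall q \near p, pair (dfun phi q) (sharp_at (w q) (Th l q)) = L l phi q.
    by apply: filterS (ThE l) => q ->.
  by rewrite /L [LHS]/lie_fun /sharp Thp (dfun_near E).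
move=> E; rewrite /H opprB E.
have -> : \sum_(k < n) L k phi p * Gamma i l k p
   = - \sum_(k < n) Gamma i l k p * kpair (theta k p) (sharp_at (w p) (dfun phi p)).
  rewrite -sumrN; apply: eq_bigr => k _; rewrite (poisson_skew aw nw (theta k p)) mulrN opprK mulrC.
  by [].
by rewrite opprK subrK.
Qed.

Let Bf x := globalize p (dfun (fun_with_diff p x)).

Lemma cd_coord x : D (dfun phi) (Bf x) p =
  \sum_i kpair x (e i p) *: D (Th i) (dfun phi) p
  - dfun (fun q => poisson w q [:: dfun phi q; dfun (fun_with_diff p x) q]) p.
Proof.
have [fK [mu [_ _ muC muE]]] := dlog_rep p f_smooth f_neq0.
have [sB BE] := globalizeP (smooth_at_fun_with_diff p x).
rewrite (torsion_exact w_symplectic D_torsion x smooth_dlog muE muC); congr (_ - _).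
apply: (cd_point D_cd sB Ths smooth_dlog).
rewrite (nbhs_singleton BE) dfun_fun_with_diff {1}(coframe_expand eu dual x).
by apply: eq_bigr => i _; rewrite Thp.
Qed.

Lemma modular_frame a A s : smooth_mvfield a setT A ->
  modular w (fun p s => f p * liouville_form m w p s) a A p s =
    (-1) ^+ a * (\sum_(i < n) \sum_(j < n)
       L i phi p * w p [:: e i p; e j p] * cd_mvfield w D (theta j) A p s)
    + \sum_(i < n) \sum_(j < n) H i j p
       * wedge (mvfield_of (e i) p) (interior_form (form_of (flat w (e j)) p) (A p)) s.
Proof.
move=> sA; have aA := sA.1 p I; have mA := alternating_multilin aA.
set h := fun q => A q [seq dfun (fun_with_diff p x) q | x <- s].
pose Ai k x := A p (set_nth 0 s k x).
rewrite (_ : modular _ _ _ _ _ _ = if size s == a then (-1) ^+ a *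
    (kpair (dfun phi p) (sharp_at (w p) (dfun h p)) - \sum_(k < size s) Ai k
      (dfun (fun q => poisson w q [:: dfun phi q; dfun (fun_with_diff p (nth 0 s k)) q]) p))
    else 0); last exact: modular_lie.
(* Summed over i, the coefficient of D_(theta^j) A is -d phi(e_j), so the first double sum is -D_(d
   phi) A. *)
pose c j := - kpair (dfun phi p) (e j p).
have cE j : \sum_i L i phi p * w p [:: e i p; e j p] = c j.
  exact: (frame_contract aw nw eu dual).
have dphiE : dfun phi p = \sum_j (- c j) *: Th j p.
  rewrite [LHS](coframe_expand eu dual); apply: eq_bigr => j _; by rewrite opprK Thp.
have cdE j : cd_mvfield w D (theta j) A p s =
    kpair (dfun h p) (sharp_at (w p) (theta j p))
    - \sum_(k < size s) Ai k (D (Th j) (Bf (nth 0 s k)) p).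
  rewrite /cd_mvfield; congr (_ - _).
    by rewrite /lie_fun /h; under eq_fun => q do rewrite -map_comp.
  apply: eq_bigr => k _; rewrite /Ai (nth_map 0) //.
have E1 : \sum_(i < n) \sum_(j < n) L i phi p * w p [:: e i p; e j p] * cd_mvfield w D (theta j) A p s
  = kpair (dfun phi p) (sharp_at (w p) (dfun h p))
    + \sum_(k < size s) Ai k (D (dfun phi) (Bf (nth 0 s k)) p).
  rewrite exchange_big /=.
  rewrite (eq_bigr (fun j => c j * cd_mvfield w D (theta j) A p s)); last first.
    by move=> j _; rewrite -mulr_suml cE.
  rewrite (eq_bigr (fun j => c j * kpair (dfun h p) (sharp_at (w p) (theta j p))
     - \sum_(k < size s) c j * Ai k (D (Th j) (Bf (nth 0 s k)) p))); last first.
    by move=> j _; rewrite cdE mulrBr mulr_sumr.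
  rewrite big_split /= sumrN exchange_big /=; congr (_ + _).
    rewrite dphiE kpair_suml; apply: eq_bigr => j _.
    by rewrite Thp (poisson_skew aw nw) mulrN [RHS]mulNr.
  rewrite -sumrN; apply: eq_bigr => k _.
  have [sB _] := globalizeP (smooth_at_fun_with_diff p (nth 0 s k)).
  rewrite (cd_point D_cd smooth_dlog Ths sB dphiE) /Ai multilin_set_nth // -sumrN.
  by apply: eq_bigr => j _; rewrite [RHS]mulNr.
(* [wedge_interior] puts flat(e_j) in one slot at a time, and by [cd_dlog] the sum over j rebuilds
   D_(theta^i) d phi there. *)
have E2 : \sum_(i < n) \sum_(j < n) H i j p
       * wedge (mvfield_of (e i) p) (interior_form (form_of (flat w (e j)) p) (A p)) s
  = - (-1) ^+ size s * \sum_(k < size s)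
      Ai k (\sum_i kpair (nth 0 s k) (e i p) *: D (Th i) (dfun phi) p).
  rewrite mulr_sumr.
  rewrite (eq_bigr (fun i => \sum_(k < size s) - (-1) ^+ size s *
     (kpair (nth 0 s k) (e i p) * Ai k (D (Th i) (dfun phi) p)))); last first.
    move=> i _; rewrite (eq_bigr (fun j => \sum_(k < size s) - (-1) ^+ size s *
      (kpair (nth 0 s k) (e i p) * (H i j p * Ai k (flat_at (w p) (e j p)))))); last first.
      move=> j _; rewrite (wedge_interior _ _ _ aA) dsumE mulrCA mulr_sumr mulr_sumr.
      apply: eq_bigr => k _; congr (_ * _).
      have := multilin_set_nth (fun _ : 'I_1 => kpair (nth 0 s k) (e i p))
        (fun=> flat_at (w p) (e j p)) mA (ltn_ord k).
      by rewrite !big_ord1 => ->; rewrite mulrCA.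
    rewrite exchange_big; apply: eq_bigr => k _ /=.
    by rewrite cd_dlog /Ai multilin_set_nth // !mulr_sumr.
  rewrite exchange_big; apply: eq_bigr => k _ /=.
  by rewrite /Ai multilin_set_nth // mulr_sumr.
rewrite E1 E2.
have E3 (k : 'I_(size s)) : Ai k (D (dfun phi) (Bf (nth 0 s k)) p) =
    Ai k (\sum_i kpair (nth 0 s k) (e i p) *: D (Th i) (dfun phi) p)
    - Ai k (dfun (fun q => poisson w q [:: dfun phi q; dfun (fun_with_diff p (nth 0 s k)) q]) p).
  by rewrite cd_coord /Ai !set_nthE ltn_ord multilinB.
rewrite (eq_bigr _ (fun k _ => E3 k)) big_split /= sumrN.
(* On lists of the wrong length [A] vanishes, and [h] is identically zero, so its differential
   vanishes too. *)
case: eqVneq => [sz|ne]; last first.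
  have Ai0 (k : 'I_(size s)) x : Ai k x = 0.
    by rewrite /Ai (alternating_degree aA) // size_set_nth_id.
  rewrite !big1 => [|k _|k _]; [|exact: Ai0|exact: Ai0].
  have -> : h = (fun=> 0).
    by apply/funext => q; rewrite /h (alternating_degree (sA.1 q I)) // size_map.
  have -> : dfun (fun _ : P => 0 : R) p = 0.
    by apply/colP => i; rewrite !mxE derive_cst.
  rewrite (poisson_skew aw nw) /kpair mulmx0 mxE.
  by rewrite oppr0 !addr0 !mulr0 addr0.
have -> : (-1) ^+ size s = (-1) ^+ a :> R by rewrite sz.
have signs (u x y z : R) : u * (z - y) = u * (z + (x - y)) + - u * x by ring.
exact: signs.
Qed.

End AtPoint.
End ModularConnection.

Theorem theorem5p15 (R : realType) (m : nat) (P : manifold R (2 * m))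
    (omega : P -> seq 'rV[R]_(2 * m) -> R) (omega_symplectic : symplectic omega)
    (f : P -> R) (f_smooth : smooth_fun setT f) (f_neq0 : forall p, f p != 0)
    (U : chart R (2 * m) P) (U_smooth : smooth_chart U)
    (e : 'I_(2 * m) -> P -> 'rV[R]_(2 * m)) (e_frame : local_frame (chart_dom U) e)
    (theta : 'I_(2 * m) -> P -> 'cV[R]_(2 * m))
    (theta_dual : dual_coframe (chart_dom U) e theta)
    (D : (P -> 'cV[R]_(2 * m)) -> (P -> 'cV[R]_(2 * m)) -> (P -> 'cV[R]_(2 * m)))
    (D_poisson : poisson_connection omega D) (D_torsion : torsion_free omega D)
    (Gamma : 'I_(2 * m) -> 'I_(2 * m) -> 'I_(2 * m) -> P -> R)
    (GammaE : forall i j p, chart_dom U p ->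
       restrict_cd D (theta i) (theta j) p =
       \sum_(k < 2 * m) Gamma i j k p *: theta k p)
    (a : nat) (A : P -> seq 'cV[R]_(2 * m) -> R)
    (A_smooth : smooth_mvfield a setT A) :
  let nu := fun p s => f p * liouville_form m omega p s in
  let L := fun i h => lie_fun (sharp omega (theta i)) h in
  let log_f := fun p => ln `|f p| in
  forall p, chart_dom U p -> forall s : seq 'cV[R]_(2 * m),
    modular omega nu a A p s =
    (-1) ^+ a * (\sum_(i < 2 * m) \sum_(j < 2 * m)
       L i log_f p * omega p [:: e i p; e j p]
       * cd_mvfield omega D (theta j) A p s)
    + \sum_(i < 2 * m) \sum_(j < 2 * m)
       ((\sum_(k < 2 * m) L k log_f p * Gamma i j k p) - L i (L j log_f) p)
       * wedge (mvfield_of (e i) p)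
               (interior_form (form_of (flat omega (e j)) p) (A p)) s.
Proof.
move=> nu L log_f p Up s.
have mm : (m + m)%N = (2 * m)%N by rewrite mul2n addnn.
exact: (modular_frame omega_symplectic mm f_smooth f_neq0 D_poisson D_torsion
  (@open_dom _ _ _ U) e_frame theta_dual GammaE Up s A_smooth).
Qed.
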